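(* Let $\omega=(\omega^\iota_j)$ be connection data, let $\underline{\mathcal O}^\omega$ be the formal $\omega$-orthogonalization procedure, and let $\underline{\mathcal O}^{\mathrm f\omega}$ be its floating counterpart. Then: (a) $\underline{\mathcal O}^\omega$ is a formal FQ orthogonalization procedure (it satisfies (vR), (Frm), (\underline{Ana}), (Nat), (CP)), with (vL), (vC), (\underline{H}$^0$), and it satisfies (\underline{FSt}). In the case $\omega=\mathrm{GS}$ it is the formal restriction of $\mathcal O^{\mathrm{GS}}$ (the restriction to the domain described in (Frm)), and in the case $\omega=\mathrm{Sy}$ it has the properties (\underline{PSy}), ($\Sigma$), (O). (b) $\underline{\mathcal O}^{\mathrm f\omega}$ is a formal FQ conform-orthogonalization procedure (it satisfies (vR), (Biv'), (Frm'), (\underline{Ana}'), (Nat), (CP')), with (vL), (vC'), and it satisfies (\underline{FSt}). In the case $\omega=\mathrm{GS}$ it is the formal restriction of $\mathcal O^{\mathrm{fGS}}$ (the restriction to the domain described in (Frm')), and in the case $\omega=\mathrm{Sy}$ it has the properties (\underline{PSy}'), ($\Sigma$), (O).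
   Context: Convenient algebra: a unital real algebra $\mathfrak A$ with a decreasing filtration $\mathfrak A=\mathfrak A^{(0)}\supset\mathfrak A^{(1)}\supset\cdots$, $\mathfrak A^{(i)}\mathfrak A^{(j)}\subset\mathfrak A^{(i+j)}$, complete and Hausdorff for the filtration, with all $\mathfrak A/\mathfrak A^{(i)}$ finite-dimensional. Convergence means convergence in every $\mathfrak A/\mathfrak A^{(i)}$. Homomorphisms are unital and filtration-preserving. Clifford system: $(Q_1,\ldots,Q_n)$ with $Q_iQ_j+Q_jQ_i=-2\delta_{ij}1$. Floating Clifford system: $(Q_1,\ldots,Q_n)$ with $(Q_2Q_1^{-1},\ldots,Q_nQ_1^{-1})$ a Clifford system. For $Q^2=\pm1$: $R^0_Q=\frac12(R+Q^{-1}RQ)$, $R^1_Q=\frac12(R-Q^{-1}RQ)$, iterated as $R^{\iota_1}_{Q_1}{}^{\iota_2}_{Q_2}\cdots$. For a Clifford system $Q$, $\iota\in\{0,1\}^n$: $(R/Q)^\iota_j=(R_jQ_j^{-1}){}^{\iota_1}_{Q_1}\cdots{}^{\iota_n}_{Q_n}$. For a floating Clifford system $Q$ (any $k$; differences modulo $2$; independent of $k$): $(R/Q)^{\mathrm f\iota}_j=(R_jQ_j^{-1}){}^{\iota_1-\iota_k}_{Q_1Q_k^{-1}}\cdots{}^{\iota_n-\iota_k}_{Q_nQ_k^{-1}}$, $(Q\backslash R)^{\mathrm f\iota}_j=(Q_j^{-1}R_j){}^{\iota_1-\iota_k}_{Q_k^{-1}Q_1}\cdots{}^{\iota_n-\iota_k}_{Q_k^{-1}Q_n}$.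 Connection data: reals $\omega^\iota_j$ ($j\in\{1,\ldots,n\}$, $\iota\in\{0,1\}^n$) with $\omega^\iota_j=0$ if $\iota_j=0$ and $\sum_j\omega^\iota_j=1$ if $\iota\ne(0,\ldots,0)$. GS: $\omega^\iota_j=1$ if $j=\min\{h:\iota_h=1\}$, else $0$. Sy: $\omega^\iota_j=\iota_j/(\iota_1+\cdots+\iota_n)$ for $\iota\neq(0,\ldots,0)$, and $0$ for $\iota=(0,\ldots,0)$. Put $\Pi^\omega_QR=\frac12\sum_{j,\iota}\omega^\iota_j(R/Q)^\iota_j\in\mathfrak A$ and $\Pi^{\mathrm f\omega}_QR=\bigl(\frac12\sum\omega^\iota_j(R/Q)^{\mathrm f\iota}_j,(\frac12\sum\omega^\iota_j(Q\backslash R)^{\mathrm f\iota}_j)^{\mathrm{opp}}\bigr)\in\mathfrak A\times\mathfrak A^{\mathrm{opp}}$. With $(\mathrm{Ad}\,X)A=(XA_iX^{-1})_i$ and $(\mathrm{Ad}^{\mathrm f}(X,Y^{\mathrm{opp}}))A=(XA_iY)_i$, put $\mathrm{Step}^\omega_AQ=(\mathrm{Ad}\exp\Pi^\omega_Q(A-Q))Q$, $\mathrm{Step}^{\mathrm f\omega}_AQ=(\mathrm{Ad}^{\mathrm f}\exp^{\mathrm f}\Pi^{\mathrm f\omega}_Q(A-Q))Q$ (where $\exp^{\mathrm f}$ is the exponential of $\mathfrak A\times\mathfrak A^{\mathrm{opp}}$). Then $\underline{\mathcal O}^\omega(A)=\lim_k(\mathrm{Step}^\omega_A)^kQ$ for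 any Clifford system $Q$ with $A-Q\in(\mathfrak A^{(1)})^n$, and $\underline{\mathcal O}^{\mathrm f\omega}(A)=\lim_k(\mathrm{Step}^{\mathrm f\omega}_A)^kQ$ for any floating Clifford system $Q$ with $A-Q\in(\mathfrak A^{(1)})^n$ (limits exist and do not depend on $Q$). $\mathcal O^{\mathrm{GS}}(A_1,\ldots,A_n)=(Q_1,\ldots,Q_n)$ with $Q_1=\mathrm{pol}\,A_1$, $Q_k=\mathrm{pol}((A_k){}^1_{Q_1}\cdots{}^1_{Q_{k-1}})$, where $\mathrm{pol}\,H=\int_0^{2\pi}\frac{H}{\cos^2t-H^2\sin^2t}\frac{dt}{2\pi}$. $\mathcal O^{\mathrm{fGS}}(A)=(A_1,\tilde Q_2A_1,\ldots,\tilde Q_nA_1)$ with $(\tilde Q_2,\ldots,\tilde Q_n)=\mathcal O^{\mathrm{GS}}(A_2A_1^{-1},\ldots,A_nA_1^{-1})$. Conditions on an operation $\Psi$: (vR): $\Psi$ assigns to certain $n$-tuples from a convenient algebra $\mathfrak A$ another $n$-tuple from $\mathfrak A$. (Frm), resp. (Frm'): the domain consists of those $A$ for which there is a Clifford, resp. floating Clifford, system $Q$ with $A-Q\in(\mathfrak A^{(1)})^n$. (Nat): $\Psi(A)=B$ implies $\Psi(\phi(A))=\phi(B)$ for homomorphisms $\phi$; the domain on $\mathfrak A\oplus\mathfrak B$ contains the product of the domains. (\underline{Ana}): for a Clifford system $Q$ and $R\in(\mathfrak A^{(1)})^n$, $\Psi(Q+R)_k=\sum_{r\ge0}\sum\psi^{[k],j_1,\ldots,j_r}_{\iota_0,\ldots,\iota_r}Q^{\iota_0}R_{j_1}Q^{\iota_1}\cdots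 R_{j_r}Q^{\iota_r}$ with fixed real $\psi$ independent of $Q$ ($\iota_s\in\{0,1\}^n$, $Q^\iota=Q_1^{\iota_1}\cdots Q_n^{\iota_n}$). (\underline{Ana}'): for a floating Clifford system $Q$ and $R\in(\mathfrak A^{(1)})^n$, $\Psi(Q+R)_k=\sum_{r\ge0}\sum\psi^{[k],j_1,\ldots,j_r}_{\iota_0,\ldots,\iota_r}\tilde Q^{\iota_0}\tilde R_{j_1}\tilde Q^{\iota_1}\cdots\tilde R_{j_r}\tilde Q^{\iota_r}Q_1$ with fixed real $\psi$ independent of $Q$, where $\iota_s\in\{0,1\}^{n-1}$, $\tilde R_k=R_kQ_1^{-1}$, $\tilde Q=(Q_2Q_1^{-1},\ldots,Q_nQ_1^{-1})$. (Biv'): $\Psi(A)=B$ and $\theta_1,\theta_2$ invertible imply $\Psi((\theta_1A_i\theta_2)_i)=(\theta_1B_i\theta_2)_i$. (CP), resp. (CP'): values are Clifford, resp. floating Clifford, systems. (vC), resp. (vC'): $\Psi(Q)=Q$ for Clifford, resp. floating Clifford, systems $Q$. (vL): $\Psi(A)=B$ implies $\Psi(((-1)^{\iota_i}A_i)_i)=((-1)^{\iota_i}B_i)_i$ for $\iota\in\{0,1\}^n$. (\underline{H}$^0$): $\Psi(A)=B$ implies $\Psi((1+t)A_1,\ldots,(1+t)A_n)=B$ in $\mathfrak A[[t]]$, where $t$ is a formal commuting variable of filtration degree $1$. (\underline{FSt}): $\Psi(A)=B$ and $t\in\mathbb R$ imply $\Psi(tA_1+(1-t)B_1,\ldots,tA_n+(1-t)B_n)=B$.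 ($\Sigma$), resp. (O): $\Psi(A)=B$ implies $\Psi(UA)=UB$ for every permutation matrix, resp. every $U\in\mathrm O(n)$ (with $(UA)_i=\sum_jU_{ij}A_j$). (\underline{PSy}), resp. (\underline{PSy}'): formal permanence with respect to symmetric (conform-)orthogonalization. Let $V$ be a finite-dimensional real vector space with positive definite metric $q$, $\mathcal B=\mathbb R[[t_1,\ldots,t_m]]$ filtered by degree, and $a_1,\ldots,a_n\in V\otimes\mathcal B$ whose constant terms satisfy $q(a_i,a_j)|_{t=0}=\delta_{ij}$, resp. $=c\,\delta_{ij}$ with some $c>0$. Let $S=[q(a_j,a_i)]_{i,j}$, with $\sqrt S$, $\sqrt{S^{-1}}$ computed by binomial series, and $[\breve a_1\cdots\breve a_n]=[a_1\cdots a_n]\sqrt{S^{-1}}$, resp. $[a_1\cdots a_n]\sqrt{S^{-1}}\cdot\frac{\mathrm{tr}\sqrt S}{n}$. Then $\Psi(\mathrm{cl}(a_1),\ldots,\mathrm{cl}(a_n))=(\mathrm{cl}(\breve a_1),\ldots,\mathrm{cl}(\breve a_n))$ in $\mathrm{Cl}(V,q)\otimes\mathcal B$, where $\mathrm{cl}(v)^2=-q(v,v)$. *)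

(* Defs.v *)
From HB Require Import structures.
From mathcomp Require Import all_boot all_order all_algebra.
From mathcomp Require Import all_classical all_reals all_analysis.
Import Order.TTheory GRing.Theory Num.Theory.
Import numFieldNormedType.Exports.

Set Implicit Arguments.
Unset Strict Implicit.
Unset Printing Implicit Defensive.

Local Open Scope classical_set_scope.
Local Open Scope ring_scope.

(* [V / P] is finite-dimensional, for a linear subspace [P] of [V] *)
Definition fin_codim (R : realType) (V : lmodType R) (P : set V) : Prop :=
  exists s : seq V, forall x : V, exists c : nat -> R,
    P (x - \sum_(j < size s) c j *: s`_j).

(* Completeness is surjectivity of A -> lim_i A/A^(i): [u] stands for a
   compatible family of classes u_i mod A^(i). *)
Record convAlg (R : realType) := ConvAlg {
  ca_sort :> algType R;
  fil : nat -> set ca_sort;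
  fil_full : forall x, fil 0 x;
  fil_zero : forall i, fil i 0;
  fil_lin : forall i (c : R) x y, fil i x -> fil i y -> fil i (c *: x + y);
  fil_decr : forall i x, fil i.+1 x -> fil i x;
  fil_mul : forall i j x y, fil i x -> fil j y -> fil (i + j) (x * y);
  fil_hausdorff : forall x, (forall i, fil i x) -> x = 0;
  fil_complete : forall u : nat -> ca_sort,
    (forall i, fil i (u i.+1 - u i)) -> exists l, forall i, fil i (l - u i);
  fil_fin_codim : forall i, fin_codim (fil i)
}.
Arguments fil {R} A : rename.

Lemma fil_leq (R : realType) (A : convAlg R) i j x :
  (i <= j)%N -> fil A j x -> fil A i x.
Proof.
move=> /subnKC <-; elim: (j - i)%N => [|k IHk]; first by rewrite addn0.
by rewrite addnS => /fil_decr.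
Qed.

Lemma fil_add (R : realType) (A : convAlg R) i x y :
  fil A i x -> fil A i y -> fil A i (x + y).
Proof. by move=> Hx Hy; rewrite -[x]scale1r; apply: fil_lin. Qed.

Lemma fil_sum (R : realType) (A : convAlg R) i (I : Type) (r : seq I)
    (F : I -> A) :
  (forall k, fil A i (F k)) -> fil A i (\sum_(k <- r) F k).
Proof. by move=> HF; apply: big_ind => //; [exact: fil_zero|exact: fil_add]. Qed.

Section FinDim.
Variables (R : realType) (C : algType R).
Hypothesis Cfin : fin_codim [set (0 : C)].

Definition disc_fil (i : nat) : set C := [set x | (0 < i)%N -> x = 0].

Fact disc_full x : disc_fil 0 x. Proof. by []. Qed.
Fact disc_zero i : disc_fil i 0. Proof. by []. Qed.
Fact disc_lin i (c : R) x y :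
  disc_fil i x -> disc_fil i y -> disc_fil i (c *: x + y).
Proof. by move=> Hx Hy i0; rewrite Hx // Hy // scaler0 addr0. Qed.
Fact disc_decr i x : disc_fil i.+1 x -> disc_fil i x.
Proof. by move=> Hx _; apply: Hx. Qed.
Fact disc_mul i j x y :
  disc_fil i x -> disc_fil j y -> disc_fil (i + j) (x * y).
Proof.
case: i => [|i] Hx Hy; last by rewrite Hx // mul0r.
by move=> j0; rewrite Hy // mulr0.
Qed.
Fact disc_hausdorff x : (forall i, disc_fil i x) -> x = 0.
Proof. by move=> /(_ 1%N); apply. Qed.
Fact disc_complete (u : nat -> C) :
  (forall i, disc_fil i (u i.+1 - u i)) -> exists l, forall i, disc_fil i (l - u i).
Proof.
move=> Hu; exists (u 1%N) => -[|i] // _; elim: i => [|i IHi]; first by rewrite subrr.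
by have /eqP := Hu i.+1 isT; rewrite subr_eq0 => /eqP ->.
Qed.
Fact disc_fin_codim i : fin_codim (disc_fil i).
Proof. by have [s Hs] := Cfin; exists s => x; have [c Hc] := Hs x; exists c. Qed.

Definition fd_convAlg : convAlg R :=
  ConvAlg disc_full disc_zero disc_lin disc_decr disc_mul disc_hausdorff
    disc_complete disc_fin_codim.
End FinDim.

Lemma reals_fin (R : realType) : fin_codim [set (0 : R^o)].
Proof.
by exists [:: 1] => x; exists (fun=> x); rewrite big_ord1 /= /GRing.scale /= mulr1 subrr.
Qed.

Definition reals_convAlg (R : realType) : convAlg R := fd_convAlg (@reals_fin R).

Section Sum.
Variables (R : realType) (A B : convAlg R).

Definition sum_fil (i : nat) : set (A * B)%type :=
  [set x | fil A i x.1 /\ fil B i x.2].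

Fact sum_full x : sum_fil 0 x. Proof. by split; apply: fil_full. Qed.
Fact sum_zero i : sum_fil i 0. Proof. by split; apply: fil_zero. Qed.
Fact sum_lin i (c : R) x y : sum_fil i x -> sum_fil i y -> sum_fil i (c *: x + y).
Proof. by move=> [? ?] [? ?]; split; apply: fil_lin. Qed.
Fact sum_decr i x : sum_fil i.+1 x -> sum_fil i x.
Proof. by move=> [? ?]; split; apply: fil_decr. Qed.
Fact sum_mul i j x y : sum_fil i x -> sum_fil j y -> sum_fil (i + j) (x * y).
Proof. by move=> [? ?] [? ?]; split; apply: fil_mul. Qed.
Fact sum_hausdorff x : (forall i, sum_fil i x) -> x = 0.
Proof.
case: x => x y H; congr pair; apply: fil_hausdorff => i; by case: (H i).
Qed.
Fact sum_complete (u : nat -> (A * B)%type) :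
  (forall i, sum_fil i (u i.+1 - u i)) -> exists l, forall i, sum_fil i (l - u i).
Proof.
move=> Hu.
have [l Hl] := @fil_complete _ A (fun i => (u i).1) (fun i => (Hu i).1).
have [l' Hl'] := @fil_complete _ B (fun i => (u i).2) (fun i => (Hu i).2).
by exists (l, l') => i; split; [apply: Hl|apply: Hl'].
Qed.
Fact sum_fin_codim i : fin_codim (sum_fil i).
Proof.
have [s Hs] := fil_fin_codim A i; have [s' Hs'] := fil_fin_codim B i.
exists ([seq (x, 0) | x <- s] ++ [seq (0, y) | y <- s']) => x.
have [c Hc] := Hs x.1; have [c' Hc'] := Hs' x.2.
exists (fun j => if (j < size s)%N then c j else c' (j - size s)%N).
rewrite size_cat !size_map big_split_ord /=.
rewrite (eq_bigr (fun j : 'I_(size s) => (c j *: s`_j, 0))); last first.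
  move=> j _; rewrite ltn_ord nth_cat size_map ltn_ord (nth_map 0) ?ltn_ord //.
  by transitivity (c j *: s`_j, c j *: (0 : B)) => //; rewrite scaler0.
rewrite [X in _ - (_ + X)](eq_bigr (fun j : 'I_(size s') => (0, c' j *: s'`_j))); last first.
  move=> j _; rewrite ltnNge leq_addr /= nth_cat size_map ltnNge leq_addr /= addKn.
  rewrite (nth_map 0) ?ltn_ord //.
  by transitivity (c' j *: (0 : A), c' j *: s'`_j) => //; rewrite scaler0.
have -> : \sum_(j < size s) (c j *: s`_j, 0 : B) = (\sum_(j < size s) c j *: s`_j, 0).
  by elim/big_rec2: _ => // j x1 x2 _ ->; congr pair; rewrite addr0.
have -> : \sum_(j < size s') (0 : A, c' j *: s'`_j) = (0, \sum_(j < size s') c' j *: s'`_j).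
  by elim/big_rec2: _ => // j x1 x2 _ ->; congr pair; rewrite addr0.
by split => /=; rewrite ?addr0 ?add0r.
Qed.

Definition sum_convAlg : convAlg R :=
  ConvAlg sum_full sum_zero sum_lin sum_decr sum_mul sum_hausdorff sum_complete
    sum_fin_codim.
End Sum.

Definition midx (m : nat) := {ffun 'I_m -> nat}.

Section MultiIndex.
Variable m : nat.
Implicit Types a b c : midx m.

Definition mdeg a : nat := (\sum_i a i)%N.
Definition mle a b : bool := [forall i, a i <= b i]%N.
Definition madd a b : midx m := [ffun i => a i + b i]%N.
Definition msub a b : midx m := [ffun i => a i - b i]%N.
Definition m0 : midx m := [ffun => 0%N].
Definition m1 (i : 'I_m) : midx m := [ffun j => (j == i) : nat].

Definition mbox (d : nat) : seq (midx m) :=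
  codom (fun f : {ffun 'I_m -> 'I_d.+1} => [ffun i => val (f i)] : midx m).
Definition mbelow c : seq (midx m) := [seq a <- mbox (mdeg c) | mle a c].

Lemma mleP a b : reflect (forall i, a i <= b i)%N (mle a b).
Proof. exact: forallP. Qed.

Lemma coord_mdeg a i : (a i <= mdeg a)%N.
Proof. by rewrite /mdeg (bigD1 i) //= leq_addr. Qed.

Lemma mem_mbox d a : (mdeg a <= d)%N -> a \in mbox d.
Proof.
move=> Hd; apply/codomP; exists [ffun i => inord (a i)].
apply/ffunP => i; rewrite !ffunE /= inordK // ltnS.
exact: leq_trans (coord_mdeg a i) Hd.
Qed.

Lemma mle_mdeg a b : mle a b -> (mdeg a <= mdeg b)%N.
Proof. by move=> /mleP H; apply: leq_sum => i _. Qed.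

Lemma mem_mbelow a c : (a \in mbelow c) = mle a c.
Proof.
rewrite mem_filter; case: (boolP (mle a c)) => //= H.
exact/mem_mbox/mle_mdeg.
Qed.

Lemma mbelow_uniq c : uniq (mbelow c).
Proof.
apply: filter_uniq; rewrite map_inj_uniq ?enum_uniq // => f g /ffunP H; apply/ffunP => i.
by apply: val_inj; have := H i; rewrite !ffunE.
Qed.

Lemma mdeg_sub a c : mle a c -> (mdeg a + mdeg (msub c a) = mdeg c)%N.
Proof.
move=> /mleP H; rewrite /mdeg -big_split; apply: eq_bigr => i _ /=.
by rewrite ffunE subnKC.
Qed.

Lemma perm_mbelow_le c d : mle c d ->
  perm_eq (mbelow c) [seq a <- mbelow d | mle a c].
Proof.
move=> cd; apply: uniq_perm; [exact: mbelow_uniq|exact/filter_uniq/mbelow_uniq|move=> a].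
rewrite mem_mbelow mem_filter mem_mbelow; case: (boolP (mle a c)) => //= /mleP ac.
by apply/esym/mleP => i; apply: leq_trans (ac i) _; move/mleP: cd.
Qed.

Lemma madd_inj a : injective (madd a).
Proof.
move=> b c /ffunP H; apply/ffunP => i; have := H i; rewrite !ffunE.
exact: addnI.
Qed.

Lemma maddK a b : msub (madd a b) a = b.
Proof. by apply/ffunP => i; rewrite !ffunE addKn. Qed.

Lemma msub_add d a b : msub d (madd a b) = msub (msub d a) b.
Proof. by apply/ffunP => i; rewrite !ffunE subnDA. Qed.

Lemma perm_mbelow_sub a d : mle a d ->
  perm_eq [seq c <- mbelow d | mle a c] [seq madd a b | b <- mbelow (msub d a)].
Proof.
move=> ad; apply: uniq_perm.
- exact/filter_uniq/mbelow_uniq.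
- by rewrite (map_inj_uniq (@madd_inj a)) mbelow_uniq.
move=> c; rewrite mem_filter mem_mbelow; apply/andP/mapP.
  move=> [ac cd]; exists (msub c a).
    rewrite mem_mbelow; apply/mleP => i; rewrite !ffunE leq_sub2r //.
    by move/mleP: cd.
  by apply/ffunP => i; rewrite !ffunE subnKC //; move/mleP: ac.
move=> [b]; rewrite mem_mbelow => /mleP bd ->; split; apply/mleP => i.
  by rewrite ffunE leq_addr.
have := bd i; rewrite !ffunE => H.
by rewrite -(subnKC (mleP _ _ ad i)) leq_add2l.
Qed.
End MultiIndex.

(* Coefficient at [c] of the product of two power series, for any
   bi-additive pairing [op] of the coefficients *)
Definition cauchy (m : nat) (X Y : Type) (Z : nmodType) (op : X -> Y -> Z)
    (f : midx m -> X) (g : midx m -> Y) (c : midx m) : Z :=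
  \sum_(a <- mbelow c) op (f a) (g (msub c a)).

Record pser (m : nat) (A : Type) := PSer { pcoef :> midx m -> A }.
Arguments PSer {m A}.

Lemma pserP (m : nat) (A : Type) (f g : pser m A) : f =1 g -> f = g.
Proof. by case: f => f; case: g => g /= /funext ->. Qed.

HB.instance Definition _ (m : nat) (A : Type) := gen_eqMixin (pser m A).
HB.instance Definition _ (m : nat) (A : Type) := gen_choiceMixin (pser m A).

Section Pser.
Variables (m : nat) (R : realType) (A : algType R).
Local Notation P := (pser m A).
Implicit Types f g h : P.

Definition ps_zero : P := PSer (fun=> 0).
Definition ps_opp f : P := PSer (fun a => - f a).
Definition ps_add f g : P := PSer (fun a => f a + g a).
Definition ps_scale (c : R) f : P := PSer (fun a => c *: f a).
Definition psC (x : A) : P := PSer (fun a => if a == m0 m then x else 0).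
Definition psX (i : 'I_m) : P := PSer (fun a => if a == m1 i then 1 else 0).
Definition ps_mul f g : P := PSer (cauchy (fun x y : A => x * y) f g).

Fact ps_addA : associative ps_add.
Proof. by move=> f g h; apply: pserP => a /=; rewrite addrA. Qed.
Fact ps_addC : commutative ps_add.
Proof. by move=> f g; apply: pserP => a /=; rewrite addrC. Qed.
Fact ps_add0 : left_id ps_zero ps_add.
Proof. by move=> f; apply: pserP => a /=; rewrite add0r. Qed.
Fact ps_addN : left_inverse ps_zero ps_opp ps_add.
Proof. by move=> f; apply: pserP => a /=; rewrite addNr. Qed.
HB.instance Definition _ := GRing.isZmodule.Build P ps_addA ps_addC ps_add0 ps_addN.

Fact ps_scaleA a b f : ps_scale a (ps_scale b f) = ps_scale (a * b) f.
Proof. by apply: pserP => c /=; rewrite scalerA. Qed.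
Fact ps_scale1 : left_id 1 ps_scale.
Proof. by move=> f; apply: pserP => c /=; rewrite scale1r. Qed.
Fact ps_scaleDr : right_distributive ps_scale +%R.
Proof. by move=> a f g; apply: pserP => c /=; rewrite scalerDr. Qed.
Fact ps_scaleDl f : {morph ps_scale^~ f : a b / a + b}.
Proof. by move=> a b; apply: pserP => c /=; rewrite scalerDl. Qed.
HB.instance Definition _ :=
  GRing.Zmodule_isLmodule.Build R P ps_scaleA ps_scale1 ps_scaleDr ps_scaleDl.

Fact ps_mulA : associative ps_mul.
Proof.
move=> f g h; apply: pserP => d /=; rewrite /cauchy /=.
under eq_bigr do rewrite /cauchy mulr_sumr.
transitivity (\sum_(c <- mbelow d) \sum_(a <- mbelow d | mle a c)
    f a * g (msub c a) * h (msub d c)); last first.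
  rewrite big_seq [RHS]big_seq; apply: eq_bigr => c; rewrite mem_mbelow => cd.
  by rewrite /cauchy mulr_suml (perm_big _ (perm_mbelow_le cd)) big_filter.
rewrite (exchange_big_dep predT) //=.
rewrite big_seq [RHS]big_seq; apply: eq_bigr => a; rewrite mem_mbelow => ad.
rewrite -[RHS]big_filter (perm_big _ (perm_mbelow_sub ad)) /= big_map.
by apply: eq_bigr => b _; rewrite maddK msub_add mulrA.
Qed.

Lemma mbelow_only (Z : nmodType) (F : midx m -> Z) a c : mle a c ->
  (forall b, mle b c -> b != a -> F b = 0) -> \sum_(b <- mbelow c) F b = F a.
Proof.
move=> ac H; rewrite (bigD1_seq a) ?mbelow_uniq ?mem_mbelow //= big_seq_cond.
by rewrite big1 ?addr0 // => b /andP[]; rewrite mem_mbelow; exact: H.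
Qed.

Fact ps_mul1 : left_id (psC 1) ps_mul.
Proof.
move=> f; apply: pserP => c /=; rewrite /cauchy (@mbelow_only _ _ (m0 m)) /=.
- by rewrite eqxx mul1r; congr (f _); apply/ffunP => i; rewrite !ffunE subn0.
- by apply/mleP => i; rewrite ffunE.
- by move=> b _ /negbTE ->; rewrite mul0r.
Qed.
Fact ps_mulr1 : right_id (psC 1) ps_mul.
Proof.
move=> f; apply: pserP => c /=; rewrite /cauchy (@mbelow_only _ _ c) /=.
- suff -> : msub c c = m0 m by rewrite eqxx mulr1.
  by apply/ffunP => i; rewrite !ffunE subnn.
- exact/mleP.
- move=> b /mleP bc bNc; case: eqP => [/ffunP H|_]; last by rewrite mulr0.
  case/eqP: bNc; apply/ffunP => i; apply/eqP; rewrite eqn_leq bc /=.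
  by have := H i; rewrite !ffunE => /eqP.
Qed.
Fact ps_mulDl : left_distributive ps_mul ps_add.
Proof.
move=> f g h; apply: pserP => c /=; rewrite /cauchy -big_split /=.
by apply: eq_bigr => a _; rewrite mulrDl.
Qed.
Fact ps_mulDr : right_distributive ps_mul ps_add.
Proof.
move=> f g h; apply: pserP => c /=; rewrite /cauchy -big_split /=.
by apply: eq_bigr => a _; rewrite mulrDr.
Qed.
Fact ps_1neq0 : psC 1 != 0 :> P.
Proof.
apply/eqP => /(congr1 (fun f : P => f (m0 m))) /=.
by rewrite eqxx; apply/eqP; rewrite oner_eq0.
Qed.
HB.instance Definition _ := GRing.Zmodule_isNzRing.Build P
  ps_mulA ps_mul1 ps_mulr1 ps_mulDl ps_mulDr ps_1neq0.

Fact ps_scaleAl (c : R) (f g : P) : c *: (f * g) = (c *: f) * g.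
Proof.
apply: pserP => a /=; rewrite /cauchy scaler_sumr.
by apply: eq_bigr => b _; rewrite scalerAl.
Qed.
HB.instance Definition _ := GRing.Lmodule_isLalgebra.Build R P ps_scaleAl.
Fact ps_scaleAr (c : R) (f g : P) : c *: (f * g) = f * (c *: g).
Proof.
apply: pserP => a /=; rewrite /cauchy scaler_sumr.
by apply: eq_bigr => b _; rewrite scalerAr.
Qed.
HB.instance Definition _ := GRing.Lalgebra_isAlgebra.Build R P ps_scaleAr.

Lemma ps_sumE (I : Type) (r : seq I) (F : I -> P) a :
  (\sum_(i <- r) F i) a = \sum_(i <- r) F i a.
Proof. by elim/big_rec2: _ => // i x y _ <-. Qed.
End Pser.

Section PserConv.
Variables (m : nat) (R : realType) (A : convAlg R).
Local Notation P := (pser m A).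

(* the variables have filtration degree 1 *)
Definition ps_fil (i : nat) : set P :=
  [set f | forall a, fil A (i - mdeg a) (f a)].

Fact ps_full f : ps_fil 0 f. Proof. by move=> a; apply: fil_full. Qed.
Fact ps_fil0 i : ps_fil i 0. Proof. by move=> a; apply: fil_zero. Qed.
Fact ps_lin i (c : R) f g : ps_fil i f -> ps_fil i g -> ps_fil i (c *: f + g).
Proof. by move=> Hf Hg a; apply: fil_lin. Qed.
Fact ps_decr i f : ps_fil i.+1 f -> ps_fil i f.
Proof. by move=> Hf a; apply: fil_leq (Hf a); rewrite leq_sub2r. Qed.
Fact ps_fil_mul i j f g : ps_fil i f -> ps_fil j g -> ps_fil (i + j) (f * g).
Proof.
move=> Hf Hg c /=; rewrite /cauchy big_seq; apply: big_ind.
- exact: fil_zero.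
- exact: fil_add.
move=> a; rewrite mem_mbelow => /mdeg_sub <-.
apply: fil_leq (fil_mul (Hf a) (Hg _)).
rewrite leq_subLR addnACA leq_add // -leq_subLR //.
Qed.
Fact ps_hausdorff f : (forall i, ps_fil i f) -> f = 0.
Proof.
move=> H; apply: pserP => a; apply: fil_hausdorff => i.
by have := H (i + mdeg a)%N a; rewrite addnK.
Qed.
Fact ps_complete (u : nat -> P) :
  (forall i, ps_fil i (u i.+1 - u i)) -> exists l, forall i, ps_fil i (l - u i).
Proof.
move=> Hu.
have Ha a : exists l : A, forall i, fil A i (l - u (i + mdeg a)%N a).
  by apply: fil_complete => i; have := Hu (i + mdeg a)%N a; rewrite addnK.
have [l Hl] := choice Ha; exists (PSer l) => i a /=.
have [ai|/ltnW ia] := leqP (mdeg a) i.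
  by have := Hl a (i - mdeg a)%N; rewrite subnK.
by move: ia; rewrite -subn_eq0 => /eqP ->; apply: fil_full.
Qed.

Let mono (a : midx m) (x : A) : P := PSer (fun b => if b == a then x else 0).

Let fin_list (L : seq (midx m)) i :
  fin_codim [set f : P | forall a, a \in L -> fil A (i - mdeg a) (f a)].
Proof.
elim: L => [|a L [s Hs]].
  by exists [::] => f; exists (fun=> 0) => a; rewrite in_nil.
have [s' Hs'] := fil_fin_codim A (i - mdeg a).
exists (s ++ [seq mono a x | x <- s']) => f; have [c Hc] := Hs f.
set g := f - _ in Hc; have [c' Hc'] := Hs' (g a).
exists (fun j => if (j < size s)%N then c j else c' (j - size s)%N).
rewrite size_cat size_map big_split_ord.
rewrite (eq_bigr (fun j : 'I_(size s) => c j *: s`_j)); last first.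
  by move=> j _; rewrite /= ltn_ord nth_cat ltn_ord.
rewrite [X in _ - (_ + X)](eq_bigr (fun j : 'I_(size s') => mono a (c' j *: s'`_j))); last first.
  move=> j _; rewrite /= ltnNge leq_addr /= nth_cat ltnNge leq_addr /= addKn.
  rewrite (nth_map 0) ?ltn_ord //; apply: pserP => b /=.
  by case: eqP; rewrite ?scaler0.
rewrite opprD addrA -/g => b.
have -> : (g - \sum_(j < size s') mono a (c' j *: s'`_j)) b =
    g b - \sum_(j < size s') (if b == a then c' j *: s'`_j else 0).
  by congr (_ - _); rewrite ps_sumE.
have [->|ba] := eqVneq b a; first by move=> _; exact: Hc'.
by rewrite big1 // subr0 in_cons (negbTE ba); exact: Hc.
Qed.

Fact ps_fin_codim i : fin_codim (ps_fil i).
Proof.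
have [s Hs] := fin_list (mbox m i) i.
exists s => f; have [c Hc] := Hs f; exists c => a.
have [ai|ia] := leqP (mdeg a) i; first exact/Hc/mem_mbox.
by move/ltnW: ia; rewrite -subn_eq0 => /eqP ->; apply: fil_full.
Qed.

Definition pser_convAlg : convAlg R :=
  ConvAlg ps_full ps_fil0 ps_lin ps_decr ps_fil_mul ps_hausdorff ps_complete
    ps_fin_codim.
End PserConv.

(* Convergence and integration take place in the quotients A/A^(i), which are
   finite-dimensional real vector spaces; their topology is tested by the
   linear forms of A that vanish on A^(i). *)
Definition quot_form (R : realType) (A : convAlg R) (i : nat)
    (f : {linear A -> R^o}) : Prop := forall x, fil A i x -> f x = 0.

Definition cvgA (R : realType) (A : convAlg R) (u : nat -> A) (l : A) : Prop :=
  forall i (f : {linear A -> R^o}), quot_form i f ->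
    (fun k => f (u k) : R) @ \oo --> (f l : R).

Definition limA (R : realType) (A : convAlg R) (u : nat -> A) : A :=
  xget 0 [set l | cvgA u l].

Definition is_integral (R : realType) (A : convAlg R) (a b : R) (F : R -> A)
    (x : A) : Prop :=
  forall i (f : {linear A -> R^o}), quot_form i f ->
    (@lebesgue_measure R).-integrable `[a, b] (fun t => (f (F t) : R)%:E) /\
    \int[@lebesgue_measure R]_(t in `[a, b]) (f (F t) : R) = f x.

Definition invertible (A : nzRingType) (x : A) : Prop :=
  exists y, x * y = 1 /\ y * x = 1.

Definition inv (A : nzRingType) (x : A) : A :=
  xget 0 [set y | x * y = 1 /\ y * x = 1].

Definition expA (R : realType) (A : convAlg R) (x : A) : A :=
  limA (fun N => \sum_(k < N) (k`!%:R : R)^-1 *: x ^+ k).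

Definition clifford (R : realType) (A : convAlg R) (n : nat) (Q : 'I_n -> A) :
    Prop :=
  forall i j, Q i * Q j + Q j * Q i = (- 2%:R * (i == j)%:R : R) *: 1.

Definition fl_tail (A : nzRingType) (n : nat) (a : 'I_n.+1 -> A) : 'I_n -> A :=
  fun i => a (lift ord0 i) * inv (a ord0).

Definition fl_clifford (R : realType) (A : convAlg R) (n : nat)
    (Q : 'I_n.+1 -> A) : Prop :=
  invertible (Q ord0) /\ clifford (fl_tail Q).

Definition near (R : realType) (A : convAlg R) (n : nat) (a Q : 'I_n -> A) :
    Prop :=
  forall i, fil A 1 (a i - Q i).

Definition bvec (n : nat) := {ffun 'I_n -> bool}.

(* X^b_Q *)
Definition part (R : realType) (A : convAlg R) (Q : A) (b : bool) (X : A) : A :=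
  (2%:R^-1 : R) *: (X + (-1) ^+ b * (inv Q * X * Q)).

(* X^{b_1}_{Q_1}^{b_2}_{Q_2}..., restricted to the indices listed in [r] *)
Definition parts (R : realType) (A : convAlg R) (n : nat) (r : seq 'I_n)
    (Q : 'I_n -> A) (b : 'I_n -> bool) (X : A) : A :=
  foldl (fun Y i => part (Q i) (b i) Y) X r.

Section Procedures.
Variables (R : realType) (A : convAlg R).

Definition rquo (n : nat) (Q X : 'I_n -> A) (s : bvec n) (j : 'I_n) : A :=
  parts (enum 'I_n) Q s (X j * inv (Q j)).

(* addition modulo 2 of exponents is [addb] *)
Definition frquo (n : nat) (k : 'I_n) (Q X : 'I_n -> A) (s : bvec n)
    (j : 'I_n) : A :=
  parts (enum 'I_n) (fun i => Q i * inv (Q k)) (fun i => s i (+) s k)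
    (X j * inv (Q j)).

Definition flquo (n : nat) (k : 'I_n) (Q X : 'I_n -> A) (s : bvec n)
    (j : 'I_n) : A :=
  parts (enum 'I_n) (fun i => inv (Q k) * Q i) (fun i => s i (+) s k)
    (inv (Q j) * X j).

Definition weights (n : nat) := bvec n -> 'I_n -> R.

Definition connection_data (n : nat) (w : weights n) : Prop :=
  (forall (s : bvec n) j, s j = false -> w s j = 0) /\
  (forall s : bvec n, s != [ffun=> false] -> \sum_j w s j = 1).

Definition GSw (n : nat) : weights n := fun s j =>
  (s j && [forall h : 'I_n, (h < j)%N ==> ~~ s h])%:R.

Definition Syw (n : nat) : weights n := fun s j =>
  if s == [ffun=> false] then 0 else (s j)%:R / (\sum_h s h)%N%:R.

Definition Pi (n : nat) (w : weights n) (Q X : 'I_n -> A) : A :=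
  (2%:R^-1 : R) *: \sum_j \sum_s w s j *: rquo Q X s j.

(* The second component stands for an element of the opposite algebra, whose
   exponential is the one of A. *)
Definition fPi (n : nat) (k : 'I_n) (w : weights n) (Q X : 'I_n -> A) : A * A :=
  ((2%:R^-1 : R) *: \sum_j \sum_s w s j *: frquo k Q X s j,
   (2%:R^-1 : R) *: \sum_j \sum_s w s j *: flquo k Q X s j).

Definition Ad (n : nat) (X : A) (a : 'I_n -> A) : 'I_n -> A :=
  fun i => X * a i * inv X.

Definition fAd (n : nat) (XY : A * A) (a : 'I_n -> A) : 'I_n -> A :=
  fun i => XY.1 * a i * XY.2.

Definition fexp (XY : A * A) : A * A := (expA XY.1, expA XY.2).

Definition Step (n : nat) (w : weights n) (a Q : 'I_n -> A) : 'I_n -> A :=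
  Ad (expA (Pi w Q (fun i => a i - Q i))) Q.

Definition fStep (n : nat) (k : 'I_n) (w : weights n) (a Q : 'I_n -> A) :
    'I_n -> A :=
  fAd (fexp (fPi k w Q (fun i => a i - Q i))) Q.

Definition dom (n : nat) (a : 'I_n -> A) : Prop :=
  exists Q : 'I_n -> A, clifford Q /\ near a Q.

Definition fdom (n : nat) (a : 'I_n.+1 -> A) : Prop :=
  exists Q : 'I_n.+1 -> A, fl_clifford Q /\ near a Q.

(* [pol_at H P]: pol H is defined and equal to P *)
Definition pol_at (H P : A) : Prop :=
  let D (t : R) := (cos t ^+ 2)%:A - sin t ^+ 2 *: (H * H) in
  (forall t, 0 <= t <= 2%:R * pi -> invertible (D t)) /\
  is_integral 0 (2%:R * pi) (fun t => (2%:R * pi)^-1 *: (H * inv (D t))) P.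

Definition OGS_at (n : nat) (a Q : 'I_n -> A) : Prop :=
  forall k : 'I_n,
    pol_at (parts [seq i : 'I_n <- enum 'I_n | (i < k)%N] Q (fun=> true) (a k)) (Q k).

Definition OfGS_at (n : nat) (a B : 'I_n.+1 -> A) : Prop :=
  invertible (a ord0) /\
  exists2 Q : 'I_n -> A, OGS_at (fl_tail a) Q &
    B ord0 = a ord0 /\ forall i, B (lift ord0 i) = Q i * a ord0.
End Procedures.

(* [Psi A a b] reads: [a] belongs to the domain, and Psi(a) = b *)
Definition operation (R : realType) (n : nat) :=
  forall A : convAlg R, ('I_n -> A) -> ('I_n -> A) -> Prop.

(* The value is the limit for every admissible starting system, which includes
   the existence of the limits and their independence of this choice. *)
Definition O_proc (R : realType) (n : nat) (w : weights R n) : operation R n :=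
  fun A a b => dom a /\
    forall Q : 'I_n -> A, clifford Q -> near a Q ->
      forall i, cvgA (fun k => iter k (Step w a) Q i) (b i).

Definition fO_proc (R : realType) (n : nat) (w : weights R n.+1) :
    operation R n.+1 :=
  fun A a b => fdom a /\
    forall (h : 'I_n.+1) (Q : 'I_n.+1 -> A), fl_clifford Q -> near a Q ->
      forall i, cvgA (fun k => iter k (fStep h w a) Q i) (b i).

Definition O_GS (R : realType) (n : nat) : operation R n :=
  fun A a b => OGS_at a b.

Definition O_fGS (R : realType) (n : nat) : operation R n.+1 :=
  fun A a b => OfGS_at a b.

Section Conditions.
Variables (R : realType) (n : nat).

Definition restriction (D : forall A : convAlg R, ('I_n -> A) -> Prop)
    (Phi Psi : operation R n) : Prop :=
  forall (A : convAlg R) (a b : 'I_n -> A), Psi A a b <-> D A a /\ Phi A a b.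

Definition vR (Psi : operation R n) : Prop :=
  forall (A : convAlg R) (a b b' : 'I_n -> A), Psi A a b -> Psi A a b' -> b = b'.

Definition Frm (Psi : operation R n) : Prop :=
  forall (A : convAlg R) (a : 'I_n -> A), (exists b, Psi A a b) <-> dom a.

Definition Nat (Psi : operation R n) : Prop :=
  (forall (A B : convAlg R) (phi : {lrmorphism A -> B}) (a b : 'I_n -> A),
     (forall i x, fil A i x -> fil B i (phi x)) ->
     Psi A a b -> Psi B (fun i => phi (a i)) (fun i => phi (b i))) /\
  (forall (A B : convAlg R) (a : 'I_n -> A) (a' : 'I_n -> B),
     (exists b, Psi A a b) -> (exists b', Psi B a' b') ->
     exists c, Psi (sum_convAlg A B) (fun i => (a i, a' i)) c).

(* Q^s, with the factors in increasing order of the indices *)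
Definition cmon (A : convAlg R) (p : nat) (Q : 'I_p -> A) (s : bvec p) : A :=
  \prod_(i < p) Q i ^+ s i.

(* Q^{s_0} X_{j_1} Q^{s_1} ... X_{j_r} Q^{s_r} *)
Definition word (A : convAlg R) (p r : nat) (Q : 'I_p -> A) (X : 'I_n -> A)
    (j : {ffun 'I_r -> 'I_n}) (s : {ffun 'I_r.+1 -> bvec p}) : A :=
  cmon Q (s ord0) * \prod_(l < r) (X (j l) * cmon Q (s (lift ord0 l))).

Definition coefficients (p : nat) :=
  forall r : nat, 'I_n -> {ffun 'I_r -> 'I_n} -> {ffun 'I_r.+1 -> bvec p} -> R.

Definition expansion (A : convAlg R) (p : nat) (psi : coefficients p)
    (Q : 'I_p -> A) (X : 'I_n -> A) (k : 'I_n) (N : nat) : A :=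
  \sum_(r < N) \sum_(j : {ffun 'I_r -> 'I_n})
    \sum_(s : {ffun 'I_r.+1 -> bvec p}) psi r k j s *: word Q X j s.

Definition Ana (Psi : operation R n) : Prop :=
  exists psi : coefficients n,
    forall (A : convAlg R) (Q X : 'I_n -> A),
      clifford Q -> (forall i, fil A 1 (X i)) ->
      exists2 b, Psi A (fun i => Q i + X i) b &
        forall k, cvgA (expansion psi Q X k) (b k).

Definition CP (Psi : operation R n) : Prop :=
  forall (A : convAlg R) (a b : 'I_n -> A), Psi A a b -> clifford b.

Definition vC (Psi : operation R n) : Prop :=
  forall (A : convAlg R) (Q : 'I_n -> A), clifford Q -> Psi A Q Q.

Definition Biv (Psi : operation R n) : Prop :=
  forall (A : convAlg R) (a b : 'I_n -> A) (x y : A),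
    invertible x -> invertible y -> Psi A a b ->
    Psi A (fun i => x * a i * y) (fun i => x * b i * y).

Definition vL (Psi : operation R n) : Prop :=
  forall (A : convAlg R) (a b : 'I_n -> A) (s : bvec n), Psi A a b ->
    Psi A (fun i => (-1) ^+ s i * a i) (fun i => (-1) ^+ s i * b i).

Definition H0 (Psi : operation R n) : Prop :=
  forall (A : convAlg R) (a b : 'I_n -> A), Psi A a b ->
    Psi (pser_convAlg 1 A) (fun i => (1 + psX A ord0) * psC 1 (a i))
      (fun i => psC 1 (b i)).

Definition FSt (Psi : operation R n) : Prop :=
  forall (A : convAlg R) (a b : 'I_n -> A) (t : R), Psi A a b ->
    Psi A (fun i => t *: a i + (1 - t) *: b i) b.

Definition mxact (A : convAlg R) (U : 'M[R]_n) (a : 'I_n -> A) : 'I_n -> A :=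
  fun i => \sum_j U i j *: a j.

Definition Sigma (Psi : operation R n) : Prop :=
  forall (A : convAlg R) (a b : 'I_n -> A) (U : 'M[R]_n), is_perm_mx U ->
    Psi A a b -> Psi A (mxact U a) (mxact U b).

Definition Orth (Psi : operation R n) : Prop :=
  forall (A : convAlg R) (a b : 'I_n -> A) (U : 'M[R]_n), U *m U^T = 1%:M ->
    Psi A a b -> Psi A (mxact U a) (mxact U b).
End Conditions.

Section FloatingConditions.
Variables (R : realType) (n : nat).

Definition fFrm (Psi : operation R n.+1) : Prop :=
  forall (A : convAlg R) (a : 'I_n.+1 -> A), (exists b, Psi A a b) <-> fdom a.

Definition fAna (Psi : operation R n.+1) : Prop :=
  exists psi : coefficients R n.+1 n,
    forall (A : convAlg R) (Q X : 'I_n.+1 -> A),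
      fl_clifford Q -> (forall i, fil A 1 (X i)) ->
      exists2 b, Psi A (fun i => Q i + X i) b &
        forall k, cvgA (fun N => expansion psi (fl_tail Q)
          (fun i => X i * inv (Q ord0)) k N * Q ord0) (b k).

Definition fCP (Psi : operation R n.+1) : Prop :=
  forall (A : convAlg R) (a b : 'I_n.+1 -> A), Psi A a b -> fl_clifford b.

Definition fvC (Psi : operation R n.+1) : Prop :=
  forall (A : convAlg R) (Q : 'I_n.+1 -> A), fl_clifford Q -> Psi A Q Q.
End FloatingConditions.

Section SymmetricOrthogonalization.
Variables (R : realType) (V : vectType R).

Definition is_metric (q : V -> V -> R) : Prop :=
  [/\ forall (c : R) u v w, q (c *: u + v) w = c * q u w + q v w,
      forall u v, q u v = q v u &
      forall u, u != 0 -> 0 < q u u].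

(* Cl(V,q), through its universal property *)
Definition is_clifford_algebra (q : V -> V -> R) (C : algType R)
    (cl : {linear V -> C}) : Prop :=
  (forall v, cl v * cl v = - (q v v)%:A) /\
  forall (D : algType R) (f : {linear V -> D}),
    (forall v, f v * f v = - (q v v)%:A) ->
    (exists phi : {lrmorphism C -> D}, forall v, phi (cl v) = f v) /\
    (forall phi phi' : {lrmorphism C -> D},
       (forall v, phi (cl v) = f v) -> (forall v, phi' (cl v) = f v) ->
       phi =1 phi').

Variables (m n : nat).

(* R[[t_1, ..., t_m]] *)
Local Notation B := (pser_convAlg m (reals_convAlg R)).

Definition gbinom (e : R) (k : nat) : R := (\prod_(i < k) (e - i%:R)) / k`!%:R.

(* S^e for a matrix S with constant term c, as c^e (1 + (S/c - 1))^e *)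
Definition binom_series (e c : R) (S : 'M[B]_n) : 'M[B]_n :=
  \matrix_(i, j) limA (fun N : nat => (\sum_(k < N)
     ((c `^ e * gbinom e k)%:A : B) *: ((c^-1)%:A *: S - 1%:M) ^+ k) i j : B).

Definition gram (q : V -> V -> R) (a : 'I_n -> pser m V) : 'M[B]_n :=
  \matrix_(i, j) (PSer (cauchy (q : V -> V -> R^o) (a j) (a i)) : B).

(* the row [a_1 ... a_n] times a matrix *)
Definition row_act (a : 'I_n -> pser m V) (W : 'M[B]_n) : 'I_n -> pser m V :=
  fun i => PSer (fun d =>
    \sum_j cauchy (fun (v : V) (x : R) => x *: v) (a j) (W j i : B) d).

Definition sym_orth (q : V -> V -> R) (a : 'I_n -> pser m V) :
    'I_n -> pser m V :=
  row_act a (binom_series (- 2%:R^-1) 1 (gram q a)).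

Definition sym_conf_orth (q : V -> V -> R) (c : R) (a : 'I_n -> pser m V) :
    'I_n -> pser m V :=
  let S := gram q a in
  row_act a (((n%:R^-1 : R)%:A * \tr (binom_series 2%:R^-1 c S) : B)
             *: binom_series (- 2%:R^-1) c S).

(* the extension of cl to V (x) B -> Cl(V,q) (x) B *)
Definition cl_ext (C : algType R) (cl : V -> C) (a : pser m V) : pser m C :=
  PSer (fun d => cl (a d)).
End SymmetricOrthogonalization.

(* C (x) R[[t_1, ..., t_m]] is the power series algebra of C, where the
   finite-dimensional algebra C has filtration degree 0. *)
Definition PSy (R : realType) (n : nat) (Psi : operation R n) : Prop :=
  forall (V : vectType R) (q : V -> V -> R) (C : algType R)
    (Cfin : fin_codim [set (0 : C)]) (cl : {linear V -> C}) (m : nat)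
    (a : 'I_n -> pser m V),
    is_metric q -> is_clifford_algebra q cl ->
    (forall i j, q (a i (m0 m)) (a j (m0 m)) = (i == j)%:R) ->
    Psi (pser_convAlg m (fd_convAlg Cfin)) (fun i => cl_ext cl (a i))
      (fun i => cl_ext cl (sym_orth q a i)).

Definition fPSy (R : realType) (n : nat) (Psi : operation R n) : Prop :=
  forall (V : vectType R) (q : V -> V -> R) (C : algType R)
    (Cfin : fin_codim [set (0 : C)]) (cl : {linear V -> C}) (m : nat)
    (a : 'I_n -> pser m V) (c : R),
    is_metric q -> is_clifford_algebra q cl -> 0 < c ->
    (forall i j, q (a i (m0 m)) (a j (m0 m)) = c * (i == j)%:R) ->
    Psi (pser_convAlg m (fd_convAlg Cfin)) (fun i => cl_ext cl (a i))
      (fun i => cl_ext cl (sym_conf_orth q c a i)).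

Definition FQ_orthogonalization (R : realType) (n : nat) (Psi : operation R n) :
    Prop :=
  [/\ vR Psi, Frm Psi, Ana Psi, Nat Psi & CP Psi].

Definition FQ_conform_orthogonalization (R : realType) (n : nat)
    (Psi : operation R n.+1) : Prop :=
  [/\ vR Psi, Biv Psi, fFrm Psi & fAna Psi] /\ (Nat Psi /\ fCP Psi).

(* Main.v *)
(* The limit b of the steps is characterized by: b is a (floating) Clifford
   system near A, and Pi_b(A - b) = 0. Conjugation by the b_i gives commuting
   involutions of the algebra, and the weights of a nonzero index sum up to 1, so
   a step started where Pi lies in the m-th filtration level makes Pi lie in the
   (m+1)-st; the same eigencomponent argument, applied to the difference of two
   solutions, shows uniqueness. For floating systems the involutions are
   (x, y) |-> (- b_i y b_i^-1, - b_i^-1 x b_i) on the square of the algebra, which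
   removes the choice of the index k. The algebraic conditions then amount to
   transporting the equation Pi_b(A - b) = 0.
   For Sy this equation says sum_j [b_j, A_j] = 0, which is O(n)-invariant and
   holds for symmetric orthogonalization because the matrix of the coefficients
   of the A_j in the b_i is symmetric. For GS it says that the part of A_k in the
   definition of Gram-Schmidt is b_k T with T unipotent commuting with b_k, and
   pol(b_k T) = b_k by expanding the integral.
   For the expansions, the iterates are approximated, in all algebras at once, by
   fixed noncommutative polynomials in Q and R; the homogeneous components of
   such a polynomial are isolated by passing to power series in t and replacing
   R by t R. *)
Require Import Defs.
From HB Require Import structures.
From mathcomp Require Import all_boot all_order all_algebra.
From mathcomp Require Import all_classical all_reals all_analysis.
From mathcomp Require Import ring.
Import Defs Order.TTheory GRing.Theory Num.Theory.
Import numFieldNormedType.Exports.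

Set Implicit Arguments.
Unset Strict Implicit.
Unset Printing Implicit Defensive.

Local Open Scope classical_set_scope.
Local Open Scope ring_scope.

(** Up to second order a step adds P Q_j - Q_j P to Q_j, that is, it subtracts P - Q_j^-1 P Q_j from
    the quotient E_j = (A_j - Q_j) Q_j^-1. The weighted average of these corrections over j is P
    minus its component at 0. Since P is itself such an average and the weights at 0 vanish, P has
    no component at 0, and the new average cancels. The obstacle is that the involutions move with
    Q. The quotients lie in level 1, so replacing Q by a system at distance m changes their parts in
    level m+1 only, and the linear algebra can be done for frozen involutions on an abstract module.
    For uniqueness, the relations satisfied by both systems make their difference tangent up to a
    quadratic term, which lies deeper. Gram-Schmidt and symmetric orthogonalization rest on the same
    numbers: the means of sin^(2k), equal to binomial(2k,k)/4^k, are the coefficients of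
    (1-s)^(-1/2). Their convolution with themselves is constantly 1, which evaluates the
    polarization integral and also squares the binomial series of S^(-1/2). *)

(* Reflexive decision procedure for identities in abelian groups. *)
Inductive zexp := ZVar of nat | ZZero | ZAdd of zexp & zexp | ZOpp of zexp.

Fixpoint zeval (V : zmodType) (e : seq V) (t : zexp) : V :=
  match t with
  | ZVar i => e`_i
  | ZZero => 0
  | ZAdd a b => zeval e a + zeval e b
  | ZOpp a => - zeval e a
  end.

Fixpoint zcoef (t : zexp) (i : nat) : int :=
  match t with
  | ZVar j => (i == j)%:R
  | ZZero => 0
  | ZAdd a b => zcoef a i + zcoef b i
  | ZOpp a => - zcoef a i
  end.

(** The right-hand side sees the expression only through integers that are computed without knowing
    [V]; this makes a decision by computation possible. *)
Lemma zevalE (V : zmodType) (e : seq V) t :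
  zeval e t = \sum_(i < size e) e`_i *~ zcoef t i.
Proof.
elim: t => [j||a iha b ihb|a iha] /=.
- have [js|sj] := ltnP j (size e).
    rewrite (bigD1 (Ordinal js)) //= eqxx mulr1z big1 ?addr0 // => i ij.
    by rewrite -[_ == _]/(i == Ordinal js) (negbTE ij) mulr0z.
  rewrite nth_default // big1 // => i _.
  by rewrite ltn_eqF ?mulr0z // (leq_trans _ sj).
- by rewrite big1 // => i _; rewrite mulr0z.
- by rewrite iha ihb -big_split; apply: eq_bigr => i _ /=; rewrite mulrzDr.
- by rewrite iha -sumrN; apply: eq_bigr => i _; rewrite mulrNz.
Qed.

Lemma zevalP (V : zmodType) (e : seq V) s t :
  all (fun i => zcoef s i == zcoef t i) (iota 0 (size e)) ->
  zeval e s = zeval e t.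
Proof.
move=> /allP h; rewrite !zevalE; apply: eq_bigr => i _.
by rewrite (eqP (h i _)) // mem_iota add0n /=.
Qed.

(* Atoms are compared up to unification: canonical instances may differ. *)
Ltac zindex x l :=
  match l with
  | cons ?y ?l' =>
      match constr:(tt) with
      | _ => let _ := match constr:(tt) with _ => unify x y end in constr:(0%N)
      | _ => let n := zindex x l' in constr:(S n)
      end
  end.
Ltac zatoms l t :=
  match t with
  | GRing.add ?a ?b => let l' := zatoms l a in zatoms l' b
  | GRing.opp ?a => zatoms l a
  | GRing.zero => l
  | _ => match constr:(tt) with _ => let _ := zindex t l in l | _ => constr:(cons t l) end
  end.
Ltac zreify l t :=
  match t with
  | GRing.add ?a ?b =>
      let u := zreify l a in let v := zreify l b in constr:(ZAdd u v)
  | GRing.opp ?a => let u := zreify l a in constr:(ZOpp u)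
  | GRing.zero => constr:(ZZero)
  | _ => let n := zindex t l in constr:(ZVar n)
  end.
Ltac zmod :=
  match goal with
  | |- @eq ?T ?a ?b =>
      let l0 := constr:(@nil T) in
      let l1 := zatoms l0 a in let l := zatoms l1 b in
      let u := zreify l a in let v := zreify l b in
      apply: (@zevalP _ l u v); vm_compute; reflexivity
  end.
(** Once products are distributed and reassociated, every noncommutative monomial is an atom of an
    identity in an abelian group. *)
Ltac nring :=
  rewrite ?(mulrBl, mulrBr, mulrDl, mulrDr, mulNr, mulrN, opprD, opprK, mulrA,
            mul1r, mulr1, mul0r, mulr0); zmod.

(** * Filtrations *)
(* Exchange argument: [x] is kept at the head of a list spanning [V] modulo
   [P], and the other vectors are put into [P] or dropped. *)
Lemma separation_span (R : realType) (V : lmodType R) (x : V) (s : seq V) (P : set V) :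
  P 0 -> (forall (c : R) y z, P y -> P z -> P (c *: y + z)) -> ~ P x ->
  (forall y, exists (c : R) (d : nat -> R),
     P (y - (c *: x + \sum_(j < size s) d j *: s`_j))) ->
  exists f : {linear V -> R^o}, (forall y, P y -> f y = 0) /\ f x != 0.
Proof.
elim: s P => [|v s IHs] P P0 Plin Px Psp.
  have /choice[f hf] : forall y, exists c, P (y - c *: x).
    by move=> y; have [c [d]] := Psp y; rewrite big_ord0 addr0; exists c.
  have PZ c y : P y -> P (c *: y) by move=> h; rewrite -[_ *: _]addr0; apply: Plin.
  have uniqf c : P (c *: x) -> c = 0.
    move=> h; apply/eqP; case: eqP => // /eqP c0; case: Px.
    by rewrite -[x]scale1r -(mulVf c0) -scalerA; apply: PZ.
  have fE c y : P (y - c *: x) -> f y = c.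
    move=> h; apply/eqP; rewrite -subr_eq0; apply/eqP/uniqf.
    rewrite (_ : _ *: _ = -1 *: (y - f y *: x) + (y - c *: x)); first exact: Plin.
    by rewrite scaleN1r opprB addrA subrK scalerBl.
  have flin : linear (f : V -> R^o).
    move=> a y z; apply: fE.
    rewrite (_ : _ - _ = a *: (y - f y *: x) + (z - f z *: x)); first exact: Plin.
    by rewrite scalerBr scalerA addrACA -opprD -scalerDl.
  exists (HB.pack_for {linear V -> R^o} (f : V -> R^o)
    (GRing.isLinear.Build R V R^o *:%R (f : V -> R^o) flin)) => /=; split.
    by move=> y Py; apply: fE; rewrite scale0r subr0.
  by rewrite (fE 1) ?oner_eq0 // scale1r subrr.
pose P' y := exists c : R, P (y - c *: v).
have P'0 : P' 0 by exists 0; rewrite scale0r subr0.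
have P'lin (c : R) y z : P' y -> P' z -> P' (c *: y + z).
  move=> [a ha] [b hb]; exists (c * a + b).
  rewrite (_ : _ - _ = c *: (y - a *: v) + (z - b *: v)); first exact: Plin.
  by rewrite scalerBr scalerA addrACA -opprD -scalerDl.
have PP' y : P y -> P' y by exists 0; rewrite scale0r subr0.
have [[c hc]|nP'] := pselect (P' x); last first.
  have [|f [hf fx]] := IHs P' P'0 P'lin nP'.
    move=> y; have [c [d h]] := Psp y; exists c, (fun j => d j.+1), (d 0%N).
    by rewrite -addrA -opprD -addrA [_ + d 0%N *: v]addrC; rewrite big_ord_recl in h.
  by exists f; split=> // y /PP'; apply: hf.
have PZ a y : P y -> P (a *: y) by move=> h; rewrite -[_ *: _]addr0; apply: Plin.
have c0 : c != 0.
  by apply/eqP => c0; move: hc; rewrite c0 scale0r subr0.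
apply: IHs => // y; have [a [d h]] := Psp y.
(* [x - c *: v] lies in [P], so the term in [v] is traded for a multiple of [x]. *)
exists (a + d 0%N / c), (fun j => d j.+1).
rewrite (big_ord_recl (size s)) [X in _ + (_ + X)]/= in h.
set S := \sum_(j < size s) _.
rewrite -/S in h.
rewrite (_ : _ - _ = - (d 0%N / c) *: (x - c *: v)
    + (y - (a *: x + (d 0%N *: v + S)))); first exact: Plin.
rewrite scalerBr !scaleNr opprK scalerA divfK // scalerDl !opprD.
zmod.
Qed.

Section Filtration.
Variables (R : realType) (A : convAlg R).
Implicit Types x y z : A.

Lemma fil_scale i (c : R) x : fil A i x -> fil A i (c *: x).
Proof. by move=> h; rewrite -[_ *: _]addr0; apply: fil_lin (fil_zero _ _). Qed.

Lemma fil_opp i x : fil A i x -> fil A i (- x).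
Proof. by move=> h; rewrite -scaleN1r; apply: fil_scale. Qed.

Lemma fil_sub i x y : fil A i x -> fil A i y -> fil A i (x - y).
Proof. by move=> hx hy; apply: fil_add hx _; apply: fil_opp. Qed.

Lemma fil_subC i x y : fil A i (x - y) -> fil A i (y - x).
Proof. by move=> h; rewrite -opprB; apply: fil_opp. Qed.

Lemma fil_trans i y x z : fil A i (x - y) -> fil A i (y - z) -> fil A i (x - z).
Proof. by move=> h1 h2; rewrite -(subrKA y); apply: fil_add. Qed.

Lemma fil_eq i x y : fil A i (x - y) -> fil A i y -> fil A i x.
Proof. by move=> h hy; rewrite -(subrK y x); apply: fil_add. Qed.

Lemma fil_mull i x y : fil A i y -> fil A i (x * y).
Proof. by move=> h; apply: (@fil_mul _ _ 0 i _ _ (fil_full x) h). Qed.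

Lemma fil_mulr i x y : fil A i x -> fil A i (x * y).
Proof. by move=> h; rewrite -[i]addn0; apply: fil_mul h (fil_full y). Qed.

Lemma fil_exp k x : fil A 1 x -> fil A k (x ^+ k).
Proof.
move=> h; elim: k => [|k IH]; first exact: fil_full.
by rewrite exprS -add1n; apply: fil_mul.
Qed.

Lemma fil_hausdorff_eq x y : (forall i, fil A i (x - y)) -> x = y.
Proof. by move=> h; apply/eqP; rewrite -subr_eq0; apply/eqP/fil_hausdorff. Qed.

Lemma fil_complete_leq (u : nat -> A) :
  (forall i, fil A i (u i.+1 - u i)) ->
  exists l, forall i k, (i <= k)%N -> fil A i (l - u k).
Proof.
move=> /fil_complete[l hl]; exists l => i k ik; exact: fil_leq (hl k).
Qed.

Lemma fil_cvgA (u : nat -> A) l :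
  (forall i, exists N, forall k, (N <= k)%N -> fil A i (l - u k)) -> cvgA u l.
Proof.
move=> h i f hf; have [N hN] := h i.
apply: cvg_near_cst; exists N => // k /hN /hf /eqP.
by rewrite linearB subr_eq0 => /eqP ->.
Qed.

(** The geometric series in [1 - x] converges because its k-th term lies in level k. The bound in
    the last clause is the same in all algebras, which later makes inverses approximable by fixed
    polynomials. *)
Lemma fil_geom x : fil A 1 (x - 1) ->
  exists y, [/\ x * y = 1, y * x = 1 &
    forall N, fil A N (y - \sum_(k < N) (1 - x) ^+ k)].
Proof.
move=> /fil_subC hx; pose u N := \sum_(k < N) (1 - x) ^+ k.
have [y hy] : exists y, forall N k, (N <= k)%N -> fil A N (y - u k).
  apply: fil_complete_leq => i; rewrite /u big_ord_recr /= addrAC subrr add0r.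
  exact: fil_exp.
have uE N : 1 - (1 - x) ^+ N = x * u N.
  by rewrite -opprB subrX1 -mulNr opprB subKr.
have xu N : x * u N = u N * x.
  rewrite /u mulr_sumr mulr_suml; apply: eq_bigr => k _; apply/commrX/commrB => //.
  exact: commr1.
exists y; split; last by move=> N; apply: hy.
- apply: fil_hausdorff_eq => N.
  apply: (@fil_trans _ (x * u N)); first by rewrite -mulrBr; apply/fil_mull/hy.
  by rewrite -uE addrAC subrr add0r; apply/fil_opp/fil_exp.
- apply: fil_hausdorff_eq => N.
  apply: (@fil_trans _ (u N * x)); first by rewrite -mulrBl; apply/fil_mulr/hy.
  by rewrite -xu -uE addrAC subrr add0r; apply/fil_opp/fil_exp.
Qed.

(** Limits and integrals are tested by linear forms only; finite codimension of the levels supplies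
    enough forms to make them unique. *)
Lemma quot_form_separation i x : ~ fil A i x ->
  exists2 f : {linear A -> R^o}, quot_form i f & f x != 0.
Proof.
move=> hx; have [s hs] := fil_fin_codim A i.
have [|||f [h1 h2]] := @separation_span _ A x s (fil A i) _ _ hx; last by exists f.
- exact: fil_zero.
- exact: fil_lin.
- by move=> y; have [c hc] := hs y; exists 0, c; rewrite scale0r add0r.
Qed.

Lemma quot_form_eq x y :
  (forall i (f : {linear A -> R^o}), quot_form i f -> f x = f y) -> x = y.
Proof.
move=> h; apply: fil_hausdorff_eq => i; apply: contrapT => /quot_form_separation[f hf].
by rewrite linearB (h i) // subrr eqxx.
Qed.

Lemma cvgA_unique (u : nat -> A) l l' : cvgA u l -> cvgA u l' -> l = l'.
Proof.
move=> hl hl'; apply: quot_form_eq => i f hf.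
by apply: (cvg_unique _ (hl i f hf) (hl' i f hf)).
Qed.

Lemma limA_eq (u : nat -> A) l : cvgA u l -> limA u = l.
Proof.
move=> hl; apply: (@cvgA_unique u) => //.
exact: (@xgetPex _ _ [set l | cvgA u l] (ex_intro _ l hl)).
Qed.

Lemma expA_fil x : fil A 1 x ->
  forall N, fil A N (expA x - \sum_(k < N) (k`!%:R : R)^-1 *: x ^+ k).
Proof.
move=> hx; pose u N : A := \sum_(k < N) (k`!%:R : R)^-1 *: x ^+ k.
have [y hy] : exists y, forall N k, (N <= k)%N -> fil A N (y - u k).
  apply: fil_complete_leq => i; rewrite /u big_ord_recr /= addrAC subrr add0r.
  by apply/fil_scale/fil_exp.
move=> N; rewrite /expA (@limA_eq u y); first exact: hy.
by apply: fil_cvgA => i; exists i => k; exact: hy.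
Qed.

Lemma expA_fil2 m x : (0 < m)%N -> fil A m x -> fil A m.+1 (expA x - (1 + x)).
Proof.
move=> m0 hx; have hx1 : fil A 1 x by apply: fil_leq hx.
have hxk k : fil A m.+1 (x ^+ k.+2).
  rewrite exprS; apply: (@fil_leq _ _ _ (m + 1)); first by rewrite addn1.
  by apply: fil_mul => //; rewrite exprS; apply: fil_mulr.
(* Of [m.+2] terms the first two give [1 + x]; the others are powers with exponent at least 2, in
   level [m.+1] because [m] is positive. *)
apply: fil_trans (@fil_leq _ _ _ m.+2 _ _ (expA_fil hx1 m.+2)) _ => //.
rewrite !big_ord_recl /= /bump /= expr0 expr1 fact0 invr1 !scale1r.
set S := \sum_(_ < _) _.
rewrite (_ : _ - _ = S); last by zmod.
by apply: fil_sum => k; apply/fil_scale/hxk.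
Qed.

Lemma expA_fil1 m x : (0 < m)%N -> fil A m x -> fil A m (expA x - 1).
Proof.
move=> m0 hx; rewrite (_ : _ - 1 = (expA x - (1 + x)) + x); last by zmod.
by apply: fil_add => //; apply: fil_decr; apply: expA_fil2.
Qed.

End Filtration.

Section Inverse.
Variable A : nzRingType.
Implicit Types x y : A.

Lemma invertible_eq x y z : x * y = 1 -> z * x = 1 -> y = z.
Proof. by move=> h1 h2; rewrite -[y]mul1r -h2 -mulrA h1 mulr1. Qed.

Lemma inv_eq x y : x * y = 1 -> y * x = 1 -> inv x = y.
Proof.
move=> h1 h2; have [_ h4] := @xgetPex _ 0 [set y | x * y = 1 /\ y * x = 1]
  (ex_intro _ y (conj h1 h2)).
by apply/esym/(invertible_eq h1).
Qed.

Lemma invertible_mulV x : invertible x -> x * inv x = 1.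
Proof. by move=> [y [h1 h2]]; rewrite (inv_eq h1 h2). Qed.

Lemma invertible_mulVl x : invertible x -> inv x * x = 1.
Proof. by move=> [y [h1 h2]]; rewrite (inv_eq h1 h2). Qed.

Lemma invertible_mul x y : invertible x -> invertible y -> invertible (x * y).
Proof.
move=> [x' [h1 h2]] [y' [h3 h4]]; exists (y' * x'); split.
  by rewrite mulrA -(mulrA x) h3 mulr1.
by rewrite mulrA -(mulrA y') h2 mulr1.
Qed.

Lemma invertible_inv x : invertible x -> invertible (inv x).
Proof.
by move=> hx; exists x; rewrite invertible_mulVl ?invertible_mulV.
Qed.

Lemma inv_mul x y : invertible x -> invertible y -> inv (x * y) = inv y * inv x.
Proof.
move=> hx hy; apply: inv_eq.
  by rewrite mulrA -(mulrA x) invertible_mulV // mulr1 invertible_mulV.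
by rewrite mulrA -(mulrA (inv y)) invertible_mulVl // mulr1 invertible_mulVl.
Qed.

Lemma inv_inv x : invertible x -> inv (inv x) = x.
Proof. by move=> hx; apply: inv_eq; rewrite ?invertible_mulVl ?invertible_mulV. Qed.

Lemma inv1 : inv (1 : A) = 1.
Proof. by apply: inv_eq; rewrite mulr1. Qed.

Lemma invertible1 : invertible (1 : A).
Proof. by exists 1; rewrite mulr1. Qed.
End Inverse.

Section Unipotent.
Variables (R : realType) (A : convAlg R).
Implicit Types x : A.

Lemma invertible_fil x : fil A 1 (x - 1) -> invertible x.
Proof. by move=> /fil_geom[y [h1 h2 _]]; exists y. Qed.

Lemma inv_geom x : fil A 1 (x - 1) ->
  forall N, fil A N (inv x - \sum_(k < N) (1 - x) ^+ k).
Proof. by move=> /fil_geom[y [h1 h2 h3]]; rewrite (inv_eq h1 h2). Qed.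

Lemma invertible_expA x : fil A 1 x -> invertible (expA x).
Proof. by move=> hx; apply/invertible_fil/expA_fil1. Qed.

Lemma inv_fil m x y : invertible x -> invertible y ->
  fil A m (x - y) -> fil A m (inv x - inv y).
Proof.
move=> hx hy h; have -> : inv x - inv y = inv x * (y - x) * inv y.
  by rewrite mulrBr mulrBl invertible_mulVl // mul1r -mulrA invertible_mulV // mulr1.
by apply/fil_mulr/fil_mull/fil_subC.
Qed.
End Unipotent.

Lemma scaler_half (R : realType) (V : lmodType R) (x : V) :
  (2%:R^-1 : R) *: (x + x) = x.
Proof.
have -> : x + x = (2%:R : R) *: x by rewrite scaler_nat.
by rewrite scalerA mulVf ?scale1r // pnatr_eq0.
Qed.

(** * Commuting involutions and their joint eigencomponents *)

Section Involutions.
Variables (R : realType) (V : lmodType R) (n : nat).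

(** One abstraction for both kinds of systems: conjugations on [A] in the plain case, swaps on the
    square of [A] in the floating case. *)
Record involutions := Involutions {
  iop :> 'I_n -> V -> V;
  iop_linear : forall i, linear (iop i);
  iopK : forall i, involutive (iop i);
  iopC : forall i j x, iop i (iop j x) = iop j (iop i x)
}.

Variable c : involutions.
HB.instance Definition _ i :=
  GRing.isLinear.Build R V V *:%R (iop c i) (@iop_linear c i).

Lemma iopZ i (a : R) x : c i (a *: x) = a *: c i x. Proof. exact: linearZ. Qed.
Lemma iopD i x y : c i (x + y) = c i x + c i y. Proof. exact: linearD. Qed.

Definition eigenpart i (b : bool) (x : V) : V :=
  (2%:R^-1 : R) *: (x + (-1) ^+ b *: c i x).

Lemma eigenpart_linear i b : linear (eigenpart i b).
Proof.
move=> a x y; rewrite /eigenpart iop_linear scalerA [a * _]mulrC -scalerA -scalerDr.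
by congr (_ *: _); rewrite !scalerDr !scalerA [_ ^+ _ * a]mulrC; zmod.
Qed.
HB.instance Definition _ i b :=
  GRing.isLinear.Build R V V *:%R (eigenpart i b) (@eigenpart_linear i b).

Definition eigenparts (r : seq 'I_n) (s : 'I_n -> bool) (x : V) : V :=
  foldl (fun y i => eigenpart i (s i) y) x r.

Lemma eigenparts_linear r s : linear (eigenparts r s).
Proof. by elim: r => [|i r IHr] a x y //=; rewrite eigenpart_linear IHr. Qed.
HB.instance Definition _ r s :=
  GRing.isLinear.Build R V V *:%R (eigenparts r s) (@eigenparts_linear r s).

Lemma eigenpart_op i j b x : eigenpart i b (c j x) = c j (eigenpart i b x).
Proof. by rewrite /eigenpart iopZ iopD iopZ iopC. Qed.

Lemma eigenparts_op r s j x : eigenparts r s (c j x) = c j (eigenparts r s x).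
Proof. by elim: r x => [|i r IHr] x //=; rewrite eigenpart_op IHr. Qed.

Lemma op_eigenpart i b x : c i (eigenpart i b x) = (-1) ^+ b *: eigenpart i b x.
Proof.
rewrite /eigenpart iopZ iopD iopZ iopK scalerA mulrC -scalerA.
by congr (_ *: _); case: b; rewrite ?scale1r ?scaleN1r; [rewrite opprB|]; zmod.
Qed.

Lemma op_eigenparts r s i x : i \in r ->
  c i (eigenparts r s x) = (-1) ^+ s i *: eigenparts r s x.
Proof.
elim: r x => [|j r IHr] x //=; rewrite inE => /orP[/eqP <-|/IHr //].
by rewrite -eigenparts_op op_eigenpart linearZ.
Qed.

Lemma eigenpart_eigen i b (b' : bool) x : c i x = (-1) ^+ b' *: x ->
  eigenpart i b x = if b == b' then x else 0.
Proof.
move=> h; rewrite /eigenpart h scalerA -signr_addb.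
by case: b b' {h} => [] [] /=; rewrite ?scale1r ?scaleN1r ?subrr ?scaler0 // scaler_half.
Qed.

Lemma eigenparts_eigen r s (t : 'I_n -> bool) x :
  (forall i, i \in r -> c i x = (-1) ^+ t i *: x) ->
  eigenparts r s x = if all (fun i => s i == t i) r then x else 0.
Proof.
elim: r => [|i r IHr] //= h; rewrite (eigenpart_eigen _ (h i _)) ?mem_head //.
case: eqP => _ /=; last by rewrite linear0.
by apply: IHr => j jr; apply: h; rewrite in_cons jr orbT.
Qed.

(** Joint eigenvectors span [V]: an involution splits a vector into two parts, and the parts keep
    the eigenvalues already obtained for the other involutions. *)
Lemma eigen_ind (P : V -> Prop) :
  (forall x y, P x -> P y -> P (x + y)) ->
  (forall (t : bvec n) x, (forall i, c i x = (-1) ^+ t i *: x) -> P x) ->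
  forall x, P x.
Proof.
move=> PD Pe x.
(* [r] lists the involutions for which [y] is not yet known to be an eigenvector. *)
suff H (r : seq 'I_n) y (t : bvec n) :
    (forall i, i \notin r -> c i y = (-1) ^+ t i *: y) -> P y.
  by apply: (H (enum 'I_n) x [ffun=> false]) => i; rewrite mem_enum.
elim: r y t => [|j r IHr] y t h; first by apply: (Pe t) => i; apply: h.
have -> : y = eigenpart j false y + eigenpart j true y.
  rewrite /eigenpart -scalerDr expr0 expr1 scale1r scaleN1r addrACA subrr addr0.
  by rewrite scaler_half.
have He b : P (eigenpart j b y).
  apply: (IHr _ [ffun i => if i == j then b else t i]) => i ir.
  rewrite ffunE; case: eqP => [->|ij]; first exact: op_eigenpart.
  rewrite -eigenpart_op h; first exact: linearZ.
  by rewrite in_cons negb_or ir andbT; apply/eqP.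
exact: PD.
Qed.

Local Notation full := (eigenparts (enum 'I_n)).

Lemma full_eigen (s t : bvec n) x : (forall i, c i x = (-1) ^+ t i *: x) ->
  full s x = if s == t then x else 0.
Proof.
move=> h; rewrite (@eigenparts_eigen _ s t) //; congr (if _ then _ else _).
apply/allP/eqP => [H|-> //]; apply/ffunP => i; apply/eqP/H.
by rewrite mem_enum.
Qed.

Lemma op_full s i x : c i (full s x) = (-1) ^+ s i *: full s x.
Proof. by rewrite op_eigenparts ?mem_enum. Qed.

Lemma full_full (s t : bvec n) x : full s (full t x) = if s == t then full t x else 0.
Proof. by apply: full_eigen => i; rewrite op_full. Qed.

Lemma sum_full x : \sum_(s : bvec n) full s x = x.
Proof.
move: x; apply: eigen_ind => [x y hx hy|t x h].
  by rewrite -{2}hx -{2}hy -big_split; apply: eq_bigr => s _; rewrite linearD.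
rewrite (bigD1 t) //= (full_eigen _ h) eqxx big1 ?addr0 // => s /negbTE st.
by rewrite (full_eigen _ h) st.
Qed.

Lemma full_sub_op (s : bvec n) i x :
  full s (x - c i x) = (s i)%:R * 2%:R *: full s x.
Proof.
rewrite linearB /= eigenparts_op op_full; case: (s i).
  by rewrite scaleN1r opprK mul1r scaler_nat mulr2n.
by rewrite mul0r scale0r scale1r subrr.
Qed.

Lemma full_add_op (s : bvec n) i x :
  full s (x + c i x) = (~~ s i)%:R * 2%:R *: full s x.
Proof.
rewrite linearD /= eigenparts_op op_full; case: (s i).
  by rewrite scaleN1r subrr mul0r scale0r.
by rewrite scale1r mul1r scaler_nat mulr2n.
Qed.

Lemma eq_full (x y : V) : (forall s : bvec n, full s x = full s y) -> x = y.
Proof. by move=> h; rewrite -[x]sum_full -[y]sum_full; apply: eq_bigr. Qed.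

Variable w : bvec n -> 'I_n -> R.

Definition connection (E : 'I_n -> V) : V :=
  (2%:R^-1 : R) *: \sum_j \sum_(s : bvec n) w s j *: full s (E j).

Lemma connectionE E E' E'' (a : R) :
  (forall j, E j = a *: E' j + E'' j) ->
  connection E = a *: connection E' + connection E''.
Proof.
move=> h; rewrite /connection scalerA mulrC -scalerA -scalerDr; congr (_ *: _).
rewrite scaler_sumr -big_split; apply: eq_bigr => j _ /=.
rewrite scaler_sumr -big_split; apply: eq_bigr => s _ /=.
by rewrite h linearP scalerDr !scalerA mulrC.
Qed.

Lemma connectionB E E' :
  connection (fun j => E j - E' j) = connection E - connection E'.
Proof.
rewrite (@connectionE _ E' E (-1)); last by move=> j; rewrite scaleN1r addrC.
by rewrite scaleN1r addrC.
Qed.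

Lemma connection0 : connection (fun=> 0) = 0.
Proof.
rewrite /connection big1 ?scaler0 // => j _; rewrite big1 // => s _.
by rewrite linear0 scaler0.
Qed.

Lemma full_connection (s : bvec n) E :
  full s (connection E) = (2%:R^-1 : R) *: \sum_j w s j *: full s (E j).
Proof.
rewrite /connection linearZ linear_sum; congr (_ *: _); apply: eq_bigr => j _.
rewrite linear_sum (bigD1 s) //= linearZ /= full_full eqxx big1 ?addr0 // => t ts.
by rewrite linearZ /= full_full eq_sym (negbTE ts) scaler0.
Qed.

Hypothesis hw : connection_data w.

Lemma weight_mul s j : w s j * (s j)%:R = w s j.
Proof. by have [h _] := hw; case: (boolP (s j)) => [|/negbTE /h ->]; rewrite ?mulr1 ?mul0r. Qed.

Lemma full0_connection E : full ([ffun=> false] : bvec n) (connection E) = 0.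
Proof.
rewrite full_connection big1 ?scaler0 // => j _.
by have [h _] := hw; rewrite h ?ffunE // scale0r.
Qed.

(* [P - c j P] is twice the (-1)-part of [P] at [j]; the weights of a nonzero
   [s] are supported on [s] and sum up to 1, so all components but the one at 0
   are recovered. *)
Lemma connection_op x :
  connection (fun j => x - c j x) = x - full ([ffun=> false] : bvec n) x.
Proof.
apply: eq_full => s; rewrite full_connection linearB /= full_full.
have [->|s0] := eqVneq s [ffun=> false].
  by rewrite subrr big1 ?scaler0 // => j _; rewrite full_sub_op ffunE mul0r scale0r scaler0.
under eq_bigr => j _ do rewrite full_sub_op scalerA mulrA weight_mul.
rewrite -scaler_suml -mulr_suml; have [_ ->] := hw; last by [].
by rewrite scalerA mul1r mulVf ?pnatr_eq0 // scale1r subr0.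
Qed.

Lemma connection_correction E :
  connection (fun j => E j - (connection E - c j (connection E))) = 0.
Proof. by rewrite connectionB connection_op full0_connection subr0 subrr. Qed.

(** At a nonzero [s] the weights are [s j] divided by the number of ones of [s]. This number factors
    out, so the component of the connection is a nonzero multiple of that of the sum; at 0 both
    components vanish. *)
Lemma connection_Sy_eq0 E : w = @Syw R n ->
  connection E = 0 <-> \sum_j (E j - c j (E j)) = 0.
Proof.
move=> wE; set Y := \sum_j _.
have fY (s : bvec n) : full s Y = 2%:R *: \sum_j (s j)%:R *: full s (E j).
  rewrite linear_sum scaler_sumr; apply: eq_bigr => j _ /=.
  by rewrite full_sub_op scalerA mulrC.
(* In 4 = 2 * 2, one factor comes from the half in [connection], the other from [full_sub_op]. *)
have fC (s : bvec n) : s != [ffun=> false] ->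
    full s (connection E) = (4%:R^-1 * (\sum_h s h)%N%:R^-1) *: full s Y.
  move=> s0; rewrite full_connection fY wE /Syw (negbTE s0) scalerA !scaler_sumr.
  apply: eq_bigr => j _; rewrite !scalerA; congr (_ *: _).
  have -> : (4%:R : R) = 2%:R * 2%:R by rewrite -natrM.
  rewrite invfM; set a := (_%:R^-1 : R); set b := _%:R^-1.
  by rewrite -!mulrA [b * _]mulrCA [a * (2%:R * _)]mulrA mulVf ?pnatr_eq0 // mul1r [b * _]mulrC.
have deg0 (s : bvec n) : s != [ffun=> false] -> ((\sum_h s h)%N%:R : R) != 0.
  move=> s0; rewrite pnatr_eq0 sum_nat_eq0; apply: contra s0 => /forallP h.
  by apply/eqP/ffunP => i; rewrite ffunE; have := h i; rewrite eqb0 => /negbTE.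
have f0 : full ([ffun=> false] : bvec n) Y = 0.
  by rewrite fY big1 ?scaler0 // => j _; rewrite ffunE scale0r.
split=> h; apply: eq_full => s; rewrite linear0; have [->//|s0] := eqVneq s [ffun=> false].
- have := fC s s0; rewrite h linear0 => /esym/eqP.
  rewrite scaler_eq0 mulf_eq0 !invr_eq0 pnatr_eq0 /= (negbTE (deg0 s s0)) /=.
  by move/eqP.
- exact: full0_connection.
- by rewrite fC // h linear0 scaler0.
Qed.

(** The weights at [s] single out its least index, so the component of the connection at [s] is half
    that of a single [E j]. *)
Lemma connection_GS_eq0 E : w = @GSw R n -> connection E = 0 ->
  forall (s : bvec n) j, s j -> (forall h : 'I_n, (h < j)%N -> ~~ s h) ->
  full s (E j) = 0.
Proof.
move=> wE h s j sj sh; have := full_connection s E; rewrite h linear0 => /esym/eqP.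
rewrite scaler_eq0 invr_eq0 pnatr_eq0 /= (bigD1 j) //= big1 => [|i ij].
  rewrite addr0 wE /GSw sj /=; have -> : [forall h : 'I_n, (h < j)%N ==> ~~ s h].
    by apply/forallP => k; apply/implyP/sh.
  by rewrite scale1r => /eqP.
rewrite wE /GSw; case: (boolP (s i)) => [si|_]; last by rewrite scale0r.
rewrite (_ : [forall h : 'I_n, (h < i)%N ==> ~~ s h] = false) ?scale0r //.
apply/negbTE/forallPn; exists j; rewrite sj implybF negbK.
rewrite ltn_neqAle eq_sym ij leqNgt; apply/negP => lt_ij.
by have := sh _ lt_ij; rewrite si.
Qed.

(* Modulo [G], the hypotheses say that [E] is tangent to the Clifford systems. *)
Lemma connection_tangent (G : V -> Prop) E :
  G 0 -> (forall (a : R) x y, G x -> G y -> G (a *: x + y)) ->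
  (forall i x, G x -> G (c i x)) ->
  (forall j, G (E j + c j (E j))) ->
  (forall i j, G ((E j - c i (E j)) - (E i - c j (E i)))) ->
  G (connection E) -> forall i, G (E i).
Proof.
move=> G0 Glin Gc hd ho hP i.
have GZ (a : R) x : G x -> G (a *: x) by move=> h; rewrite -[_ *: _]addr0; apply: Glin.
have GD x y : G x -> G y -> G (x + y) by move=> hx hy; rewrite -[x]scale1r; apply: Glin.
have Gf s x : G x -> G (full s x).
  rewrite /eigenparts; elim: (enum _) x => [|j r IHr] x h //=; apply: IHr.
  by apply/GZ/GD/GZ/Gc.
have G2 (a : R) x : a != 0 -> G (a *: x) -> G x.
  by move=> a0 /(GZ a^-1); rewrite scalerA mulVf // scale1r.
rewrite -(sum_full (E i)); apply: (big_ind G G0 GD) => s _.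
case: (boolP (s i)) => [si|/negbTE si]; last first.
  have := Gf s _ (hd i); rewrite full_add_op si mul1r; apply: G2.
  by rewrite pnatr_eq0.
have s0 : s != [ffun=> false] by apply/eqP => h; move: si; rewrite h ffunE.
(* Modulo [G], the component of [E j] at [s] is that of [E i] if [s j] holds, and 0 otherwise; the
   weights average these to the component of [E i]. *)
have hj j : G (full s (E j) - (s j)%:R *: full s (E i)).
  have := Gf s _ (ho i j); rewrite linearB /= !full_sub_op si mul1r mulrC -scalerA -scalerBr.
  by apply: G2; rewrite pnatr_eq0.
have H : G (\sum_j w s j *: full s (E j)).
  have := Gf s _ hP; rewrite full_connection; apply: G2.
  by rewrite invr_eq0 pnatr_eq0.
have -> : full s (E i) = \sum_j w s j *: full s (E j) -
    \sum_j w s j *: (full s (E j) - (s j)%:R *: full s (E i)).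
  rewrite -sumrB (eq_bigr (fun j => w s j *: full s (E i))); last first.
    by move=> j _; rewrite -scalerBr subKr scalerA weight_mul.
  by rewrite -scaler_suml (proj2 hw s s0) scale1r.
apply: (GD _ _ H).
rewrite -[X in G X]scaleN1r; apply/GZ; apply: (big_ind G G0 GD) => j _.
exact/GZ/hj.
Qed.

End Involutions.

Section Transport.
Variables (R : realType) (V V' : lmodType R) (n : nat).
Variables (c : involutions V n) (c' : involutions V' n) (f : V -> V').
Hypotheses (flin : linear f) (fc : forall i x, f (c i x) = c' i (f x)).

Lemma eigenparts_transport r s x : f (eigenparts c r s x) = eigenparts c' r s (f x).
Proof.
pose fl := HB.pack_for {linear V -> V'} f (GRing.isLinear.Build R V V' *:%R f flin).
elim: r x => [|i r IHr] x //=; rewrite IHr; congr eigenparts.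
by rewrite /eigenpart -[f]/(fl : V -> V') linearZ linearD linearZ /= fc.
Qed.

Lemma connection_transport w E :
  f (connection c w E) = connection c' w (fun j => f (E j)).
Proof.
pose fl := HB.pack_for {linear V -> V'} f (GRing.isLinear.Build R V V' *:%R f flin).
rewrite /connection -[f]/(fl : V -> V') linearZ linear_sum; congr (_ *: _).
apply: eq_bigr => j _; rewrite linear_sum; apply: eq_bigr => s _.
by rewrite linearZ /= eigenparts_transport.
Qed.
End Transport.

(** * Connections of two nearby families of involutions *)

Section FilteredInvolutions.
Variables (R : realType) (B : convAlg R) (n : nat) (w : bvec n -> 'I_n -> R).
Variables (c c' : involutions B n).
Hypotheses (hc : forall k i x, fil B k x -> fil B k (c i x)).
Hypotheses (hc' : forall k i x, fil B k x -> fil B k (c' i x)).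
Implicit Types E F : 'I_n -> B.

Lemma fil_connection k E : (forall j, fil B k (E j)) -> fil B k (connection c w E).
Proof.
move=> h; apply: fil_scale; apply: fil_sum => j; apply: fil_sum => s; apply: fil_scale.
rewrite /eigenparts; elim: (enum _) (E j) (h j) => [|i r IHr] x hx //=.
apply: IHr; apply: fil_scale; apply: fil_add => //; apply: fil_scale; exact: hc.
Qed.

Variable m : nat.
Hypothesis hcc : forall i x, fil B 1 x -> fil B m.+1 (c' i x - c i x).

Lemma connection_perturb E : (forall j, fil B 1 (E j)) ->
  fil B m.+1 (connection c' w E - connection c w E).
Proof.
move=> h; rewrite /connection -scalerBr; apply: fil_scale; rewrite -sumrB.
apply: fil_sum => j; rewrite -sumrB; apply: fil_sum => s; rewrite -scalerBr.
apply: fil_scale; rewrite /eigenparts.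
suff H (r : seq 'I_n) x y : fil B 1 y -> fil B m.+1 (x - y) ->
    fil B m.+1 (foldl (fun z i => eigenpart c' i (s i) z) x r -
                foldl (fun z i => eigenpart c i (s i) z) y r).
  by apply: H; rewrite ?subrr //; apply: fil_zero.
elim: r x y => [|i r IHr] x y hy hxy //=.
apply: IHr; first by apply/fil_scale/fil_add => //; apply/fil_scale/hc.
rewrite /eigenpart -scalerBr opprD addrACA -scalerBr; apply/fil_scale/fil_add => //.
apply/fil_scale/(@fil_trans _ _ _ (c' i y)); last exact: hcc.
rewrite -[_ - _](linearB (iop c' i)); exact: hc'.
Qed.

Hypothesis hw : connection_data w.

(** [E] and [E'] are the quotients before and after a step. Up to level [m.+1] they differ by the
    correction that annihilates the connection, and the change of involutions costs no more. *)
Lemma connection_step E E' :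
  (forall j, fil B 1 (E' j)) ->
  (forall j, fil B m.+1 (E' j - (E j - (connection c w E - c j (connection c w E))))) ->
  fil B m.+1 (connection c' w E').
Proof.
move=> h1 h2; apply: fil_eq (connection_perturb h1) _.
set P := connection c w E in h2 *.
rewrite -[connection c w E']subr0 -(connection_correction c hw E) -connectionB.
exact: fil_connection.
Qed.

(** [F] is the difference of two solutions. Subtracting their equations puts its connection in level
    [m.+1]; as the last two hypotheses make [F] tangent up to that level, [F] is recovered from its
    connection. *)
Lemma connection_uniq E E' F :
  connection c w E = 0 -> connection c' w E' = 0 ->
  (forall j, fil B 1 (E' j)) ->
  (forall j, fil B m.+1 (E' j - (E j - F j))) ->
  (forall j, fil B m.+1 (F j + c j (F j))) ->
  (forall i j, fil B m.+1 ((F j - c i (F j)) - (F i - c j (F i)))) ->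
  forall i, fil B m.+1 (F i).
Proof.
move=> hE hE' h1 h2 h3 h4.
apply: (connection_tangent hw (fil_zero B m.+1) _ _ h3 h4).
- by move=> a x y; apply: fil_lin.
- by move=> i x; apply: hc.
have := fil_connection h2; rewrite !connectionB hE sub0r opprK => h.
rewrite -(addKr (connection c w E') (connection c w F)); apply: fil_add => //.
by have := connection_perturb h1; rewrite hE' sub0r.
Qed.
End FilteredInvolutions.

(** * Clifford systems *)
Section CliffordInvolutions.
Variables (R : realType) (A : convAlg R) (n : nat).
Implicit Types (Q X a b : 'I_n -> A) (x P : A).

Lemma clifford_sqr Q i : clifford Q -> Q i * Q i = -1.
Proof.
move=> /(_ i i); rewrite eqxx mulr1 -mulr2n -scaler_nat => h.
have e : (2%:R : R) != 0 by rewrite pnatr_eq0.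
by apply: (scalerI e); rewrite h scaleNr scalerN.
Qed.

Lemma clifford_anti Q i j : clifford Q -> i != j -> Q i * Q j = - (Q j * Q i).
Proof.
move=> /(_ i j) h /negbTE ij; move: h; rewrite ij mulr0 scale0r => /eqP.
by rewrite addr_eq0 => /eqP.
Qed.

Lemma cliffordP Q : (forall i, Q i * Q i = -1) ->
  (forall i j, i != j -> Q i * Q j = - (Q j * Q i)) -> clifford Q.
Proof.
move=> h1 h2 i j; have [->|ij] := eqVneq i j.
  by rewrite h1 mulr1 scaleNr scaler_nat mulr2n opprD.
by rewrite h2 // addNr mulr0 scale0r.
Qed.

Lemma clifford_inv Q i : clifford Q -> inv (Q i) = - Q i.
Proof.
by move=> hQ; apply: inv_eq; rewrite ?mulrN ?mulNr clifford_sqr ?opprK.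
Qed.

Lemma clifford_invertible Q i : clifford Q -> invertible (Q i).
Proof.
by move=> hQ; exists (- Q i); rewrite ?mulrN ?mulNr clifford_sqr ?opprK.
Qed.

Section Conj.
Variables (Q : 'I_n -> A) (hQ : clifford Q).

Lemma clifford_conjE i x : inv (Q i) * x * Q i = - (Q i * x * Q i).
Proof. by rewrite clifford_inv // !mulNr. Qed.

Fact conj_linear i : linear (fun x : A => inv (Q i) * x * Q i).
Proof. by move=> a x y; rewrite mulrDr mulrDl -scalerAr -scalerAl. Qed.
Fact conjK i : involutive (fun x : A => inv (Q i) * x * Q i).
Proof.
move=> x; rewrite !clifford_conjE mulrN mulNr opprK !mulrA clifford_sqr //.
by rewrite -mulrA clifford_sqr // mulN1r mulrN1 opprK.
Qed.
Fact conjC i j x : inv (Q i) * (inv (Q j) * x * Q j) * Q i =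
  inv (Q j) * (inv (Q i) * x * Q i) * Q j.
Proof.
rewrite !clifford_conjE !mulrN !mulNr !opprK.
have [->//|ij] := eqVneq i j.
have eq k l : Q k * (Q l * x * Q l) * Q k = Q k * Q l * x * (Q l * Q k).
  by rewrite !mulrA.
by rewrite !eq (clifford_anti hQ ij) mulrN !mulNr.
Qed.

Definition clifford_conj : involutions A n := Involutions conj_linear conjK conjC.

Lemma part_conj i (b : bool) x : part (Q i) b x = eigenpart clifford_conj i b x.
Proof.
by rewrite /part /eigenpart; congr (_ *: (_ + _)); case: b;
  rewrite ?expr0 ?expr1 ?mulN1r ?scaleN1r ?mul1r ?scale1r.
Qed.

Lemma parts_conj r (s : 'I_n -> bool) x : parts r Q s x = eigenparts clifford_conj r s x.
Proof. by elim: r x => [|i r IHr] x //=; rewrite -IHr part_conj. Qed.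

Lemma Pi_connection (w : weights R n) X :
  Pi w Q X = connection clifford_conj w (fun j => X j * inv (Q j)).
Proof.
rewrite /Pi /connection; congr (_ *: _); apply: eq_bigr => j _.
by apply: eq_bigr => s _; rewrite /rquo parts_conj.
Qed.

Lemma fil_conj k i x : fil A k x -> fil A k (clifford_conj i x).
Proof. by move=> h; apply/fil_mulr/fil_mull. Qed.

Lemma Pi_fil (w : weights R n) k X :
  (forall i, fil A k (X i)) -> fil A k (Pi w Q X).
Proof.
move=> h; rewrite Pi_connection; apply: fil_connection => [l i x|j].
  exact: fil_conj.
exact: fil_mulr.
Qed.
End Conj.

Lemma conj_perturb Q Q' (hQ : clifford Q) (hQ' : clifford Q') m :
  (forall i, fil A m (Q' i - Q i)) ->
  forall i x, fil A 1 x ->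
  fil A m.+1 (clifford_conj hQ' i x - clifford_conj hQ i x).
Proof.
move=> hD i x hx; rewrite /= !clifford_conjE //.
rewrite (_ : _ - _ = - ((Q' i - Q i) * x * Q' i + Q i * x * (Q' i - Q i))); last by nring.
apply/fil_opp/fil_add; first by rewrite -addn1; apply/fil_mulr/fil_mul.
by rewrite -add1n; apply/fil_mul => //; apply: fil_mull.
Qed.

Lemma clifford_Ad Q x : invertible x -> clifford Q -> clifford (Ad x Q).
Proof.
move=> hx hQ i j; rewrite /Ad.
have e k l : x * Q k * inv x * (x * Q l * inv x) = x * (Q k * Q l) * inv x.
  by rewrite !mulrA -(mulrA (x * Q k)) invertible_mulVl // mulr1.
by rewrite !e -mulrDl -mulrDr hQ -scalerAr mulr1 -scalerAl invertible_mulV.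
Qed.

Lemma mul3_fil m (x y P P' q : A) : (0 < m)%N -> fil A m P -> fil A m P' ->
  fil A m.+1 (x - (1 + P)) -> fil A m.+1 (y - (1 + P')) ->
  fil A m.+1 (x * q * y - (q + P * q + q * P')).
Proof.
move=> m0 hP hP' hx hy.
rewrite (_ : _ - _ = (x - (1 + P)) * q * y + (1 + P) * q * (y - (1 + P')) + P * q * P'); last first.
  by nring.
apply: fil_add; first apply: fil_add.
- by do 2!apply: fil_mulr.
- exact: fil_mull.
- apply: (@fil_leq _ _ _ (m + m)); first by rewrite -addn1 leq_add2l.
  by apply: fil_mul => //; apply: fil_mulr.
Qed.

Lemma inv_expA_fil m P : (0 < m)%N -> fil A m P ->
  fil A m.+1 (inv (expA P) - (1 - P)).
Proof.
move=> m0 hP; have h1 : fil A 1 P by apply: fil_leq hP.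
have hi := invertible_expA h1.
rewrite (_ : _ - _ = inv (expA P) * ((1 - expA P * (1 - P)))); last first.
  by rewrite mulrBr mulr1 mulrA invertible_mulVl ?mul1r.
apply: fil_mull.
rewrite (_ : _ - _ = P * P - (expA P - (1 + P)) * (1 - P)); last by nring.
apply: fil_sub; last by apply: fil_mulr; apply: expA_fil2.
by rewrite -add1n; apply: fil_mul.
Qed.

Variable w : weights R n.
Hypothesis hw : connection_data w.

Lemma clifford_diff Q a i : clifford Q -> (a i - Q i) * inv (Q i) = - (a i * Q i) - 1.
Proof. by move=> hQ; rewrite clifford_inv // mulrN mulrBl clifford_sqr // opprK opprD. Qed.

Lemma Step_spec Q a m : (0 < m)%N -> clifford Q -> near a Q ->
  fil A m (Pi w Q (fun i => a i - Q i)) ->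
  [/\ clifford (Step w a Q), near a (Step w a Q),
      forall i, fil A m (Step w a Q i - Q i) &
      fil A m.+1 (Pi w (Step w a Q) (fun i => a i - Step w a Q i))].
Proof.
move=> m0 hQ haQ; set P := Pi w Q _ => hP; set Q' := Step w a Q.
have hP1 : fil A 1 P by apply: fil_leq hP.
have hQ' : clifford Q' by apply: clifford_Ad => //; apply: invertible_expA.
have hD1 i : fil A m.+1 (Q' i - (Q i + P * Q i + Q i * (- P))).
  apply: mul3_fil => //; first exact: fil_opp; first exact: expA_fil2.
  exact: inv_expA_fil.
have hD i : fil A m (Q' i - Q i).
  rewrite (_ : _ - _ = (Q' i - (Q i + P * Q i + Q i * (- P))) + (P * Q i - Q i * P)).
    apply: fil_add; first exact: fil_decr.
    by apply: fil_sub; [apply: fil_mulr|apply: fil_mull].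
  by nring.
have haQ' : near a Q'.
  move=> i; apply: fil_trans (haQ i) _; apply: fil_subC.
  by apply: fil_leq (hD i).
split=> //; rewrite (Pi_connection hQ').
apply: (connection_step (c := clifford_conj hQ)
  (E := fun j => (a j - Q j) * inv (Q j)) (fil_conj hQ) (fil_conj hQ') _ hw).
- exact: conj_perturb.
- by move=> j; apply: fil_mulr.
move=> j; rewrite -Pi_connection -/P /= !clifford_diff // clifford_conjE //.
(* What remains is a product of factors of levels 1 and [m], and the second-order error of the
   formula for [Q' j]. *)
rewrite (_ : _ - _ = - ((a j - Q j) * (Q' j - Q j)) -
   Q j * (Q' j - (Q j + P * Q j + Q j * (- P)))).
  apply: fil_sub; last exact: fil_mull.
  by apply: fil_opp; rewrite -add1n; apply: fil_mul.
have e := clifford_sqr j hQ.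
by rewrite !(mulrBl, mulrBr, mulrDl, mulrDr, mulNr, mulrN, opprD, opprK, mulrA) e
  ?(mulNr, mulrN, opprK, mul1r); zmod.
Qed.

Lemma fixed_uniq Q Q' a : clifford Q -> clifford Q' -> near a Q -> near a Q' ->
  Pi w Q (fun i => a i - Q i) = 0 -> Pi w Q' (fun i => a i - Q' i) = 0 ->
  Q' = Q.
Proof.
move=> hQ hQ' haQ haQ' P0 P0'; apply/funext => i; apply: fil_hausdorff_eq => m.
have e k := clifford_sqr k hQ; have e' k := clifford_sqr k hQ'.
elim: m i => [|m IHm] i; first exact: fil_full.
case: m IHm => [|m] hD; first exact: fil_trans (fil_subC (haQ' i)) (haQ i).
(* Products of two differences lie in level 2M, which is at least M+1 since M is positive. *)
set M := m.+1 in hD *; have hDD k l : fil A M.+1 ((Q' k - Q k) * (Q' l - Q l)).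
  by apply: (@fil_leq _ _ _ (M + M)); [rewrite -add1n leq_add2r|apply: fil_mul].
have hF j : fil A M.+1 ((Q' j - Q j) * inv (Q j)).
  move: j; apply: (connection_uniq (fil_conj hQ) (fil_conj hQ') (conj_perturb hQ hQ' hD)
    hw (E := fun j => (a j - Q j) * inv (Q j)) (E' := fun j => (a j - Q' j) * inv (Q' j))).
  - by rewrite -Pi_connection.
  - by rewrite -Pi_connection.
  - by move=> j; apply: fil_mulr.
  - move=> j; rewrite !clifford_diff //.
    rewrite (_ : _ - _ = - ((a j - Q j) * (Q' j - Q j)) + (Q' j - Q j) * (Q' j - Q j)).
      by apply: fil_add => //; apply: fil_opp; rewrite -add1n; apply: fil_mul.
    by rewrite !(mulrBl, mulrBr, mulrDl, mulrDr, mulNr, mulrN, opprD, opprK, mulrA) e e'; zmod.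
  - move=> j; rewrite /= clifford_conjE // clifford_diff //.
    (* The relations [Q j * Q j = -1] and [Q' j * Q' j = -1] leave only the square of the
       difference. *)
    rewrite (_ : _ + _ = (Q' j - Q j) * (Q' j - Q j)) //.
    rewrite !(mulrBl, mulrBr, mulrDl, mulrDr, mulNr, mulrN, opprD, opprK, mulrA, mulr1) e e'.
    by rewrite -(mulrA (Q j * _)) e mulrN1; zmod.
  - move=> j k; have [->|jk] := eqVneq j k; first by rewrite subrr; apply: fil_zero.
    rewrite /= !clifford_conjE // !clifford_diff //.
    (* The anticommutation relations inside each system leave only the anticommutator of the two
       differences, which is again quadratic. *)
    set Z := (Q' j - Q j) * (Q' k - Q k) + (Q' k - Q k) * (Q' j - Q j).
    rewrite (_ : _ - _ = Z * (Q k * Q j)); first by apply/fil_mulr/fil_add.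
    rewrite /Z; have h1 := clifford_anti hQ jk; have h2 := clifford_anti hQ' jk.
    rewrite !(mulrBl, mulrBr, mulrDl, mulrDr, mulNr, mulrN, opprD, opprK, mulrA, mulr1) h1 h2.
    have t1 x : x * Q j * Q j = - x by rewrite -mulrA e mulrN1.
    have t2 x : x * Q k * Q k = - x by rewrite -mulrA e mulrN1.
    have t3 x : x * Q j * Q k = - (x * Q k * Q j) by rewrite -!mulrA h1 mulrN.
    by rewrite ?(t1, t2, t3, e, mulNr, mulrN, opprK, mul1r); zmod.
have -> : Q' i - Q i = - ((Q' i - Q i) * inv (Q i) * - Q i).
  by rewrite clifford_inv // -mulrA mulrNN e mulrN1 opprK.
by apply/fil_opp/fil_mulr.
Qed.
End CliffordInvolutions.

Section SystemLimit.
Variables (R : realType) (A : convAlg R) (n : nat).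

Lemma fil_tuple_limit (u : nat -> 'I_n -> A) :
  (forall k i, fil A k.+1 (u k.+1 i - u k i)) ->
  exists b : 'I_n -> A, forall i k N, (N <= k.+1)%N -> fil A N (b i - u k i).
Proof.
move=> h; have /choice[b hb] : forall i, exists l, forall k, fil A k.+1 (l - u k i).
  move=> i; have [l hl] : exists l, forall m k, (m <= k)%N -> fil A m (l - u k i).
    by apply: fil_complete_leq => k; apply: fil_decr.
  (* Completeness alone puts [l - u k.+1 i] in level [k.+1]; the increment before it is just as
     small, which gains one index. *)
  exists l => k; apply: (@fil_trans _ _ _ (u k.+1 i)); [exact: hl|exact: h].
by exists b => i k N Nk; apply: fil_leq (hb i k).
Qed.

Lemma clifford_limit (u : nat -> 'I_n -> A) b : (forall k, clifford (u k)) ->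
  (forall k i, fil A k (b i - u k i)) -> clifford b.
Proof.
move=> hu hb i j; rewrite -(hu 0%N i j); apply: fil_hausdorff_eq => k.
rewrite (hu 0%N i j) -(hu k i j).
rewrite (_ : _ - _ = (b i - u k i) * b j + u k i * (b j - u k j) +
  ((b j - u k j) * b i + u k j * (b i - u k i))); last by nring.
by apply: fil_add; apply: fil_add; (exact: fil_mulr || exact: fil_mull).
Qed.

Variable w : weights R n.
Hypothesis hw : connection_data w.

Definition fixed_system (a b : 'I_n -> A) : Prop :=
  [/\ clifford b, near a b & Pi w b (fun i => a i - b i) = 0].

Lemma Step_limit a Q : clifford Q -> near a Q ->
  exists2 b, fixed_system a b &
    forall i k N, (N <= k.+1)%N -> fil A N (b i - iter k (Step w a) Q i).
Proof.
move=> hQ haQ; set u := fun k => iter k (Step w a) Q.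
have hu k : [/\ clifford (u k), near a (u k) &
    fil A k.+1 (Pi w (u k) (fun i => a i - u k i))].
  elim: k => [|k [h1 h2 h3]]; first by split=> //; apply: Pi_fil.
  by have [] := Step_spec hw _ h1 h2 h3.
have hu' k i : fil A k.+1 (u k.+1 i - u k i).
  by have [h1 h2 h3] := hu k; have [_ _ h _] := Step_spec hw (ltn0Sn k) h1 h2 h3; apply: h.
have [b hb] := fil_tuple_limit hu'; exists b => //.
have hbc : clifford b.
  by apply: (@clifford_limit u) => [k|k i]; [have [] := hu k|apply: hb].
have hab : near a b.
  by move=> i; apply: fil_trans (haQ i) (fil_subC _); apply: (hb i 0%N).
(* The equation for [b] is compared with that for the k-th iterate, which holds up to level [k.+1]:
   replacing the involutions and the quotients costs no more than that level. *)
split=> //; apply: fil_hausdorff => k.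
have [h1 h2 h3] := hu k; apply: fil_decr; rewrite (Pi_connection hbc).
apply: (fil_eq (connection_perturb w (fil_conj h1) (fil_conj hbc) _ _)).
- by apply: conj_perturb => i; apply: hb.
- by move=> j; apply: fil_mulr.
move: h3; rewrite (Pi_connection h1); apply: fil_eq.
rewrite -connectionB; apply: fil_connection => [|j]; first exact: fil_conj.
have hd : fil A k.+1 (b j - u k j) by apply: hb.
rewrite (_ : _ - _ = - (b j - u k j) * inv (b j) + (a j - u k j) * (inv (b j) - inv (u k j))).
  by apply: fil_add; [apply/fil_mulr/fil_opp|rewrite !clifford_inv //; apply: fil_mull;
    rewrite -opprD; apply: fil_opp].
by nring.
Qed.

(** Independence of the starting system is not read off from the iteration; it comes from the
    uniqueness of the solution. *)
Lemma O_procP a b : O_proc w a b <-> fixed_system a b.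
Proof.
have uniq b' b'' : fixed_system a b' -> fixed_system a b'' -> b' = b''.
  by move=> [h1 h2 h3] [h4 h5 h6]; apply: (fixed_uniq hw h4 h1 h5 h2).
have lim Q : clifford Q -> near a Q -> exists2 b', fixed_system a b' &
    forall i, cvgA (fun k => iter k (Step w a) Q i) (b' i).
  move=> hQ haQ; have [b' hb' hl] := Step_limit hQ haQ; exists b' => // i.
  by apply: fil_cvgA => N; exists N => k Nk; apply: hl; rewrite leqW.
split=> [[[Q [hQ haQ]] h]|hb].
  have [b' hb' hl] := lim Q hQ haQ.
  suff -> : b = b' by [].
  by apply/funext => i; apply: (cvgA_unique (h Q hQ haQ i)).
split; first by have [h1 h2 _] := hb; exists b.
by move=> Q hQ haQ; have [b' hb' hl] := lim Q hQ haQ; rewrite (uniq _ _ hb hb').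
Qed.

Lemma O_proc_exists (a : 'I_n -> A) : dom a -> exists b : 'I_n -> A, O_proc w a b.
Proof.
move=> [Q [hQ haQ]]; have [b hb _] := Step_limit hQ haQ.
by exists b; apply/O_procP.
Qed.
End SystemLimit.

(** * Floating Clifford systems *)
Section TwistedInvolutions.
Variables (R : realType) (V : lmodType R) (n : nat) (c : involutions V n).
Variable h : 'I_n.

Fact twist_linear i : linear (fun x => c h (c i x)).
Proof. by move=> a x y; rewrite !iop_linear. Qed.
Fact twistK i : involutive (fun x => c h (c i x)).
Proof. by move=> x; rewrite (iopC c i h) !iopK. Qed.
Fact twistC i j x : c h (c i (c h (c j x))) = c h (c j (c h (c i x))).
Proof. by rewrite !(iopC c h) (iopC c i j). Qed.
(** In the floating case these products preserve the two halves of the square, where they are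
    conjugations by [Q i * inv (Q h)] and by [inv (Q h) * Q i], as in the definition of the floating
    quotients. *)
Definition twist := Involutions twist_linear twistK twistC.

(* The products of the involutions determine the component [s] up to
   complementation, and the sign at [j] fixes which of the two occurs. *)
Lemma eigenparts_twist (s : bvec n) j x : s j -> c j x = - x ->
  eigenparts twist (enum 'I_n) (fun i => s i (+) s h) x =
  eigenparts c (enum 'I_n) s x.
Proof.
(* Every [x] with [c j x = - x] is [y - c j y] for [y] half of [x]. Stated for all [y], the claim is
   additive and can be checked on joint eigenvectors. *)
move=> sj cx; pose P y := eigenparts twist (enum 'I_n) (fun i => s i (+) s h) (y - c j y) =
  eigenparts c (enum 'I_n) s (y - c j y).
suff : P ((2%:R^-1 : R) *: x) by rewrite /P iopZ cx scalerN opprK -scalerDr scaler_half.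
apply: (eigen_ind (c := c) (P := P)) => [y z|t y ht].
  rewrite /P iopD opprD addrACA => hy hz.
  by rewrite [LHS]linearD /= hy hz [RHS]linearD.
rewrite /P ht; case: (boolP (t j)) => tj; last first.
  by rewrite expr0 scale1r subrr [LHS]linear0 [RHS]linear0.
rewrite scaleN1r opprK; set z := y + y.
have hz i : c i z = (-1) ^+ t i *: z by rewrite iopD ht scalerDr.
rewrite (full_eigen _ hz) (@eigenparts_eigen _ _ _ _ _ _ (fun i => t h (+) t i)).
  congr (if _ then _ else _); apply/allP/eqP => [H|-> i _]; last by rewrite addbC.
  apply/ffunP => i; have := H i (mem_enum _ _); have := H j (mem_enum _ _).
  by rewrite sj tj; case: (s i) (s h) (t i) (t h) => [] [] [] [].
by move=> i _ /=; rewrite hz iopZ hz scalerA -signr_addb addbC.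
Qed.
End TwistedInvolutions.

Section FloatingInvolutions.
Variables (R : realType) (A : convAlg R) (n : nat).
Implicit Types (Q X a b : 'I_n -> A) (x y : A).
Local Notation V := (sum_convAlg A A).

(** The form of a floating Clifford system that singles out no entry; the equivalence is
    [fl_cliffordP]. *)
Definition floating Q : Prop := (forall i, invertible (Q i)) /\
  (forall i j, i != j -> Q i * inv (Q j) = - (Q j * inv (Q i))).

Lemma floating_mulV Q i : floating Q -> Q i * inv (Q i) = 1.
Proof. by move=> [h _]; apply: invertible_mulV. Qed.

Lemma floating_mulVl Q i : floating Q -> inv (Q i) * Q i = 1.
Proof. by move=> [h _]; apply: invertible_mulVl. Qed.

Lemma floating_anti Q i j : floating Q -> i != j ->
  Q i * inv (Q j) = - (Q j * inv (Q i)).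
Proof. by move=> [_]; apply. Qed.

Lemma floating_antil Q i j : floating Q -> i != j ->
  inv (Q i) * Q j = - (inv (Q j) * Q i).
Proof.
move=> hQ ij; have h := floating_anti hQ ij.
transitivity (inv (Q i) * (Q j * inv (Q i)) * Q i).
  by rewrite -!mulrA floating_mulVl // mulr1.
by rewrite -[Q j * _]opprK -h mulrN mulNr !mulrA floating_mulVl // mul1r.
Qed.

Lemma floatingP Q (v : 'I_n -> A) :
  (forall i, Q i * v i = 1) -> (forall i, v i * Q i = 1) ->
  (forall i j, i != j -> Q i * v j = - (Q j * v i)) ->
  floating Q /\ (forall i, inv (Q i) = v i).
Proof.
move=> h1 h2 h3; have e i : inv (Q i) = v i by apply: inv_eq.
by split=> //; split=> [i|i j ij]; [exists (v i)|rewrite !e h3].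
Qed.

Section Swap.
Variables (Q : 'I_n -> A) (hQ : floating Q).

Definition swap i (x : V) : V :=
  (- (Q i * x.2 * inv (Q i)), - (inv (Q i) * x.1 * Q i)).

Fact swap_linear i : linear (swap i).
Proof.
move=> a [x1 x2] [y1 y2]; congr pair => /=;
by rewrite mulrDr mulrDl -scalerAr -scalerAl opprD scalerN.
Qed.
Fact swapK i : involutive (swap i).
Proof.
move=> [x y]; congr pair => /=; rewrite mulrN mulNr opprK !mulrA.
  by rewrite floating_mulV // mul1r -mulrA floating_mulV // mulr1.
by rewrite floating_mulVl // mul1r -mulrA floating_mulVl // mulr1.
Qed.
Fact swapC i j (x : V) : swap i (swap j x) = swap j (swap i x).
Proof.
have [->//|ij] := eqVneq i j.
have h1 := floating_anti hQ ij; have h2 := floating_antil hQ ij.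
case: x => x y; congr pair => /=; rewrite !(mulrN, mulNr) !opprK.
  have e k l : Q k * (inv (Q l) * x * Q l) * inv (Q k) =
    Q k * inv (Q l) * x * (Q l * inv (Q k)) by rewrite !mulrA.
  by rewrite !e h1 mulrN !mulNr.
have e k l : inv (Q k) * (Q l * y * inv (Q l)) * Q k =
  inv (Q k) * Q l * y * (inv (Q l) * Q k) by rewrite !mulrA.
by rewrite !e h2 mulrN !mulNr.
Qed.
Definition floating_swap : involutions V n := Involutions swap_linear swapK swapC.

Definition biquo X (j : 'I_n) : V := (X j * inv (Q j), inv (Q j) * X j).

(** This sign is the hypothesis under which the twisted parts recover the untwisted ones. *)
Lemma swap_biquo X j : floating_swap j (biquo X j) = - biquo X j.
Proof.
congr pair => /=; rewrite !mulrA.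
  by rewrite floating_mulV // mul1r.
by rewrite -mulrA floating_mulVl // mulr1.
Qed.

Lemma partsE h r (s : 'I_n -> bool) (x : V) :
  eigenparts (twist floating_swap h) r s x =
  (parts r (fun i => Q i * inv (Q h)) s x.1, parts r (fun i => inv (Q h) * Q i) s x.2).
Proof.
have invh i : invertible (Q i) by case: hQ.
elim: r x => [|i r IHr] [x y] //=; rewrite IHr; congr pair; rewrite /parts [RHS]/=; congr foldl.
  rewrite /part /eigenpart /=; congr (_ *: (_ + _)).
  rewrite inv_mul ?inv_inv //; last exact: invertible_inv.
  by rewrite !(mulrN, mulNr) opprK !mulrA; case: (s i);
    rewrite ?expr0 ?expr1 ?mulN1r ?scaleN1r ?mul1r ?scale1r // !mulNr.
(* [part] conjugates with the inverse on the left; in the second half this is the opposite order of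
   the two swaps. *)
have tE : twist floating_swap h i (x, y) = floating_swap i (floating_swap h (x, y)).
  exact: iopC.
rewrite /part /eigenpart tE /=; congr (_ *: (_ + _)).
rewrite inv_mul ?inv_inv //; last exact: invertible_inv.
by rewrite !(mulrN, mulNr) opprK !mulrA; case: (s i);
  rewrite ?expr0 ?expr1 ?mulN1r ?scaleN1r ?mul1r ?scale1r // !mulNr.
Qed.

Variables (w : weights R n) (hw : connection_data w).

Lemma fPi_connection h X : fPi h w Q X = connection floating_swap w (biquo X).
Proof.
rewrite /fPi /connection.
have -> : \sum_j \sum_(s : bvec n) w s j *: eigenparts floating_swap (enum 'I_n) s (biquo X j)
  = (\sum_j \sum_s w s j *: frquo h Q X s j, \sum_j \sum_s w s j *: flquo h Q X s j) :> V.
  transitivity (\sum_j \sum_(s : bvec n) ((w s j *: frquo h Q X s j, w s j *: flquo h Q X s j) : V)).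
    apply: eq_bigr => j _; apply: eq_bigr => s _.
    case: (boolP (s j)) => sj.
      by rewrite -(eigenparts_twist h sj (swap_biquo X j)) partsE.
    (* For [s j = false] the twisted and untwisted parts may differ, but there the weight
       vanishes. *)
    by rewrite (proj1 hw s j (negbTE sj)) !scale0r.
  have pairs (I : finType) (F : I -> V) : \sum_i F i = (\sum_i (F i).1, \sum_i (F i).2).
    by elim/big_rec3: _ => // i y1 y2 z _ ->.
  by rewrite pairs /=; congr pair; apply: eq_bigr => j _; rewrite pairs.
by [].
Qed.

Lemma fil_swap k i (x : V) : fil V k x -> fil V k (floating_swap i x).
Proof.
by move=> [h1 h2]; split; apply: fil_opp; apply: fil_mulr; apply: fil_mull.
Qed.

Lemma fil_biquo k X j : fil A k (X j) -> fil V k (biquo X j).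
Proof. by move=> h; split; [apply: fil_mulr|apply: fil_mull]. Qed.

Lemma fPi_fil h k X : (forall i, fil A k (X i)) -> fil V k (fPi h w Q X).
Proof.
move=> hX; rewrite fPi_connection; apply: fil_connection => [l i x|j].
  exact: fil_swap.
exact: fil_biquo.
Qed.
End Swap.

Lemma swap_perturb Q Q' (hQ : floating Q) (hQ' : floating Q') m :
  (forall i, fil A m (Q' i - Q i)) ->
  forall i (x : V), fil V 1 x ->
  fil V m.+1 (floating_swap hQ' i x - floating_swap hQ i x).
Proof.
move=> hD i [x y] [/= hx hy].
have hi : fil A m (inv (Q' i) - inv (Q i)).
  by apply: inv_fil => //; [case: hQ'|case: hQ].
have k z u : fil A 1 z -> fil A m u -> fil A m.+1 (u * z).
  by move=> hz hu; rewrite -addn1; apply: fil_mul.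
have k' z u : fil A 1 z -> fil A m u -> fil A m.+1 (z * u).
  by move=> hz hu; rewrite -add1n; apply: fil_mul.
split=> /=.
  rewrite (_ : _ - _ = - ((Q' i - Q i) * y * inv (Q' i) + Q i * (y * (inv (Q' i) - inv (Q i))))).
    by apply/fil_opp/fil_add; [apply/fil_mulr/k|apply/fil_mull/k'].
  by nring.
rewrite (_ : _ - _ = - ((inv (Q' i) - inv (Q i)) * x * Q' i + inv (Q i) * (x * (Q' i - Q i)))).
  by apply/fil_opp/fil_add; [apply/fil_mulr/k|apply/fil_mull/k'].
by nring.
Qed.

Lemma floating_fAd Q (x y : A) : invertible x -> invertible y -> floating Q ->
  floating (fAd (x, y) Q) /\ forall i, inv (fAd (x, y) Q i) = inv y * inv (Q i) * inv x.
Proof.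
move=> hx hy hQ; apply: floatingP => [i|i|i j ij]; rewrite /fAd /=.
- rewrite !mulrA -(mulrA (x * _)) invertible_mulV // mulr1.
  by rewrite -(mulrA x) floating_mulV // mulr1 invertible_mulV.
- rewrite !mulrA -(mulrA (_ * inv (Q i))) invertible_mulVl // mulr1.
  by rewrite -(mulrA (inv y)) floating_mulVl // mulr1 invertible_mulVl.
have e k l : x * Q k * y * (inv y * inv (Q l) * inv x) = x * (Q k * inv (Q l)) * inv x.
  by rewrite !mulrA -(mulrA (x * Q k)) invertible_mulV // mulr1.
by rewrite !e floating_anti // mulrN mulNr.
Qed.

Variable w : weights R n.
Hypothesis hw : connection_data w.

Lemma biquo_diff Q a i : floating Q ->
  biquo Q (fun j => a j - Q j) i = (a i * inv (Q i) - 1, inv (Q i) * a i - 1).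
Proof. by move=> hQ; rewrite /biquo mulrBl mulrBr floating_mulV // floating_mulVl. Qed.

Lemma fStep_spec h Q a m : (0 < m)%N -> floating Q -> near a Q ->
  fil V m (fPi h w Q (fun i => a i - Q i)) ->
  [/\ floating (fStep h w a Q), near a (fStep h w a Q),
      forall i, fil A m (fStep h w a Q i - Q i) &
      fil V m.+1 (fPi h w (fStep h w a Q) (fun i => a i - fStep h w a Q i))].
Proof.
move=> m0 hQ haQ; set P : V := fPi h w Q _; set Q' := fStep h w a Q => -[hP1 hP2].
have hP1' : fil A 1 P.1 by apply: fil_leq hP1.
have hP2' : fil A 1 P.2 by apply: fil_leq hP2.
have [hQ' iQ'] := floating_fAd (invertible_expA hP1') (invertible_expA hP2') hQ.
rewrite -[fAd _ _]/Q' in hQ' iQ'.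
have hD1 i : fil A m.+1 (Q' i - (Q i + P.1 * Q i + Q i * P.2)).
  by apply: mul3_fil => //; exact: expA_fil2.
have hD i : fil A m (Q' i - Q i).
  rewrite (_ : _ - _ = (Q' i - (Q i + P.1 * Q i + Q i * P.2)) + (P.1 * Q i + Q i * P.2)).
    apply: fil_add; first exact: fil_decr.
    by apply: fil_add; [apply: fil_mulr|apply: fil_mull].
  by nring.
have hv i : fil A m (inv (Q' i) - inv (Q i)).
  by apply: inv_fil => //; [case: hQ'|case: hQ].
have haQ' : near a Q'.
  move=> i; apply: fil_trans (haQ i) _; apply: fil_subC.
  by apply: fil_leq (hD i).
have PE : fPi h w Q (fun i => a i - Q i) = P by [].
clearbody Q' P; split=> //; rewrite (fPi_connection hQ') //.
apply: (connection_step (fil_swap hQ) (fil_swap hQ') (swap_perturb hQ hQ' hD) hw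
  (E := biquo Q (fun j => a j - Q j))).
- by move=> j; apply: fil_biquo.
move=> j; rewrite -(fPi_connection hQ hw h) PE !biquo_diff //.
have ivQ : invertible (Q j) by case: hQ.
have ivQ' : invertible (Q' j) by case: hQ'.
have k x u : fil A 1 x -> fil A m u -> fil A m.+1 (u * x).
  by move=> hz hu; rewrite -addn1; apply: fil_mul.
have k' x u : fil A 1 x -> fil A m u -> fil A m.+1 (x * u).
  by move=> hz hu; rewrite -add1n; apply: fil_mul.
have kk x y : fil A m x -> fil A m y -> fil A m.+1 (x * y).
  by move=> hx hy; apply: k' => //; apply: fil_leq hx.
have e1 := floating_mulV j hQ; have e2 := floating_mulVl j hQ.
have e1' := floating_mulV j hQ'; have e2' := floating_mulVl j hQ'.
have t1 x : x * Q j * inv (Q j) = x by rewrite -mulrA e1 mulr1.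
have t2 x : x * inv (Q j) * Q j = x by rewrite -mulrA e2 mulr1.
have t1' x : x * Q' j * inv (Q' j) = x by rewrite -mulrA e1' mulr1.
have t2' x : x * inv (Q' j) * Q' j = x by rewrite -mulrA e2' mulr1.
split=> /=.
  (* As in the plain case the defect is quadratic, apart from the error of the first-order formula
     for [Q' j]; the change of the inverse contributes a quadratic term of its own. *)
  rewrite (_ : _ - _ = - ((a j - Q j) * (inv (Q j) * (Q' j - Q j) * inv (Q' j)))
     - (Q' j - Q j) * (inv (Q' j) - inv (Q j))
     - (Q' j - (Q j + P.1 * Q j + Q j * P.2)) * inv (Q j)).
    apply: fil_sub; last exact: fil_mulr.
    apply: fil_sub; last exact: kk.
    by apply/fil_opp/k'; [exact: haQ|apply/fil_mulr/fil_mull].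
  rewrite !(mulrBl, mulrBr, mulrDl, mulrDr, mulNr, mulrN, opprD, opprK, mulrA).
  by rewrite ?(t1, t2, t1', t2', e1, e2, e1', e2', mul1r); zmod.
rewrite (_ : _ - _ = - (inv (Q' j) * (Q' j - Q j) * inv (Q j) * (a j - Q j))
     - (inv (Q' j) - inv (Q j)) * (Q' j - Q j)
     - inv (Q j) * (Q' j - (Q j + P.1 * Q j + Q j * P.2))).
  apply: fil_sub; last exact: fil_mull.
  apply: fil_sub; last exact: kk.
  by apply/fil_opp/k; [exact: haQ|apply/fil_mulr/fil_mull].
rewrite !(mulrBl, mulrBr, mulrDl, mulrDr, mulNr, mulrN, opprD, opprK, mulrA).
by rewrite ?(t1, t2, t1', t2', e1, e2, e1', e2', mul1r); zmod.
Qed.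

Lemma ffixed_uniq h Q Q' a : floating Q -> floating Q' -> near a Q -> near a Q' ->
  fPi h w Q (fun i => a i - Q i) = 0 -> fPi h w Q' (fun i => a i - Q' i) = 0 ->
  Q' = Q.
Proof.
move=> hQ hQ' haQ haQ' P0 P0'; apply/funext => i; apply: fil_hausdorff_eq => m.
elim: m i => [|m IHm] i; first exact: fil_full.
case: m IHm => [|m] hD; first exact: fil_trans (fil_subC (haQ' i)) (haQ i).
set M := m.+1 in hD *.
have hv k : fil A M (inv (Q' k) - inv (Q k)).
  by apply: inv_fil => //; [case: hQ'|case: hQ].
have kk x y : fil A M x -> fil A M y -> fil A M.+1 (x * y).
  move=> hx hy; apply: (@fil_leq _ _ _ (M + M)); [by rewrite -add1n leq_add2r|].
  exact: fil_mul.
have ivQ k : invertible (Q k) by case: hQ.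
have ivQ' k : invertible (Q' k) by case: hQ'.
have e1 k := floating_mulV k hQ; have e2 k := floating_mulVl k hQ.
have e1' k := floating_mulV k hQ'; have e2' k := floating_mulVl k hQ'.
have t1 k x : x * Q k * inv (Q k) = x by rewrite -mulrA e1 mulr1.
have t2 k x : x * inv (Q k) * Q k = x by rewrite -mulrA e2 mulr1.
have t1' k x : x * Q' k * inv (Q' k) = x by rewrite -mulrA e1' mulr1.
have t2' k x : x * inv (Q' k) * Q' k = x by rewrite -mulrA e2' mulr1.
(* The inverse of an entry is no longer its negative, so it is not linear in the system and has to
   be expanded to first order. *)
have hv2 k : fil A M.+1 (inv (Q' k) - (inv (Q k) - inv (Q k) * (Q' k - Q k) * inv (Q k))).
  rewrite (_ : _ - _ = - (inv (Q k) * (Q' k - Q k) * (inv (Q' k) - inv (Q k)))).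
    by apply/fil_opp/kk => //; apply: fil_mull.
  rewrite !(mulrBl, mulrBr, mulrDl, mulrDr, mulNr, mulrN, opprD, opprK, mulrA).
  by rewrite ?(t1, t2, t1', t2', e1, e2, e1', e2', mul1r); zmod.
suff hF j : fil V M.+1 (biquo Q (fun j => Q' j - Q j) j).
  have [h1 _] := hF i; rewrite (_ : _ - _ = (Q' i - Q i) * inv (Q i) * Q i); last by rewrite t2.
  exact: fil_mulr.
move: j; apply: (connection_uniq (fil_swap hQ) (fil_swap hQ') (swap_perturb hQ hQ' hD) hw
  (E := biquo Q (fun j => a j - Q j)) (E' := biquo Q' (fun j => a j - Q' j))).
- by rewrite -(fPi_connection hQ hw h).
- by rewrite -(fPi_connection hQ' hw h).
- by move=> j; apply: fil_biquo.
- move=> j; rewrite !biquo_diff //; split=> /=.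
    rewrite (_ : _ - _ = - ((a j - Q j) * (inv (Q j) * (Q' j - Q j) * inv (Q' j)))
     - (Q' j - Q j) * (inv (Q' j) - inv (Q j))).
      apply: fil_sub; last exact: kk.
      by apply/fil_opp; rewrite -add1n; apply: fil_mul => //; apply/fil_mulr/fil_mull.
    rewrite !(mulrBl, mulrBr, mulrDl, mulrDr, mulNr, mulrN, opprD, opprK, mulrA).
    by rewrite ?(t1, t2, t1', t2', e1, e2, e1', e2', mul1r); zmod.
  rewrite (_ : _ - _ = - (inv (Q' j) * (Q' j - Q j) * inv (Q j) * (a j - Q j))
     - (inv (Q' j) - inv (Q j)) * (Q' j - Q j)).
    apply: fil_sub; last exact: kk.
    by apply/fil_opp; rewrite -addn1; apply: fil_mul => //; apply/fil_mulr/fil_mull.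
  rewrite !(mulrBl, mulrBr, mulrDl, mulrDr, mulNr, mulrN, opprD, opprK, mulrA).
  by rewrite ?(t1, t2, t1', t2', e1, e2, e1', e2', mul1r); zmod.
- by move=> j; rewrite swap_biquo subrr; apply: fil_zero.
- move=> j k; have [->|jk] := eqVneq j k; first by rewrite subrr; apply: fil_zero.
  have h1 := floating_anti hQ jk; have h1' := floating_anti hQ' jk.
  have h2 := floating_antil hQ jk; have h2' := floating_antil hQ' jk.
  set D := fun l => Q' l - Q l.
  (* An exact relation between quotients of [Q'] passes, up to level [M.+1], to their first-order
     expansions around [Q]. *)
  have hy (x x' y y' : A) : fil A M.+1 (x' - x) -> fil A M.+1 (y' - y) ->
      x' + y' = 0 -> fil A M.+1 (x + y).
    move=> hx hy e0; rewrite -[x + y]subr0 -e0; apply: fil_subC.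
    by rewrite opprD addrACA; apply: fil_add.
  have dv l l' : fil A M.+1 (Q' l * inv (Q' l') -
      (Q l * inv (Q l') + D l * inv (Q l') - Q l * inv (Q l') * D l' * inv (Q l'))).
    rewrite (_ : _ - _ = Q' l * (inv (Q' l') - (inv (Q l') - inv (Q l') * (Q' l' - Q l') * inv (Q l')))
      - (Q' l - Q l) * (inv (Q l') * (Q' l' - Q l') * inv (Q l'))).
      by apply: fil_sub; [apply: fil_mull|apply: kk => //; apply/fil_mulr/fil_mull].
    by rewrite /D; nring.
  have dv' l l' : fil A M.+1 (inv (Q' l) * Q' l' -
      (inv (Q l) * Q l' + inv (Q l) * D l' - inv (Q l) * D l * inv (Q l) * Q l')).
    rewrite (_ : _ - _ = (inv (Q' l) - (inv (Q l) - inv (Q l) * (Q' l - Q l) * inv (Q l))) * Q' l'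
      - (inv (Q l) * (Q' l - Q l) * inv (Q l)) * (Q' l' - Q l')).
      by apply: fil_sub; [apply: fil_mulr|apply: kk => //; apply/fil_mulr/fil_mull].
    by rewrite /D; nring.
  split=> /=.
    have := hy _ _ _ _ (dv k j) (dv j k); rewrite h1' addrN => /(_ erefl) H.
    rewrite (_ : _ - _ = ((Q k * inv (Q j) + D k * inv (Q j) - Q k * inv (Q j) * D j * inv (Q j))
       + (Q j * inv (Q k) + D j * inv (Q k) - Q j * inv (Q k) * D k * inv (Q k))) * - (Q k * inv (Q j))).
      exact: fil_mulr.
    rewrite -/(D j) -/(D k).
    have u1 x : x * inv (Q j) * Q k * inv (Q j) = - (x * inv (Q k)).
      by rewrite -!mulrA (mulrA (inv (Q j))) h2 mulNr -mulrA e1 mulr1 mulrN.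
    rewrite !(mulrBl, mulrBr, mulrDl, mulrDr, mulNr, mulrN, opprD, opprK, mulrA).
    by rewrite h1 ?(mulrN, mulNr, opprK) ?(u1, t2) ?(opprK, mulrN, mulNr) ?e1; zmod.
  have := hy _ _ _ _ (dv' k j) (dv' j k); rewrite h2' addrN => /(_ erefl) H.
  rewrite (_ : _ - _ = - (inv (Q j) * Q k) * ((inv (Q k) * Q j + inv (Q k) * D j - inv (Q k) * D k * inv (Q k) * Q j)
     + (inv (Q j) * Q k + inv (Q j) * D k - inv (Q j) * D j * inv (Q j) * Q k))).
    exact: fil_mull.
  rewrite -/(D j) -/(D k).
  rewrite !(mulrBl, mulrBr, mulrDl, mulrDr, mulNr, mulrN, opprD, opprK, mulrA).
  have u1 : inv (Q j) * Q k * inv (Q j) = - inv (Q k).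
    by rewrite h2 mulNr t1.
  by rewrite ?(u1, t1, e2) ?(opprK, mulrN, mulNr) ?(t1, e2); zmod.
Qed.

End FloatingInvolutions.

Section FloatingLimit.
Variables (R : realType) (A : convAlg R) (n : nat).
Local Notation V := (sum_convAlg A A).

(** The product of the i-th and j-th entries of the tail is minus the quotient of the corresponding
    entries of [Q]: equal indices give the squares -1, distinct ones translate anticommutation into
    antisymmetry of the quotients. *)
Lemma fl_cliffordP (Q : 'I_n.+1 -> A) : fl_clifford Q <-> floating Q.
Proof.
split=> [[h0 hT]|hQ].
  have TE i : Q (lift ord0 i) * inv (Q ord0) = fl_tail Q i by [].
  move: (fl_tail Q) hT TE => T hT TE.
  have QE i : Q (lift ord0 i) = T i * Q ord0.
    by rewrite -TE -mulrA invertible_mulVl // mulr1.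
  have iT i : invertible (T i) by apply: clifford_invertible.
  have iQ i : invertible (Q i).
    by case: (unliftP ord0 i) => [j ->|-> //]; rewrite QE; apply: invertible_mul.
  have vE i : inv (Q (lift ord0 i)) = - (inv (Q ord0) * T i).
    by rewrite QE inv_mul // (clifford_inv i hT) mulrN.
  have vE0 i : Q ord0 * inv (Q (lift ord0 i)) = - T i.
    by rewrite vE mulrN mulrA invertible_mulV // mul1r.
  split=> // i j; case: (unliftP ord0 i) => [i' ->|->]; case: (unliftP ord0 j) => [j' ->|->] //.
  - rewrite (inj_eq lift_inj) => ij; rewrite 2!vE !mulrN !mulrA 2!TE.
    by rewrite (clifford_anti hT ij).
  - by rewrite vE0 opprK TE.
  - by rewrite vE0 TE.
have h0 : invertible (Q ord0) by case: hQ.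
split=> //; have ne i : lift ord0 i != ord0 :> 'I_n.+1 by [].
have e i j : fl_tail Q i * fl_tail Q j = - (Q (lift ord0 i) * inv (Q (lift ord0 j))).
  rewrite /fl_tail (floating_anti hQ (ne j)) mulrN; congr (- _).
  by rewrite mulrA -(mulrA _ (inv _)) invertible_mulVl // mulr1.
apply: cliffordP => [i|i j ij]; rewrite !e; first by rewrite floating_mulV.
by rewrite (floating_anti hQ) ?(inj_eq lift_inj).
Qed.

Lemma floating_limit (u : nat -> 'I_n -> A) b : (forall k, floating (u k)) ->
  (forall k i, fil A k.+1 (b i - u k i)) -> floating b.
Proof.
move=> hu hb; have ib i : invertible (b i).
  (* The limit is an invertible element times a unipotent one. *)
  have -> : b i = u 0%N i * (inv (u 0%N i) * b i).
    by rewrite mulrA floating_mulV // mul1r.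
  apply: invertible_mul; first by have [] := hu 0%N.
  apply: invertible_fil; rewrite -(floating_mulVl i (hu 0%N)) -mulrBr.
  exact: fil_mull.
split=> // i j ij; apply: fil_hausdorff_eq => k.
have huv l : fil A k (inv (b l) - inv (u k l)).
  by apply: inv_fil => //; [have [] := hu k|apply: fil_decr].
have hub l : fil A k (b l - u k l) by apply: fil_decr.
rewrite (_ : _ - _ = (b i - u k i) * inv (b j) + u k i * (inv (b j) - inv (u k j)) +
  ((b j - u k j) * inv (b i) + u k j * (inv (b i) - inv (u k i)))).
  by apply: fil_add; apply: fil_add; (exact: fil_mulr || exact: fil_mull).
rewrite !(mulrBl, mulrBr) (floating_anti (hu k) ij); zmod.
Qed.

Variables (w : weights R n) (h : 'I_n).
Hypothesis hw : connection_data w.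

Definition ffixed_system (a b : 'I_n -> A) : Prop :=
  [/\ floating b, near a b & fPi h w b (fun i => a i - b i) = 0].

Lemma fStep_limit a Q : floating Q -> near a Q ->
  exists2 b, ffixed_system a b &
    forall i k N, (N <= k.+1)%N -> fil A N (b i - iter k (fStep h w a) Q i).
Proof.
move=> hQ haQ; set u := fun k => iter k (fStep h w a) Q.
have hu k : [/\ floating (u k), near a (u k) &
    fil V k.+1 (fPi h w (u k) (fun i => a i - u k i))].
  elim: k => [|k [h1 h2 h3]]; first by split=> //; apply: fPi_fil.
  by have [] := fStep_spec hw _ h1 h2 h3.
have hu' k i : fil A k.+1 (u k.+1 i - u k i).
  by have [h1 h2 h3] := hu k; have [_ _ H _] := fStep_spec hw (ltn0Sn k) h1 h2 h3; apply: H.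
have [b hb] := fil_tuple_limit hu'; exists b => //.
have hbc : floating b.
  by apply: (@floating_limit u) => [k|k i]; [have [] := hu k|apply: hb].
have hab : near a b.
  by move=> i; apply: fil_trans (haQ i) (fil_subC _); apply: (hb i 0%N).
split=> //; apply: (@fil_hausdorff _ V) => k.
have [h1 h2 h3] := hu k; apply: fil_decr; rewrite (fPi_connection hbc hw).
apply: (fil_eq (connection_perturb w (fil_swap h1) (fil_swap hbc) _ _)).
- by apply: swap_perturb => i; apply: hb.
- by move=> j; apply: fil_biquo.
move: h3; rewrite (fPi_connection h1 hw); apply: fil_eq.
rewrite -connectionB; apply: fil_connection => [|j]; first exact: fil_swap.
have hd : fil A k.+1 (b j - u k j) by apply: hb.
have hv : fil A k.+1 (inv (b j) - inv (u k j)).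
  by apply: inv_fil => //; [case: hbc|case: h1].
split=> /=.
  rewrite (_ : _ - _ = - (b j - u k j) * inv (b j) + (a j - u k j) * (inv (b j) - inv (u k j))).
    by apply: fil_add; [apply/fil_mulr/fil_opp|apply: fil_mull].
  by nring.
rewrite (_ : _ - _ = inv (b j) * - (b j - u k j) + (inv (b j) - inv (u k j)) * (a j - u k j)).
  by apply: fil_add; [apply/fil_mull/fil_opp|apply: fil_mulr].
by nring.
Qed.
End FloatingLimit.

Section FloatingProcedure.
Variables (R : realType) (A : convAlg R) (n : nat) (w : weights R n.+1).
Hypothesis hw : connection_data w.
Implicit Types a b : 'I_n.+1 -> A.

Lemma ffixed_system_index h h' a b : ffixed_system w h a b -> ffixed_system w h' a b.
Proof.
by move=> [h1 h2 h3]; split=> //; rewrite fPi_connection // -(fPi_connection h1 hw h).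
Qed.

Lemma fO_procP a b : fO_proc w a b <-> ffixed_system w ord0 a b.
Proof.
have uniq b' b'' : ffixed_system w ord0 a b' -> ffixed_system w ord0 a b'' -> b' = b''.
  by move=> [h1 h2 h3] [h4 h5 h6]; apply: (ffixed_uniq hw h4 h1 h5 h2 h6 h3).
have lim h Q : floating Q -> near a Q -> exists2 b', ffixed_system w ord0 a b' &
    forall i, cvgA (fun k => iter k (fStep h w a) Q i) (b' i).
  move=> hQ haQ; have [b' hb' hl] := fStep_limit h hw hQ haQ; exists b'.
    exact: ffixed_system_index hb'.
  by move=> i; apply: fil_cvgA => N; exists N => k Nk; apply: hl; rewrite leqW.
split=> [[[Q [/fl_cliffordP hQ haQ]] h]|hb].
  have [b' hb' hl] := lim ord0 Q hQ haQ.
  suff -> : b = b' by [].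
  apply/funext => i; apply: (cvgA_unique (h ord0 Q _ haQ i) (hl i)).
  exact/fl_cliffordP.
split; first by have [h1 h2 _] := hb; exists b; split=> //; apply/fl_cliffordP.
move=> h Q /fl_cliffordP hQ haQ; have [b' hb' hl] := lim h Q hQ haQ.
by rewrite (uniq _ _ hb hb').
Qed.

Lemma fO_proc_exists a : fdom a -> exists b, fO_proc w a b.
Proof.
move=> [Q [/fl_cliffordP hQ haQ]]; have [b hb _] := fStep_limit ord0 hw hQ haQ.
by exists b; apply/fO_procP.
Qed.
End FloatingProcedure.

(** * Algebraic conditions *)
Section MoreConnection.
Variables (R : realType) (V : lmodType R) (n : nat) (c : involutions V n).
Variable w : bvec n -> 'I_n -> R.

Lemma connectionZ (t : R) E : connection c w (fun j => t *: E j) = t *: connection c w E.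
Proof.
rewrite (@connectionE _ _ _ _ _ _ E (fun=> 0) t) ?connection0 ?addr0 // => j.
by rewrite addr0.
Qed.

Lemma connectionD E E' :
  connection c w (fun j => E j + E' j) = connection c w E + connection c w E'.
Proof. by rewrite (@connectionE _ _ _ _ _ _ E E' 1) ?scale1r // => j; rewrite scale1r. Qed.

(** A vector fixed by all involutions lives in the component at 0, where all weights vanish. *)
Lemma connection_const z : connection_data w -> (forall i, c i z = z) ->
  connection c w (fun=> z) = 0.
Proof.
move=> [h0 _] hz; rewrite /connection big1 ?scaler0 // => j _; rewrite big1 // => s _.
rewrite (@full_eigen _ _ _ c s [ffun=> false] z) => [|i]; last by rewrite hz ffunE scale1r.
by case: eqP => [->|]; rewrite ?scaler0 // h0 ?ffunE // scale0r.
Qed.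
End MoreConnection.

Section PowerSeriesConstants.
Variables (R : realType) (A : algType R) (m : nat).

Lemma psC_mull (x : A) (f : pser m A) a : (psC m x * f : pser m A) a = x * f a.
Proof.
rewrite [LHS](@mbelow_only _ _ _ (m0 m)) /=.
- by rewrite eqxx; congr (_ * f _); apply/ffunP => i; rewrite !ffunE subn0.
- by apply/mleP => i; rewrite ffunE.
- by move=> b _ /negbTE ->; rewrite mul0r.
Qed.

Lemma psC_mulr (x : A) (f : pser m A) a : (f * psC m x : pser m A) a = f a * x.
Proof.
rewrite [LHS](@mbelow_only _ _ _ a) /=.
- suff -> : msub a a = m0 m by rewrite eqxx.
  by apply/ffunP => i; rewrite !ffunE subnn.
- exact/mleP.
- move=> b /mleP bc bNc; case: eqP => [/ffunP H|_]; last by rewrite mulr0.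
  case/eqP: bNc; apply/ffunP => i; apply/eqP; rewrite eqn_leq bc /=.
  by have := H i; rewrite !ffunE => /eqP.
Qed.

Lemma psC_mul (x y : A) : psC m (x * y) = psC m x * psC m y :> pser m A.
Proof. by apply: pserP => a; rewrite psC_mull /=; case: eqP; rewrite ?mulr0. Qed.

Lemma psC_linear : linear (@psC m R A : A -> pser m A).
Proof. by move=> c x y; apply: pserP => a /=; case: eqP; rewrite ?scaler0 ?addr0. Qed.

Lemma psC_lin (c : R) (x y : A) : psC m (c *: x + y) = c *: psC m x + psC m y :> pser m A.
Proof. exact: psC_linear. Qed.

Lemma psC_add (x y : A) : psC m (x + y) = psC m x + psC m y :> pser m A.
Proof. by rewrite -[x]scale1r psC_lin !scale1r. Qed.

Lemma psC_zero : psC m 0 = 0 :> pser m A.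
Proof. by apply: pserP => a /=; case: eqP. Qed.

Lemma psC_scale (c : R) (x : A) : psC m (c *: x) = c *: psC m x :> pser m A.
Proof. by rewrite -[c *: x]addr0 psC_lin psC_zero addr0. Qed.

Lemma psC_opp (x : A) : psC m (- x) = - psC m x :> pser m A.
Proof. by apply: pserP => a /=; case: eqP; rewrite ?oppr0. Qed.

Lemma psX_psC i (x : A) : psX A i * psC m x = psC m x * psX A i.
Proof.
by apply: pserP => a; rewrite psC_mull psC_mulr /=; case: eqP; rewrite ?mul1r ?mulr1 ?mul0r ?mulr0.
Qed.
End PowerSeriesConstants.

Lemma ps_filP (R : realType) (A : convAlg R) m i (f : pser m A) :
  fil (pser_convAlg m A) i f <-> forall a, fil A (i - mdeg a) (f a).
Proof. by []. Qed.

Section PiTransport.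
Variables (R : realType) (A B : convAlg R) (n : nat) (w : weights R n).
Variables (Q X : 'I_n -> A) (Q' X' : 'I_n -> B).

Lemma Pi_transport (f : A -> B) : clifford Q -> clifford Q' -> linear f ->
  (forall i x, f (inv (Q i) * x * Q i) = inv (Q' i) * f x * Q' i) ->
  (forall i, f (X i * inv (Q i)) = X' i * inv (Q' i)) ->
  f (Pi w Q X) = Pi w Q' X'.
Proof.
move=> hQ hQ' hf h1 h2; rewrite (Pi_connection hQ) (Pi_connection hQ').
rewrite (connection_transport (c' := clifford_conj hQ')) //.
by congr connection; apply/funext => j; apply: h2.
Qed.

Lemma fPi_transport h (f g : A -> B) : connection_data w ->
  floating Q -> floating Q' -> linear f -> linear g ->
  (forall i x, f (Q i * x * inv (Q i)) = Q' i * g x * inv (Q' i)) ->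
  (forall i x, g (inv (Q i) * x * Q i) = inv (Q' i) * f x * Q' i) ->
  (forall i, f (X i * inv (Q i)) = X' i * inv (Q' i)) ->
  (forall i, g (inv (Q i) * X i) = inv (Q' i) * X' i) ->
  fPi h w Q' X' = (f (fPi h w Q X).1, g (fPi h w Q X).2).
Proof.
move=> hw hQ hQ' hf hg h1 h2 h3 h4.
rewrite (fPi_connection hQ hw) (fPi_connection hQ' hw).
pose F (z : sum_convAlg A A) : sum_convAlg B B := (f z.1, g z.2).
have f0N z : f (- z) = - f z.
  by have := hf (-1) z 0; rewrite scaleN1r addr0 scaleN1r => ->; have := hf (-1) 0 0;
    rewrite scaler0 addr0 scaleN1r addNr => ->; rewrite addr0.
have g0N z : g (- z) = - g z.
  by have := hg (-1) z 0; rewrite scaleN1r addr0 scaleN1r => ->; have := hg (-1) 0 0;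
    rewrite scaler0 addr0 scaleN1r addNr => ->; rewrite addr0.
rewrite -[RHS]/(F (connection (floating_swap hQ) w (biquo Q X))).
rewrite (connection_transport (c' := floating_swap hQ')).
- by congr connection; apply/funext => j; congr pair; rewrite ?h3 ?h4.
- by move=> t x y; congr pair; [apply: hf|apply: hg].
- by move=> i x; congr pair => /=; rewrite ?f0N ?g0N ?h1 ?h2.
Qed.
End PiTransport.

Section Morphism.
Variables (R : realType) (A B : convAlg R) (phi : {lrmorphism A -> B}).

Lemma invertible_morph x : invertible x -> invertible (phi x).
Proof. by move=> [y [h1 h2]]; exists (phi y); rewrite -!rmorphM h1 h2 rmorph1. Qed.

Lemma inv_morph x : invertible x -> inv (phi x) = phi (inv x).
Proof.
move=> hx; apply: inv_eq; rewrite -rmorphM ?invertible_mulV ?invertible_mulVl ?rmorph1 //.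
Qed.
End Morphism.

Section PlainProperties.
Variables (R : realType) (n : nat) (w : weights R n).
Hypothesis hw : connection_data w.

Lemma O_vR : vR (O_proc w).
Proof.
move=> A a b b' /(O_procP hw)[h1 h2 h3] /(O_procP hw)[h4 h5 h6].
exact: (fixed_uniq hw h4 h1 h5 h2 h6 h3).
Qed.

Lemma O_Frm : Frm (O_proc w).
Proof.
move=> A a; split=> [[b [ha _]] //|]; exact: O_proc_exists.
Qed.

Lemma O_CP : CP (O_proc w).
Proof. by move=> A a b /(O_procP hw)[]. Qed.

Lemma O_vC : vC (O_proc w).
Proof.
move=> A Q hQ; apply/O_procP => //; split=> //.
  by move=> i; rewrite subrr; apply: fil_zero.
rewrite (Pi_connection hQ) -[RHS](connection0 (clifford_conj hQ) w).
by congr connection; apply/funext => j; rewrite subrr mul0r.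
Qed.

Lemma O_Nat : Nat (O_proc w).
Proof.
split=> [A B phi a b hphi /(O_procP hw)[h1 h2 h3]|A B a a'].
  have hb : clifford (fun i => phi (b i)).
    move=> i j; transitivity (phi (b i * b j + b j * b i)).
      by rewrite rmorphD !rmorphM.
    by rewrite h1 linearZ_LR rmorph1.
  apply/O_procP => //; split=> //.
    by move=> i; rewrite -rmorphB; apply/hphi.
  transitivity (phi (Pi w b (fun i => a i - b i))); last by rewrite h3 raddf0.
  apply/esym/(Pi_transport w (f := phi)) => //.
  - exact: linearP.
  - by move=> i x; rewrite !rmorphM inv_morph //; apply: clifford_invertible.
  - by move=> i; rewrite rmorphM rmorphB inv_morph //; apply: clifford_invertible.
move=> /O_Frm[Q [hQ haQ]] /O_Frm[Q' [hQ' haQ']]; apply: O_proc_exists => //.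
exists (fun i => (Q i, Q' i)); split=> [i j|i]; last by split; [apply: haQ|apply: haQ'].
by congr pair; [apply: hQ|apply: hQ'].
Qed.

(** The signs cancel in the conjugations and in the quotients, so [Pi] does not change and the
    identity serves as transport map. *)
Lemma O_vL : vL (O_proc w).
Proof.
move=> A a b s /(O_procP hw)[h1 h2 h3].
set b' := fun i => (-1) ^+ s i * b i; have bb' i : b' i = b i \/ b' i = - b i.
  by rewrite /b'; case: (s i); rewrite ?expr0 ?expr1 ?mul1r ?mulN1r; [right|left].
have signM i x y : (-1) ^+ s i * x * ((-1) ^+ s i * y) = x * y :> A.
  by case: (s i); rewrite ?expr0 ?expr1 ?mul1r ?mulN1r // mulrNN.
have hb : clifford b'.
  apply: cliffordP => [i|i j ij]; first by rewrite /b' signM clifford_sqr.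
  have := clifford_anti h1 ij.
  by case: (bb' i) (bb' j) => -> [] ->; rewrite ?(mulrN, mulNr) => ->.
have ib i : inv (b' i) = (-1) ^+ s i * inv (b i).
  by rewrite clifford_inv // clifford_inv // mulrN.
apply/O_procP => //; split=> // [i|].
  by rewrite -mulrBr; apply/fil_mull/h2.
rewrite -h3; apply/esym/(Pi_transport w (f := id)) => // [i x|i].
  by rewrite ib /b'; case: (s i); rewrite ?expr0 ?expr1 ?mul1r ?mulN1r // !mulNr mulrN opprK.
by rewrite ib -mulrBr signM.
Qed.

Lemma O_FSt : FSt (O_proc w).
Proof.
move=> A a b t /(O_procP hw)[h1 h2 h3]; apply/O_procP => //.
have e i : t *: a i + (1 - t) *: b i - b i = t *: (a i - b i).
  by rewrite scalerBl scale1r scalerBr; zmod.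
split=> // [i|]; first by rewrite e; apply/fil_scale/h2.
transitivity (t *: Pi w b (fun i => a i - b i)); last by rewrite h3 scaler0.
rewrite !(Pi_connection h1) -connectionZ; congr connection; apply/funext => j.
by rewrite e scalerAl.
Qed.

Lemma O_H0 : H0 (O_proc w).
Proof.
move=> A a b /(O_procP hw)[h1 h2 h3]; pose t : pser_convAlg 1 A := psX A ord0; pose p x : pser_convAlg 1 A := psC 1 x.
have pM x y : p (x * y) = p x * p y by apply: psC_mul.
have hb : clifford (fun i => p (b i)).
  move=> i j; rewrite -!pM -[RHS]psC_scale -h1; exact/esym/psC_add.
have tC x : t * p x = p x * t by apply: psX_psC.
have psCB x y : p (x - y) = p x - p y.
  by rewrite /p psC_add psC_opp.
have ib i : inv (p (b i)) = p (inv (b i)).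
  by rewrite (clifford_inv i hb) (clifford_inv i h1) /p psC_opp.
apply: (proj2 (O_procP hw (fun i => (1 + t) * p (a i)) (fun i => p (b i)))).
split=> // [i|].
  rewrite (_ : _ - _ = p (a i - b i) + t * p (a i)); last first.
    by rewrite psCB; nring.
  apply: fil_add; apply/ps_filP => d.
    rewrite /=; case: eqP => [->|_]; last exact: fil_zero.
    by apply: fil_leq (h2 i); rewrite leq_subr.
  rewrite tC psC_mull /p /=; case: eqP => [->|_]; last by rewrite mulr0; apply: fil_zero.
  by rewrite /mdeg big_ord1 ffunE eqxx subnn; apply: fil_full.
rewrite (Pi_connection hb).
(* Multiplying [a j] by 1 + t multiplies the quotient by 1 + t and adds t, a constant fixed by all
   conjugations, which the connection kills. *)
transitivity (connection (clifford_conj hb) w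
   (fun j => (1 + t) * p ((a j - b j) * inv (b j)) + t)).
  congr connection; apply/funext => j; rewrite pM psCB ib.
  have e : p (b j) * p (inv (b j)) = 1.
    by rewrite -pM invertible_mulV //; apply: clifford_invertible.
  rewrite !(mulrBl, mulrBr, mulrDl, mulrDr, mulNr, mulrN, mul1r, mulrA).
  by rewrite -(mulrA t (p (b j))) e mulr1; zmod.
rewrite connectionD connection_const ?addr0 // => [|i]; last first.
  by rewrite /= ib -tC -mulrA -pM invertible_mulVl ?mulr1 //; apply: clifford_invertible.
transitivity ((1 + t) * p (Pi w b (fun i => a i - b i))); last first.
  by rewrite h3 [p 0]psC_zero mulr0.
rewrite (Pi_connection h1).
pose f (x : A) : pser_convAlg 1 A := (1 + t) * p x.
apply/esym; apply: (connection_transport (f := f)) => [c x y|i x].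
  by rewrite /f /p psC_lin mulrDr scalerAr.
rewrite /f /= ib !pM !mulrA; congr (_ * _ * _).
by rewrite mulrDl mulrDr mul1r mulr1 tC.
Qed.

Lemma commutator_Sy (A : convAlg R) (Q X : 'I_n -> A) : clifford Q -> w = @Syw R n ->
  Pi w Q X = 0 <-> \sum_j (Q j * X j - X j * Q j) = 0.
Proof.
move=> hQ hS; rewrite (Pi_connection hQ) connection_Sy_eq0 //.
suff -> : \sum_j (X j * inv (Q j) - clifford_conj hQ j (X j * inv (Q j))) =
  \sum_j (Q j * X j - X j * Q j) by [].
apply: eq_bigr => j _; rewrite /= -!mulrA invertible_mulVl; last exact: clifford_invertible.
by rewrite mulr1 clifford_inv // mulrN mulNr opprK addrC.
Qed.

Lemma mxact_clifford (A : convAlg R) (U : 'M[R]_n) (Q : 'I_n -> A) :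
  U *m U^T = 1%:M -> clifford Q -> clifford (mxact U Q).
Proof.
move=> hU hQ i j; rewrite /mxact.
have e k l : (\sum_j0 U k j0 *: Q j0) * (\sum_j0 U l j0 *: Q j0) =
   \sum_p \sum_q (U k p * U l q) *: (Q p * Q q).
  rewrite mulr_suml; apply: eq_bigr => p _; rewrite mulr_sumr; apply: eq_bigr => q _.
  by rewrite -scalerAl -scalerAr scalerA.
rewrite !e [X in _ + X]exchange_big /= -big_split /=.
transitivity (\sum_p (- 2%:R * (U i p * U j p) : R) *: (1 : A)).
  apply: eq_bigr => p _; rewrite -big_split /= (bigD1 p) //= big1 => [|q pq].
    by rewrite addr0 [U j p * _]mulrC -scalerDr hQ eqxx mulr1 scalerA mulrC.
  by rewrite [U j q * _]mulrC -scalerDr hQ eq_sym (negbTE pq) mulr0 scale0r scaler0.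
rewrite -scaler_suml -mulr_sumr; congr (_ * _ *: _).
have := congr1 (fun M : 'M[R]_n => M i j) hU; rewrite !mxE => <-.
by apply: eq_bigr => p _; rewrite mxE.
Qed.

Lemma mxact_near (A : convAlg R) (U : 'M[R]_n) (a b : 'I_n -> A) :
  near a b -> near (mxact U a) (mxact U b).
Proof.
move=> h i; rewrite /mxact -sumrB; apply: fil_sum => j; rewrite -scalerBr.
exact/fil_scale/h.
Qed.

Lemma mxact_sum (A : convAlg R) (U : 'M[R]_n) (a b : 'I_n -> A) : U *m U^T = 1%:M ->
  \sum_i mxact U a i * mxact U b i = \sum_i a i * b i.
Proof.
move=> /mulmx1C hU; rewrite /mxact.
transitivity (\sum_i \sum_p \sum_q (U i p * U i q) *: (a p * b q)).
  apply: eq_bigr => i _.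
  rewrite mulr_suml; apply: eq_bigr => p _; rewrite mulr_sumr; apply: eq_bigr => q _.
  by rewrite -scalerAl -scalerAr scalerA.
rewrite exchange_big; apply: eq_bigr => p _; rewrite exchange_big /=.
rewrite (eq_bigr (fun q => (p == q)%:R *: (a p * b q))) => [|q _]; last first.
  rewrite -scaler_suml; congr (_ *: _).
  have := congr1 (fun M : 'M[R]_n => M p q) hU; rewrite !mxE => <-.
  by apply: eq_bigr => i _; rewrite mxE.
rewrite (bigD1 p) //= eqxx scale1r big1 ?addr0 // => q qp.
by rewrite eq_sym (negbTE qp) scale0r.
Qed.

Lemma mxact_sub (A : convAlg R) (U : 'M[R]_n) (a b : 'I_n -> A) i :
  mxact U a i - mxact U b i = mxact U (fun j => a j - b j) i.
Proof. by rewrite /mxact -sumrB; apply: eq_bigr => j _; rewrite scalerBr. Qed.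

Lemma O_Orth : w = @Syw R n -> Orth (O_proc w).
Proof.
move=> hS A a b U hU /(O_procP hw)[h1 h2 h3].
have h1' := mxact_clifford hU h1.
apply/O_procP => //; split=> //; first exact: mxact_near.
have -> : (fun i => mxact U a i - mxact U b i) = mxact U (fun j => a j - b j).
  by apply/funext => i; rewrite mxact_sub.
apply/commutator_Sy => //; move/commutator_Sy: h3 => /(_ h1 hS).
by rewrite !sumrB !mxact_sum.
Qed.

Lemma perm_mx_orthogonal (U : 'M[R]_n) : is_perm_mx U -> U *m U^T = 1%:M.
Proof.
move=> /is_perm_mxP[s ->]; apply/matrixP => i j.
by rewrite -row_permE !mxE (inj_eq (@perm.perm_inj _ s)) eq_sym.
Qed.

Lemma O_Sigma : w = @Syw R n -> Sigma (O_proc w).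
Proof. by move=> hS A a b U /perm_mx_orthogonal; apply: O_Orth. Qed.
End PlainProperties.

Section FloatingProperties.
Variables (R : realType) (n : nat) (w : weights R n.+1).
Hypothesis hw : connection_data w.

Lemma fO_vR : vR (fO_proc w).
Proof.
move=> A a b b' /(fO_procP hw)[h1 h2 h3] /(fO_procP hw)[h4 h5 h6].
exact: (ffixed_uniq hw h4 h1 h5 h2 h6 h3).
Qed.

Lemma fO_Frm : fFrm (fO_proc w).
Proof.
move=> A a; split=> [[b [ha _]] //|]; exact: fO_proc_exists.
Qed.

Lemma fO_CP : fCP (fO_proc w).
Proof. by move=> A a b /(fO_procP hw)[h _ _]; apply/fl_cliffordP. Qed.

Lemma fO_vC : fvC (fO_proc w).
Proof.
move=> A Q /fl_cliffordP hQ; apply/fO_procP => //; split=> //.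
  by move=> i; rewrite subrr; apply: fil_zero.
rewrite (fPi_connection hQ hw) -[RHS](connection0 (floating_swap hQ) w).
by congr connection; apply/funext => j; congr pair; rewrite subrr ?mul0r ?mulr0.
Qed.

Lemma fO_Nat : Nat (fO_proc w).
Proof.
split=> [A B phi a b hphi /(fO_procP hw)[h1 h2 h3]|A B a a'].
  have ib i : invertible (b i) by case: h1.
  have hb : floating (fun i => phi (b i)).
    split=> [i|i j ij]; first exact: invertible_morph.
    by rewrite !inv_morph // -!rmorphM -rmorphN; congr (phi _); apply: floating_anti.
  apply/fO_procP => //; split=> //.
    by move=> i; rewrite -rmorphB; apply/hphi.
  have Plin : linear (phi : A -> B) by exact: linearP.
  rewrite (@fPi_transport _ _ _ _ w b (fun i => a i - b i) _ _ _ phi phi) //.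
  - by rewrite h3 /= raddf0.
  - by move=> i x; rewrite !rmorphM inv_morph.
  - by move=> i x; rewrite !rmorphM inv_morph.
  - by move=> i; rewrite rmorphM rmorphB inv_morph.
  - by move=> i; rewrite rmorphM rmorphB inv_morph.
move=> /fO_Frm[Q [/fl_cliffordP hQ haQ]] /fO_Frm[Q' [/fl_cliffordP hQ' haQ']].
apply: fO_proc_exists => //.
have [||| H _] := @floatingP _ (sum_convAlg A B) _ (fun i => (Q i, Q' i))
    (fun i => (inv (Q i), inv (Q' i))).
- by move=> i; congr pair; rewrite floating_mulV.
- by move=> i; congr pair; rewrite floating_mulVl.
- by move=> i j ij; congr pair; rewrite floating_anti.
exists (fun i => (Q i, Q' i)); split; first by apply/fl_cliffordP.
by move=> i; split; [apply: haQ|apply: haQ'].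
Qed.

(** The two halves are transported by different maps: right quotients are conjugated by [x], left
    quotients by [inv y], and the swaps exchange the two. *)
Lemma fO_Biv : Biv (fO_proc w).
Proof.
move=> A a b x y hx hy /(fO_procP hw)[h1 h2 h3].
have [hb ib] := floating_fAd hx hy h1.
apply/fO_procP => //; split=> //.
  by move=> i; rewrite -mulrBl -mulrBr; apply/fil_mulr/fil_mull/h2.
rewrite (@fPi_transport _ _ _ _ w b (fun i => a i - b i) (fAd (x, y) b) _ _
  (fun z => x * z * inv x) (fun z => inv y * z * y)) //.
- by rewrite h3 /= !mulr0 !mul0r.
- by move=> c z z'; rewrite mulrDr mulrDl -scalerAr -scalerAl.
- by move=> c z z'; rewrite mulrDr mulrDl -scalerAr -scalerAl.
- move=> i z; rewrite ib /fAd /= !mulrA -(mulrA _ y) invertible_mulV // mulr1.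
  by rewrite -(mulrA _ y) invertible_mulV // mulr1.
- move=> i z; rewrite ib /fAd /= !mulrA -(mulrA _ _ x) invertible_mulVl // mulr1.
  by rewrite -(mulrA _ _ x) invertible_mulVl // mulr1.
- move=> i; rewrite ib /= -mulrBl -mulrBr !mulrA.
  by rewrite -(mulrA _ y) invertible_mulV // mulr1.
- move=> i; rewrite ib /= -mulrBl -mulrBr !mulrA.
  by rewrite -(mulrA _ _ x) invertible_mulVl // mulr1.
Qed.

Lemma fO_vL : vL (fO_proc w).
Proof.
move=> A a b s /(fO_procP hw)[h1 h2 h3].
have ib i : invertible (b i) by case: h1.
have signM i (x y : A) : (-1) ^+ s i * x * ((-1) ^+ s i * y) = x * y.
  by case: (s i); rewrite ?expr0 ?expr1 ?mul1r ?mulN1r // mulrNN.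
have [|||hb vb] := @floatingP _ A _ (fun i => (-1) ^+ s i * b i)
    (fun i => (-1) ^+ s i * inv (b i)).
- by move=> i; rewrite signM floating_mulV.
- by move=> i; rewrite signM floating_mulVl.
- move=> i j ij; have := floating_anti h1 ij.
  by case: (s i) (s j) => [] []; rewrite ?expr0 ?expr1 ?mul1r ?mulN1r ?(mulrN, mulNr) => ->.
apply/fO_procP => //; split=> // [i|]; first by rewrite -mulrBr; apply/fil_mull/h2.
rewrite (@fPi_transport _ _ _ _ w b (fun i => a i - b i) _ _ _ id id) //.
- move=> i x; rewrite vb; case: (s i); rewrite ?expr0 ?expr1 ?mul1r ?mulN1r //.
  by rewrite !mulNr mulrN opprK.
- move=> i x; rewrite vb; case: (s i); rewrite ?expr0 ?expr1 ?mul1r ?mulN1r //.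
  by rewrite !mulNr mulrN opprK.
- by move=> i; rewrite vb -mulrBr signM.
- by move=> i; rewrite vb -mulrBr signM.
Qed.

Lemma fO_FSt : FSt (fO_proc w).
Proof.
move=> A a b t /(fO_procP hw)[h1 h2 h3]; apply/fO_procP => //.
have e i : t *: a i + (1 - t) *: b i - b i = t *: (a i - b i).
  by rewrite scalerBl scale1r scalerBr; zmod.
split=> // [i|]; first by rewrite e; apply/fil_scale/h2.
transitivity (t *: (fPi ord0 w b (fun i => a i - b i) : sum_convAlg A A)); last first.
  by rewrite h3 scaler0.
rewrite !(fPi_connection h1) // -connectionZ; congr connection; apply/funext => j.
by rewrite /biquo e; congr pair; rewrite -?scalerAl -?scalerAr.
Qed.

(** Each [biquo] is a (-1)-eigenvector of its own swap, so the sum in the criterion for [Sy] is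
    twice the sum of the [biquo]. *)
Lemma fPi_Sy (A : convAlg R) (Q X : 'I_n.+1 -> A) : floating Q -> w = @Syw R n.+1 ->
  fPi ord0 w Q X = 0 <->
  \sum_j X j * inv (Q j) = 0 /\ \sum_j inv (Q j) * X j = 0.
Proof.
move=> hQ hS; rewrite (fPi_connection hQ hw) (connection_Sy_eq0 _ hw) //.
have -> : \sum_j (biquo Q X j - floating_swap hQ j (biquo Q X j)) =
   (2%:R : R) *: (\sum_j X j * inv (Q j), \sum_j inv (Q j) * X j) :> sum_convAlg A A.
  have -> : (\sum_j X j * inv (Q j), \sum_j inv (Q j) * X j) =
      \sum_j biquo Q X j :> sum_convAlg A A.
    by apply/esym; elim/big_rec3: _ => // i y1 y2 z _ ->.
  rewrite scaler_sumr; apply: eq_bigr => j _.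
  by rewrite swap_biquo opprK scaler_nat mulr2n.
have n2 : (2%:R : R) != 0 by rewrite pnatr_eq0.
split=> [/eqP|[-> ->]]; last by apply: (scaler0 (sum_convAlg A A)).
by rewrite scaler_eq0 (negbTE n2) /= => /eqP[].
Qed.

(** In the symmetrized products the off-diagonal terms cancel by antisymmetry and the diagonal ones
    give [U *m U^T]. This yields both that the transformed inverses are inverses and that the new
    quotients are antisymmetric. *)
Lemma mxact_floating (A : convAlg R) (U : 'M[R]_n.+1) (Q : 'I_n.+1 -> A) :
  U *m U^T = 1%:M -> floating Q ->
  floating (mxact U Q) /\ forall i, inv (mxact U Q i) = mxact U (fun i => inv (Q i)) i.
Proof.
move=> hU hQ; set v := fun i => inv (Q i).
have pairing (x y : 'I_n.+1 -> A) :
    (forall i, x i * y i = 1) -> (forall i j, i != j -> x i * y j = - (x j * y i)) ->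
    forall i j, mxact U x i * mxact U y j + mxact U x j * mxact U y i =
      (2%:R * (i == j)%:R : R) *: (1 : A).
  move=> xy1 xyN i j.
  have e k l : mxact U x k * mxact U y l =
     \sum_p \sum_q (U k p * U l q) *: (x p * y q).
    rewrite /mxact mulr_suml; apply: eq_bigr => p _; rewrite mulr_sumr.
    by apply: eq_bigr => q _; rewrite -scalerAl -scalerAr scalerA.
  rewrite !e [X in _ + X]exchange_big /= -big_split /=.
  transitivity (\sum_p (2%:R * (U i p * U j p) : R) *: (1 : A)).
    apply: eq_bigr => p _; rewrite -big_split /= (bigD1 p) //= big1 => [|q pq].
      by rewrite addr0 [U j p * _]mulrC xy1 -scalerDl mulr_natl (mulr2n (U i p * _)).
    by rewrite [U j q * _]mulrC -scalerDr (xyN q) // addrN scaler0.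
  rewrite -scaler_suml -mulr_sumr; congr (_ * _ *: _).
  have := congr1 (fun M : 'M[R]_n.+1 => M i j) hU; rewrite !mxE => <-.
  by apply: eq_bigr => p _; rewrite mxE.
have half (x y : 'I_n.+1 -> A) : (forall i j, mxact U x i * mxact U y j +
    mxact U x j * mxact U y i = (2%:R * (i == j)%:R : R) *: (1 : A)) ->
    forall i, mxact U x i * mxact U y i = 1.
  move=> H i; have n2 : (2%:R : R) != 0 by rewrite pnatr_eq0.
  by apply: (scalerI n2); rewrite scaler_nat mulr2n H eqxx mulr1.
have h1 := pairing Q v (fun i => floating_mulV i hQ) (fun i j => floating_anti hQ).
have h2 := pairing v Q (fun i => floating_mulVl i hQ) (fun i j => floating_antil hQ).
apply: floatingP; [exact: half|exact: half|move=> i j /negbTE ij].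
by apply/eqP; rewrite -addr_eq0 h1 ij mulr0 scale0r.
Qed.

Lemma fO_Orth : w = @Syw R n.+1 -> Orth (fO_proc w).
Proof.
move=> hS A a b U hU /(fO_procP hw)[h1 h2 h3].
have [h1' ib] := mxact_floating hU h1.
apply/fO_procP => //; split=> //; first exact: mxact_near.
have -> : (fun i => mxact U a i - mxact U b i) = mxact U (fun j => a j - b j).
  by apply/funext => i; rewrite mxact_sub.
apply/fPi_Sy => //; move/fPi_Sy: h3 => /(_ h1 hS)[e1 e2].
split.
  rewrite -[RHS]e1 -[RHS](mxact_sum (fun j => a j - b j) (fun j => inv (b j)) hU).
  by apply: eq_bigr => j _; rewrite ib.
rewrite -[RHS]e2 -[RHS](mxact_sum (fun j => inv (b j)) (fun j => a j - b j) hU).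
by apply: eq_bigr => j _; rewrite ib.
Qed.

Lemma fO_Sigma : w = @Syw R n.+1 -> Sigma (fO_proc w).
Proof. by move=> hS A a b U /perm_mx_orthogonal; apply: fO_Orth. Qed.
End FloatingProperties.

(** * Means of the even powers of the sine *)

Section Wallis.
Variable R : realType.
Local Notation mu := (@lebesgue_measure R).
Local Notation I := (`[(0 : R), 2%:R * pi]%classic).

Definition sin_sqr_pow (k : nat) (t : R) : R := (sin t ^+ 2) ^+ k.

Lemma sin_sqr_powE k t : sin_sqr_pow k t = (sin ^+ (2 * k)%N) t.
Proof. by rewrite /sin_sqr_pow -exprM exprfctE. Qed.

Lemma sin_sqr_pow_continuous k : continuous (sin_sqr_pow k).
Proof.
rewrite (_ : sin_sqr_pow k = sin ^+ (2 * k)%N); last by apply/funext => t; rewrite sin_sqr_powE.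
move=> t; apply/differentiable_continuous/derivable1_diffP.
by apply: ex_derive; apply: is_deriveX.
Qed.

Lemma sin_sqr_pow_integrable k : mu.-integrable I (EFin \o sin_sqr_pow k).
Proof.
apply: continuous_compact_integrable; first exact: segment_compact.
exact/continuous_subspaceT/sin_sqr_pow_continuous.
Qed.

(** The value is binomial(2k,k)/4^k, the coefficient of s^k in (1-s)^(-1/2); only the recurrence and
    the convolution identity below are used. *)
Definition wallis (k : nat) : R :=
  (2%:R * pi)^-1 * \int[mu]_(t in I) sin_sqr_pow k t.

Lemma twopi_gt0 : 0 < 2%:R * pi :> R.
Proof. by rewrite mulr_gt0 ?pi_gt0. Qed.

Lemma wallis0 : wallis 0 = 1.
Proof.
rewrite /wallis (eq_Rintegral _ (g := cst 1)) => [|t _]; last by rewrite /sin_sqr_pow expr0.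
rewrite Rintegral_cst //= mul1r lebesgue_measure_itv /= lte_fin twopi_gt0 sube0 /=.
by rewrite mulVf // gt_eqF // twopi_gt0.
Qed.

(** The two integrands differ by the derivative of sin^(2k+1) cos, which vanishes at 0 and at 2
    pi. *)
Lemma wallisS k : (k.+1).*2%:R * wallis k.+1 = k.*2.+1%:R * wallis k.
Proof.
suff H : \int[mu]_(t in I) (k.*2.+1%:R * sin_sqr_pow k t - (k.+1).*2%:R * sin_sqr_pow k.+1 t) = 0.
  apply/eqP; rewrite eq_sym -subr_eq0 /wallis !(mulrCA _ (_^-1)) -mulrBr.
  rewrite -!RintegralZl //; [|exact: sin_sqr_pow_integrable..].
  rewrite -RintegralB // ?H ?mulr0 //.
    exact: integrableZl (sin_sqr_pow_integrable k).
  exact: integrableZl (sin_sqr_pow_integrable k.+1).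
pose F : R -> R := sin ^+ k.*2.+1 * cos.
pose f t : R := k.*2.+1%:R * sin_sqr_pow k t - (k.+1).*2%:R * sin_sqr_pow k.+1 t.
have dF (t : R) : is_derive t (1 : R) F (f t).
  have H := is_deriveM (is_deriveX k.*2.+1 (is_derive_sin t)) (is_derive_cos t).
  apply: is_derive_eq H _; rewrite /f !sin_sqr_powE !exprfctE /= !mul2n.
  rewrite /GRing.scale /= doubleS -[k.*2.+2%:R]natr1 !exprS.
  have c2 : cos t * cos t = 1 - sin t * sin t.
    by rewrite -!expr2 -(cos2Dsin2 t) addrK.
  set m := k.*2.+1%:R; set S := sin t ^+ _.
  transitivity (m * S * (cos t * cos t) - S * (sin t * sin t)); first by ring.
  by rewrite c2; ring.
have F0 : F 0 = 0 by rewrite /F /= fctE exprfctE sin0 exprS !mul0r.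
have F1 : F (2%:R * pi) = 0.
  by rewrite /F /= fctE exprfctE mulr_natl sin2pi exprS !mul0r.
have cF : continuous F.
  move=> t; apply/differentiable_continuous/derivable1_diffP.
  by apply: ex_derive; apply: dF.
rewrite /Rintegral (@continuous_FTC2 _ f F) ?F0 ?F1 ?sube0 //.
- exact: twopi_gt0.
- apply/continuous_subspaceT => t; apply: cvgB; apply: cvgM; try exact: cvg_cst;
  exact: sin_sqr_pow_continuous.
- split=> [t _||]; first by apply: ex_derive; apply: dF.
  + by apply: cvg_at_right_filter; apply: cF.
  + by apply: cvg_at_left_filter; apply: cF.
- by move=> t _; rewrite derive1E; apply: derive_val.
Qed.

(** The square of (1-s)^(-1/2) is the geometric series. Writing c_k for the sum, the recurrence of
    [wallis] gives (k+1) c_(k+1) = k c_k + c_k. *)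
Lemma wallis_convolution k : \sum_(i < k.+1) wallis i * wallis (k - i) = 1.
Proof.
elim: k => [|k IHk]; first by rewrite big_ord1 subnn wallis0 mulr1.
have rev m (c : nat -> nat -> R) : \sum_(i < m.+1) c i (m - i)%N = \sum_(i < m.+1) c (m - i)%N i.
  rewrite (reindex_inj rev_ord_inj); apply: eq_bigr => i _ /=.
  by rewrite subSS subKn // -ltnS.
(* Symmetrizing under the exchange of i and m - i replaces the factor 2i by i + (m - i) = m. *)
have e m : \sum_(i < m.+1) i.*2%:R * wallis i * wallis (m - i) =
    m%:R * \sum_(i < m.+1) wallis i * wallis (m - i) :> R.
  set a := LHS; have -> : a = 2%:R^-1 * (a + a) by field.
  rewrite {2}/a (rev m (fun i j => i.*2%:R * wallis i * wallis j)) /a -big_split /=.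
  rewrite !mulr_sumr; apply: eq_bigr => i _.
  have im : (i <= m)%N by rewrite -ltnS.
  have -> : (m%:R : R) = i%:R + (m - i)%:R by rewrite -natrD subnKC.
  rewrite -!mul2n !natrM.
  have n2 : (2%:R : R) != 0 by rewrite pnatr_eq0.
  by field.
apply: (@mulfI _ k.+1%:R); first by rewrite pnatr_eq0.
rewrite -e big_ord_recl /= double0 !mul0r add0r.
transitivity (\sum_(i < k.+1) (i.*2.+1%:R * wallis i) * wallis (k - i)).
  by apply: eq_bigr => i _; rewrite /bump /= add1n wallisS subSS.
transitivity (\sum_(i < k.+1) i.*2%:R * wallis i * wallis (k - i) +
  \sum_(i < k.+1) wallis i * wallis (k - i)).
  by rewrite -big_split; apply: eq_bigr => i _ /=; rewrite -natr1; ring.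
by rewrite e IHk !mulr1 natr1.
Qed.
End Wallis.

(** * Truncated power series in one element *)

Section TruncatedProduct.
Variables (R : comNzRingType) (M : nzRingType) (sigma : {rmorphism R -> M}).
Variables (S : M) (cS : commr_rmorph sigma S) (I : M -> Prop) (N : nat).
Hypotheses (I0 : I 0) (ID : forall x y, I x -> I y -> I (x + y)).
Hypotheses (IM : forall x y, I y -> I (x * y)) (IS : I (S ^+ N)).
Implicit Types a b : nat -> R.

Lemma horner_poly_sum (n : nat) a :
  horner_morph cS (\poly_(k < n) a k) = \sum_(k < n) sigma (a k) * S ^+ k.
Proof.
rewrite poly_def rmorph_sum; apply: eq_bigr => k _.
by rewrite -mul_polyC rmorphM rmorphXn /= horner_morphC horner_morphX.
Qed.

Lemma horner_truncated (p : {poly R}) :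
  (forall k, (k < N)%N -> p`_k = 0) -> I (horner_morph cS p).
Proof.
move=> hp; rewrite -[p]coefK horner_poly_sum; apply: big_ind => // k _.
have [kN|Nk] := ltnP k N; first by rewrite hp // rmorph0 mul0r.
by rewrite -(subnK Nk) exprD mulrA; apply: IM.
Qed.

(** The sums are values at [S] of polynomials, whose product agrees with the truncated convolution
    in degrees below [N]; [I] absorbs the rest. It stays abstract to cover both a filtered algebra
    and matrices over power series. *)
Lemma truncated_product a b :
  I ((\sum_(k < N) sigma (a k) * S ^+ k) * (\sum_(k < N) sigma (b k) * S ^+ k) -
     \sum_(m < N) sigma (\sum_(i < m.+1) a i * b (m - i)%N) * S ^+ m).
Proof.
rewrite -!(horner_poly_sum N) -(horner_poly_sum N (fun m => \sum_(i < m.+1) a i * b (m - i)%N)).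
rewrite -rmorphM -rmorphB; apply: horner_truncated => k kN.
rewrite coefB coefM coef_poly kN; apply/eqP; rewrite subr_eq0; apply/eqP.
apply: eq_bigr => i _; rewrite !coef_poly.
by rewrite (leq_ltn_trans _ kN) ?(leq_ltn_trans (leq_subr _ _) kN) // -ltnS.
Qed.
End TruncatedProduct.

(** * The polarization integral *)

Section Polarization.
Variables (R : realType) (A : convAlg R).
Implicit Types (H P T S X : A).
Local Notation mu := (@lebesgue_measure R).
Local Notation I := (`[(0 : R), 2%:R * pi]%classic).

Lemma is_integral_unique (a b : R) (F : R -> A) x y :
  is_integral a b F x -> is_integral a b F y -> x = y.
Proof.
move=> hx hy; apply: quot_form_eq => i f hf.
by have [_ <-] := hx i f hf; have [_ <-] := hy i f hf.
Qed.

Lemma pol_at_unique H P P' : pol_at H P -> pol_at H P' -> P = P'.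
Proof. by move=> [_ h] [_ h']; apply: is_integral_unique h h'. Qed.

(** [X * X - 1] is [(X - 1) * (X + 1)], and [X + 1] is invertible, being twice a unipotent
    element. *)
Lemma fil_sqrt N X : fil A 1 (X - 1) -> fil A N (X * X - 1) -> fil A N (X - 1).
Proof.
move=> h1 hN; have hi : invertible ((2%:R^-1 : R) *: (X + 1)).
  apply: invertible_fil; rewrite (_ : _ - _ = (2%:R^-1 : R) *: (X - 1)).
    exact: fil_scale.
  by rewrite -{2}[1 : A](@scaler_half R) -scalerBr; congr (_ *: _); zmod.
have -> : X - 1 = (2%:R^-1 : R) *: (X * X - 1) * inv ((2%:R^-1 : R) *: (X + 1)).
  rewrite (_ : X * X - 1 = (X - 1) * (X + 1)); last by nring.
  by rewrite scalerAr -mulrA invertible_mulV // mulr1.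
by apply/fil_mulr/fil_scale.
Qed.

Definition wallis_sum S N : A := \sum_(k < N) wallis R k *: S ^+ k.

(** The partial sum approximates (1-S)^(-1/2): its square is the truncated geometric series up to
    level [N]. So the square of the product with [T] is close to 1, and [fil_sqrt] passes to the
    product itself. *)
Lemma wallis_sum_sqrt S T N : fil A 1 S -> fil A 1 (T - 1) -> T * T = 1 - S ->
  T * S = S * T -> fil A N (T * wallis_sum S N - 1).
Proof.
move=> hS hT TT TS; case: N => [|N]; first exact: fil_full.
set E := wallis_sum S N.+1; have cE : T * E = E * T.
  rewrite mulr_suml mulr_sumr; apply: eq_bigr => k _.
  by rewrite -scalerAr -scalerAl; congr (_ *: _); apply: commrX.
apply: fil_sqrt.
  rewrite (_ : _ - _ = (T - 1) * E + (E - 1)); last by nring.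
  apply: fil_add; first exact: fil_mulr.
  rewrite /E /wallis_sum big_ord_recl wallis0 expr0 scale1r addrAC subrr add0r.
  by apply: fil_sum => k; apply: fil_scale; rewrite exprS; apply: fil_mulr.
have cS : commr_rmorph (in_alg A : {rmorphism R -> A}) S.
  by move=> x; rewrite /GRing.comm /= -scalerAl -scalerAr mul1r mulr1.
have Ealg : E = \sum_(k < N.+1) in_alg A (wallis R k) * S ^+ k.
  by apply: eq_bigr => k _; rewrite /= mulr_algl.
have hE := @truncated_product _ _ (in_alg A) S cS (fil A N.+1) N.+1 (fil_zero A _)
   (@fil_add _ A _) (@fil_mull _ A _) (fil_exp _ hS) (wallis R) (wallis R).
rewrite -Ealg in hE.
rewrite (_ : _ - _ = (1 - S) * (E * E - \sum_(m < N.+1) S ^+ m) +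
  ((1 - S) * \sum_(m < N.+1) S ^+ m - 1)); last first.
  by rewrite mulrA -(mulrA T) -cE !mulrA TT -mulrA; nring.
apply: fil_add.
  apply: fil_mull; move: hE; rewrite [X in fil _ _ (_ - X)](_ : _ = \sum_(m < N.+1) S ^+ m) //.
  by apply: eq_bigr => m _; rewrite wallis_convolution /= scale1r mul1r.
rewrite -(opprB S 1) mulNr -subrX1 opprB addrAC subrr add0r.
by apply/fil_opp/fil_exp.
Qed.

(** With S = 1 - T^2 one has H^2 = S - 1, so the denominator is 1 - sin^2(t) S. Integrating its
    geometric series termwise yields H (1-S)^(-1/2) = P T T^(-1) = P. *)
Lemma pol_at_polar H P T : P * P = -1 -> P * T = T * P -> fil A 1 (T - 1) ->
  H = P * T -> pol_at H P.
Proof.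
move=> PP cPT hT HE; set S := 1 - T * T.
have hS : fil A 1 S.
  rewrite (_ : S = - ((T - 1) * T + (T - 1))); last by rewrite /S; nring.
  by apply/fil_opp/fil_add => //; apply: fil_mulr.
have HH : H * H = S - 1.
  rewrite HE mulrA -(mulrA P T P) -cPT mulrA PP /S; nring.
have DE (t : R) : (cos t ^+ 2)%:A - sin t ^+ 2 *: (H * H) = 1 - sin t ^+ 2 *: S.
  rewrite HH scalerBr opprB addrA -scalerDl cos2Dsin2 scale1r; zmod.
have hD (t : R) : fil A 1 ((1 - sin t ^+ 2 *: S) - 1).
  by rewrite addrAC subrr add0r; apply/fil_opp/fil_scale.
split=> [t _|i f hf]; first by rewrite DE; apply: invertible_fil.
pose c k : R := (2%:R * pi)^-1 * f (H * S ^+ k).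
(* A form that vanishes on level [i] sees only the first [i] terms of the geometric series, so the
   integrand is a finite sum. *)
have fE (t : R) : f ((2%:R * pi)^-1 *: (H * inv ((cos t ^+ 2)%:A - sin t ^+ 2 *: (H * H))))
   = \sum_(k < i) c k * sin_sqr_pow k t.
  rewrite DE linearZ /=; have := hf _ (fil_mull H (inv_geom (hD t) i)).
  rewrite mulrBr linearB => /eqP; rewrite subr_eq0 => /eqP ->.
  rewrite mulr_sumr linear_sum /GRing.scale /= mulr_sumr; apply: eq_bigr => k _.
  rewrite opprB addrC subrK exprZn -scalerAr linearZ /GRing.scale /= /c /sin_sqr_pow.
  by rewrite mulrA mulrAC.
have intk k : mu.-integrable I (fun t => (c k * sin_sqr_pow k t)%:E).
  have := integrableZl _ (c k) (sin_sqr_pow_integrable R k); apply.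
  exact: measurable_itv.
have ints n : mu.-integrable I (fun t => (\sum_(k < n) c k * sin_sqr_pow k t)%:E).
  rewrite (_ : (fun t => _) = (fun t => (\sum_(k < n) (c k * sin_sqr_pow k t)%:E)%E)).
    by apply: integrable_sum => //; exact: measurable_itv.
  by apply/funext => t; rewrite sumEFin.
split.
  rewrite (_ : (fun t => _) = (fun t => (\sum_(k < i) c k * sin_sqr_pow k t)%:E)).
    exact: ints.
  by apply/funext => t; congr (_%:E); apply: fE.
transitivity (\int[mu]_(t in I) (\sum_(k < i) c k * sin_sqr_pow k t)).
  by apply: eq_Rintegral => t _; apply: fE.
have -> : \int[mu]_(t in I) (\sum_(k < i) c k * sin_sqr_pow k t) =
    \sum_(k < i) wallis R k * f (H * S ^+ k).
  elim: (i) => [|n IHn].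
    by under eq_Rintegral => t _ do rewrite big_ord0; rewrite Rintegral_cst // mul0r big_ord0.
  under eq_Rintegral => t _ do rewrite big_ord_recr /=.
  rewrite RintegralD //; [|exact: ints|exact: intk]; rewrite IHn big_ord_recr /=; congr (_ + _).
  rewrite RintegralZl //; last exact: sin_sqr_pow_integrable.
  by rewrite /c /wallis mulrAC.
transitivity (f (H * wallis_sum S i)).
  rewrite mulr_sumr linear_sum; apply: eq_bigr => k _.
  by rewrite -scalerAr linearZ.
apply/eqP; rewrite -subr_eq0 -linearB; apply/eqP; apply: (hf).
rewrite HE -mulrA -{2}[P]mulr1 -mulrBr; apply: fil_mull.
apply: wallis_sum_sqrt => //; first by rewrite /S; nring.
by rewrite /S; nring.
Qed.
End Polarization.

(** * Gram-Schmidt *)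
Section GramSchmidt.
Variable R : realType.

Lemma GS_connection_data n : connection_data (@GSw R n).
Proof.
split=> [s j sj|s s0]; first by rewrite /GSw sj.
have [i0 si0] : exists i, s i.
  apply/existsP; apply: contraNT s0; rewrite negb_exists => /forallP h.
  by apply/eqP/ffunP => i; rewrite ffunE; apply/negbTE/h.
case: (arg_minnP (fun i : 'I_n => val i) si0) => j sj jmin.
rewrite (bigD1 j) //= big1 => [|i ij]; last first.
  rewrite /GSw; case: (boolP (s i)) => [si|//]; apply/eqP; rewrite pnatr_eq0 eqb0.
  apply/forallPn; exists j; rewrite sj implybF negbK ltn_neqAle jmin // andbT.
  by rewrite eq_sym.
rewrite addr0 /GSw sj /= (_ : [forall h : 'I_n, _]) //.
by apply/forallP => i; apply/implyP => ij; apply/negP => /jmin; rewrite leqNgt ij.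
Qed.

Section Parts.
Variables (V : lmodType R) (n : nat) (c : involutions V n).

Lemma eigenparts_eigenpart r s i b x :
  eigenparts c r s (eigenpart c i b x) = eigenpart c i b (eigenparts c r s x).
Proof.
have eZ (t : R) y : eigenparts c r s (t *: y) = t *: eigenparts c r s y.
  exact: linearZ.
have eD y z : eigenparts c r s (y + z) = eigenparts c r s y + eigenparts c r s z.
  exact: linearD.
by rewrite /eigenpart eZ eD eZ eigenparts_op.
Qed.

Lemma eigenpartsC r s r' s' x :
  eigenparts c r s (eigenparts c r' s' x) = eigenparts c r' s' (eigenparts c r s x).
Proof. by elim: r' x => [|i r' IHr] x //=; rewrite IHr eigenparts_eigenpart. Qed.

End Parts.

Section PlainGS.
Variables (A : convAlg R) (n : nat).
Implicit Types (Q a b : 'I_n -> A).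

(* Multiplying by [inv (Q k)], which anticommutes with [Q i] for [i <> k],
   exchanges the two parts with respect to [Q i]. *)
Lemma parts_mul_inv Q (k : 'I_n) r (X : A) : clifford Q -> k \notin r ->
  parts r Q (fun=> true) X * inv (Q k) = parts r Q (fun=> false) (X * inv (Q k)).
Proof.
move=> hQ; elim: r X => [|i r IHr] X //=; rewrite in_cons negb_or => /andP[ki kr].
rewrite IHr //; congr (parts _ _ _ _).
rewrite /part expr0 expr1 mul1r mulN1r -scalerAl mulrDl; congr (_ *: (_ + _)).
have e : Q i * inv (Q k) = - (inv (Q k) * Q i).
  by rewrite (clifford_inv k hQ) mulrN mulNr opprK (clifford_anti hQ ki).
by rewrite mulNr -!mulrA e !mulrN opprK.
Qed.

Lemma OGS_at_fixed a b : fixed_system (@GSw R n) a b -> OGS_at a b.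
Proof.
move=> [hb hab P0] k; set r := [seq i : 'I_n <- enum 'I_n | (i < k)%N].
have kr : k \notin r by rewrite mem_filter ltnn.
have bb := clifford_sqr k hb.
pose c := clifford_conj hb; pose E j := (a j - b j) * inv (b j).
have E0 : connection c (@GSw R n) E = 0 by rewrite -Pi_connection.
pose Y := eigenparts c r (fun=> false) (E k).
(* A component of [Y] at some [s] with [s k] can survive only if [s] vanishes below [k]. Then [k] is
   the least index of [s], and the equation for [GS] kills this component of [E k]. *)
have cY : c k Y = Y.
  apply/eqP; rewrite eq_sym -subr_eq0; apply/eqP; apply: (eq_full (c := c)) => s.
  rewrite full_sub_op linear0; case: (boolP (s k)) => sk; last by rewrite mul0r scale0r.
  have -> : eigenparts c (enum 'I_n) s Y = 0; last by rewrite scaler0.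
  rewrite eigenpartsC (@eigenparts_eigen _ _ _ _ _ _ s) => [|i _]; last exact: op_full.
  case: ifP => // /allP hs; apply: (connection_GS_eq0 erefl E0 sk).
  move=> h hk; have := hs h; rewrite mem_filter hk mem_enum /= => /(_ isT).
  by case: (s h).
have hY : fil A 1 Y.
  have hE : fil A 1 (E k) by apply/fil_mulr/hab.
  rewrite /Y /eigenparts; elim: (r) (E k) hE => [|i r' IHr] x hx //=.
  by apply: IHr; apply/fil_scale/fil_add => //; apply/fil_scale/fil_mulr/fil_mull.
(* Multiplication by [inv (b k)] turns these parts of [a k] into the invariant parts of [1 + E k],
   and 1 is itself invariant. *)
have HE : parts r b (fun=> true) (a k) = (1 + Y) * b k.
  transitivity (parts r b (fun=> true) (a k) * inv (b k) * b k).
    by rewrite -mulrA invertible_mulVl ?mulr1 //; apply: clifford_invertible.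
  congr (_ * _); rewrite parts_mul_inv // parts_conj.
  have -> : a k * inv (b k) = 1 + E k.
    by rewrite /E mulrBl invertible_mulV ?[LHS]addrC; [zmod|exact: clifford_invertible].
  have -> : eigenparts c r (fun=> false) (1 + E k) =
      eigenparts c r (fun=> false) 1 + eigenparts c r (fun=> false) (E k) by exact: linearD.
  congr (_ + _); rewrite (@eigenparts_eigen _ _ _ _ _ _ (fun=> false)) => [|i _].
    by rewrite ifT //; apply/allP => i.
  by rewrite /= mulr1 scale1r invertible_mulVl //; apply: clifford_invertible.
have cbY : b k * (1 + Y) = (1 + Y) * b k.
  rewrite mulrDr mulrDl mulr1 mul1r; congr (_ + _).
  by rewrite -{1}cY /= !mulrA invertible_mulV ?mul1r //; apply: clifford_invertible.
rewrite HE -cbY; apply: (pol_at_polar (T := 1 + Y)) => //.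
by rewrite addrAC subrr add0r.
Qed.

(** Each entry is determined by [a] and the entries before it. *)
Lemma OGS_at_unique a b b' : OGS_at a b -> OGS_at a b' -> b = b'.
Proof.
move=> h h'; apply/funext => k; move: {2}(val k) (leqnn (val k)) => m.
elim: m k => [|m IHm] k km.
  apply: pol_at_unique (h k) _.
  suff -> : parts [seq i : 'I_n <- enum 'I_n | (i < k)%N] b (fun=> true) (a k) =
    parts [seq i : 'I_n <- enum 'I_n | (i < k)%N] b' (fun=> true) (a k) by [].
  rewrite (_ : [seq i : 'I_n <- enum 'I_n | (i < k)%N] = [::]) //.
  by apply/eqP; rewrite -[_ == _]negbK -has_filter; apply/hasPn => i _; rewrite -leqNgt (leq_trans km).
apply: pol_at_unique (h k) _.
suff -> : parts [seq i : 'I_n <- enum 'I_n | (i < k)%N] b (fun=> true) (a k) =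
    parts [seq i : 'I_n <- enum 'I_n | (i < k)%N] b' (fun=> true) (a k) by [].
rewrite /parts; have : {in [seq i : 'I_n <- enum 'I_n | (i < k)%N], b =1 b'}.
  by move=> i; rewrite mem_filter => /andP[ik _]; apply: IHm; rewrite -ltnS (leq_trans ik).
elim: [seq i : 'I_n <- enum 'I_n | (i < k)%N] (a k) => [|i r IHr] x hr //=.
by rewrite hr ?mem_head // IHr // => j jr; apply: hr; rewrite in_cons jr orbT.
Qed.

(** For the converse, the procedure has some value on its domain; this value satisfies the
    Gram-Schmidt equations, and they have at most one solution. *)
Lemma O_GS_restriction_aux a b :
  O_proc (@GSw R n) a b <-> dom a /\ OGS_at a b.
Proof.
have hw := GS_connection_data n; split=> [h|[ha hb]].
  by split; [case: h|apply: OGS_at_fixed; apply/O_procP].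
have [b' hb'] := O_proc_exists hw ha.
by rewrite (OGS_at_unique hb (OGS_at_fixed (proj1 (O_procP hw _ _) hb'))).
Qed.
End PlainGS.

Section FloatingGS.
Variables (A : convAlg R) (n : nat).
Local Notation V := (sum_convAlg A A).

Definition fcons (x : A) (Q : 'I_n -> A) (i : 'I_n.+1) : A :=
  if unlift ord0 i is Some j then Q j else x.

Lemma fcons0 x Q : fcons x Q ord0 = x.
Proof. by rewrite /fcons unlift_none. Qed.
Lemma fconsS x Q i : fcons x Q (lift ord0 i) = Q i.
Proof. by rewrite /fcons liftK. Qed.

Lemma fl_clifford_fcons Q : clifford Q -> fl_clifford (fcons 1 Q).
Proof.
move=> hQ; split; first by rewrite fcons0; apply: invertible1.
suff -> : fl_tail (fcons 1 Q) = Q by [].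
by apply/funext => i; rewrite /fl_tail fcons0 fconsS inv1 mulr1.
Qed.

Lemma parts_map_lift (T : 'I_n.+1 -> A) (s : 'I_n.+1 -> bool) r x :
  parts (map (lift ord0) r) T s x =
  parts r (fun i => T (lift ord0 i)) (fun i => s (lift ord0 i)) x.
Proof. by rewrite /parts; elim: r x => [|i r IHr] x //=. Qed.

(** With first entry 1 and index [ord0], the conjugating quotients are the entries of [b]
    themselves, so the floating equation reduces to the plain one for the tail. *)
Lemma fO_GS_base (a b : 'I_n -> A) : O_proc (@GSw R n) a b ->
  fO_proc (@GSw R n.+1) (fcons 1 a) (fcons 1 b).
Proof.
have hw := GS_connection_data n; have hw1 := GS_connection_data n.+1.
move=> /(O_procP hw)[hb hab P0].
have hB := proj1 (fl_cliffordP _) (fl_clifford_fcons hb).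
apply/fO_procP => //; split=> // [i|].
  case: (unliftP ord0 i) => [j ->|->]; rewrite ?fcons0 ?fconsS //.
  by rewrite subrr; apply: fil_zero.
set B := fcons 1 b in hB *; set X := fun i => _.
have B0 : B ord0 = 1 by rewrite /B fcons0.
have BS i : B (lift ord0 i) = b i by rewrite /B fconsS.
have XE0 : X ord0 = 0 by rewrite /X B0 fcons0 subrr.
have XES i : X (lift ord0 i) = a i - b i by rewrite /X BS fconsS.
clearbody X; clearbody B.
pose c := clifford_conj hb; pose E j := (a j - b j) * inv (b j).
have E0 : connection c (@GSw R n) E = 0 by rewrite -Pi_connection.
rewrite (fPi_connection hB hw1); apply: (eq_full (c := floating_swap hB)) => s.
rewrite full_connection linear0 big1 ?scaler0 // => j _.
rewrite /GSw; case: (boolP (s j && _)) => [/andP[sj /forallP hs]|_]; last by rewrite scale0r.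
rewrite scale1r; case: (unliftP ord0 j) sj hs => [j' ->|->] sj hs; last first.
  by rewrite /biquo XE0 mul0r mulr0; apply: linear0.
(* The weight is nonzero only if [j] is the least index of [s]; as [j] is positive, [s] vanishes at
   [ord0] and the shift of exponents by [s ord0] has no effect. *)
have s0 : s ord0 = false by have := hs ord0; rewrite /= => /negbTE.
have part1 x : part (1 : A) false x = x.
  by rewrite /part inv1 !mul1r mulr1 scaler_half.
pose s' : bvec n := [ffun i => s (lift ord0 i)].
have step (T : 'I_n.+1 -> A) t x : T ord0 = 1 -> t ord0 = false ->
    (forall i, T (lift ord0 i) = b i) -> (forall i, t (lift ord0 i) = s' i) ->
    parts (enum 'I_n.+1) T t x = parts (enum 'I_n) b s' x.
  move=> T0 t0 Tb ts; rewrite enum_ordSl /parts /= T0 t0 part1 -/(parts _ _ _ _) parts_map_lift.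
  by congr parts; apply/funext.
rewrite -(eigenparts_twist ord0 sj (swap_biquo hB X _)) partsE !step /=; first last.
- by move=> i; rewrite s0 addbF ffunE.
- by move=> i; rewrite BS B0 inv1 mulr1.
- by rewrite addbb.
- by rewrite B0 inv1 mulr1.
- by move=> i; rewrite s0 addbF ffunE.
- by move=> i; rewrite BS B0 inv1 mul1r.
- by rewrite addbb.
- by rewrite B0 inv1 mul1r.
rewrite XES BS !(parts_conj hb) -/(E j').
have hE : eigenparts c (enum 'I_n) s' (E j') = 0.
  apply: (connection_GS_eq0 erefl E0); first by rewrite ffunE.
  by move=> h hj; have := hs (lift ord0 h); rewrite ffunE /= /bump /= !add1n ltnS hj.
(* The left quotient is the conjugate of the right one, so the second half vanishes together with
   the first. *)
have -> : inv (b j') * (a j' - b j') = c j' (E j').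
  rewrite /= /E -!mulrA invertible_mulVl ?mulr1 //; exact: clifford_invertible.
by rewrite eigenparts_op hE; congr pair; apply: linear0.
Qed.

(** The definition of floating Gram-Schmidt divides by the first entry; [fO_Biv] undoes this
    division on the side of the procedure. *)
Lemma fO_GS_OfGS (a b : 'I_n.+1 -> A) : fO_proc (@GSw R n.+1) a b -> OfGS_at a b.
Proof.
have hw := GS_connection_data n; have hw1 := GS_connection_data n.+1.
move=> hab; have [hb nab _] := proj1 (fO_procP hw1 a b) hab.
have ib i : invertible (b i) by case: hb.
have ia : invertible (a ord0).
  have -> : a ord0 = b ord0 * (inv (b ord0) * a ord0).
    by rewrite mulrA invertible_mulV // mul1r.
  apply: invertible_mul => //; apply: invertible_fil.
  by rewrite -(invertible_mulVl (ib ord0)) -mulrBr; apply: fil_mull.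
have [Q hQ] : exists Q : 'I_n -> A, O_proc (@GSw R n) (fl_tail a) Q.
  apply: O_proc_exists => //; exists (fl_tail b); split.
    by have [] := proj2 (fl_cliffordP b) hb.
  move=> i; rewrite /fl_tail (_ : _ - _ = (a (lift ord0 i) - b (lift ord0 i)) * inv (a ord0) +
    b (lift ord0 i) * (inv (a ord0) - inv (b ord0))); last by nring.
  by apply: fil_add; [apply/fil_mulr/nab|apply/fil_mull/inv_fil].
split=> //; exists Q; first by apply: OGS_at_fixed; apply/O_procP.
have := fO_Biv hw1 (invertible1 A) ia (fO_GS_base hQ).
have -> : (fun i => 1 * fcons 1 (fl_tail a) i * a ord0) = a.
  apply/funext => i; case: (unliftP ord0 i) => [j ->|->]; rewrite ?fcons0 ?fconsS !mul1r //.
  by rewrite /fl_tail -mulrA invertible_mulVl // mulr1.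
move=> /(fO_vR hw1 hab) ->; rewrite fcons0 !mul1r; split=> // i.
by rewrite fconsS mul1r.
Qed.

Lemma OfGS_at_unique (a b b' : 'I_n.+1 -> A) : OfGS_at a b -> OfGS_at a b' -> b = b'.
Proof.
move=> [_ [Q hQ [b0 bS]]] [_ [Q' hQ' [b0' bS']]].
apply/funext => i; case: (unliftP ord0 i) => [j ->|->]; last by rewrite b0 b0'.
by rewrite bS bS' (OGS_at_unique hQ hQ').
Qed.

Lemma fO_GS_restriction_aux (a b : 'I_n.+1 -> A) :
  fO_proc (@GSw R n.+1) a b <-> fdom a /\ OfGS_at a b.
Proof.
have hw := GS_connection_data n.+1; split=> [h|[ha hb]].
  by split; [case: h|apply: fO_GS_OfGS].
have [b' hb'] := fO_proc_exists hw ha.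
by rewrite (OfGS_at_unique hb (fO_GS_OfGS hb')).
Qed.
End FloatingGS.
End GramSchmidt.

(** * Binomial coefficients with exponents one half and minus one half *)

Section BinomialCoefficients.
Variable R : realType.

Lemma gbinom0 (e : R) : gbinom e 0 = 1.
Proof. by rewrite /gbinom big_ord0 fact0 divr1. Qed.

Lemma gbinomS (e : R) k : k.+1%:R * gbinom e k.+1 = (e - k%:R) * gbinom e k.
Proof.
rewrite /gbinom big_ord_recr /= factS natrM.
have h1 : (k.+1%:R : R) != 0 by rewrite pnatr_eq0.
have h2 : (k`!%:R : R) != 0 by rewrite pnatr_eq0 -lt0n fact_gt0.
by field; rewrite addrC natr1 h1 h2.
Qed.

(** Both sides satisfy the same recurrence. The convolution identity of the sine means thereby
    serves for matrix square roots. *)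
Lemma gbinom_wallis k : gbinom (- 2%:R^-1 : R) k = (-1) ^+ k * wallis R k.
Proof.
elim: k => [|k IHk]; first by rewrite gbinom0 wallis0 mulr1.
have h1 : (k.+1%:R : R) != 0 by rewrite pnatr_eq0.
apply: (mulfI h1); rewrite gbinomS IHk exprS.
have := wallisS R k; rewrite -[k.*2.+1%:R]natr1 -!mul2n !natrM => e.
have -> : k.+1%:R * (-1 * (-1) ^+ k * wallis R k.+1) =
   - (2%:R^-1 * (-1) ^+ k) * (2%:R * k.+1%:R * wallis R k.+1) by field.
by rewrite e; field.
Qed.

Lemma gbinom_half_convolution k :
  \sum_(i < k.+1) gbinom (- 2%:R^-1 : R) i * gbinom (- 2%:R^-1) (k - i) = (-1) ^+ k.
Proof.
rewrite (eq_bigr (fun i : 'I_k.+1 => (-1) ^+ k * (wallis R i * wallis R (k - i)))).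
  by rewrite -mulr_sumr wallis_convolution mulr1.
move=> i _; have ik : (i <= k)%N by rewrite -ltnS.
by rewrite !gbinom_wallis mulrACA -exprD subnKC.
Qed.

(** Multiplication by 1 + X raises the exponent by one; this leads from the series of exponent -1/2
    to that of exponent 1/2. *)
Lemma gbinom_pascal (e : R) k : gbinom (e + 1) k.+1 = gbinom e k.+1 + gbinom e k.
Proof.
rewrite /gbinom (big_ord_recl k) (big_ord_recr k) /= subr0.
rewrite [X in _ * X / _](eq_bigr (fun i : 'I_k => e - i%:R)); last first.
  by move=> i _; rewrite /bump /= add1n -natr1; ring.
rewrite factS natrM.
have h1 : (k.+1%:R : R) != 0 by rewrite pnatr_eq0.
have h2 : (k`!%:R : R) != 0 by rewrite pnatr_eq0 -lt0n fact_gt0.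
rewrite -natr1 in h1 *.
by field; rewrite ?[1 + _]addrC h2 h1.
Qed.
End BinomialCoefficients.

Section CauchySwap.
Variable m : nat.

Lemma perm_mbelow_rev (c : midx m) : perm_eq (mbelow c) [seq msub c a | a <- mbelow c].
Proof.
have subK a : mle a c -> msub c (msub c a) = a.
  by move=> /mleP h; apply/ffunP => i; rewrite !ffunE subKn.
have suble a : mle (msub c a) c by apply/mleP => i; rewrite ffunE leq_subr.
apply: uniq_perm; first exact: mbelow_uniq.
  rewrite map_inj_in_uniq ?mbelow_uniq // => a b; rewrite !mem_mbelow => ha hb h.
  by rewrite -(subK a ha) h subK.
move=> a; apply/idP/mapP => [|[b _ ->]]; last by rewrite mem_mbelow.
by rewrite mem_mbelow => ha; exists (msub c a); rewrite ?mem_mbelow // subK.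
Qed.

Lemma cauchy_swap (X Y : Type) (Z : nmodType) (op : X -> Y -> Z) f g (c : midx m) :
  cauchy op f g c = cauchy (fun y x => op x y) g f c.
Proof.
rewrite /cauchy (perm_big _ (perm_mbelow_rev c)) big_map big_seq [RHS]big_seq.
apply: eq_bigr => a; rewrite mem_mbelow => /mleP h; congr (op _ (g _)).
by apply/ffunP => i; rewrite !ffunE subKn.
Qed.
End CauchySwap.

Lemma fd_filP (R : realType) (C : algType R) (Cfin : fin_codim [set (0 : C)]) i (x : C) :
  fil (fd_convAlg Cfin) i x <-> ((0 < i)%N -> x = 0).
Proof. by []. Qed.

Section ScalarSeries.
Variables (R : realType) (m : nat) (C : algType R) (Cfin : fin_codim [set (0 : C)]).
Local Notation B := (pser_convAlg m (reals_convAlg R)).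
Local Notation CB := (pser_convAlg m (fd_convAlg Cfin)).

Lemma ps_mulC (x y : B) : x * y = y * x.
Proof.
apply: pserP => c; rewrite [LHS]cauchy_swap; apply: eq_bigr => a _ /=.
exact: (@mulrC R).
Qed.

(** The central embedding through which entries of matrices over the scalar series act on the
    Clifford side. *)
Definition scal (x : B) : CB := PSer (fun a => (x a : R)%:A : C).

Lemma scal_mull (x : B) (f : CB) d :
  (scal x * f : CB) d = \sum_(a <- mbelow d) (x a : R) *: (f (msub d a) : C).
Proof. by apply: eq_bigr => a _; rewrite /= mulr_algl. Qed.

Lemma scal_comm (x : B) (f : CB) : scal x * f = f * scal x.
Proof.
apply: pserP => d; rewrite [RHS]cauchy_swap; apply: eq_bigr => a _ /=.
by rewrite mulr_algl mulr_algr.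
Qed.

Lemma scal_mul (x y : B) : scal (x * y) = scal x * scal y.
Proof.
apply: pserP => d; rewrite scal_mull [LHS]/= /cauchy scaler_suml.
by apply: eq_bigr => a _; rewrite /= scalerA.
Qed.

Lemma scal_add (x y : B) : scal (x + y) = scal x + scal y.
Proof. by apply: pserP => d; rewrite /= scalerDl. Qed.

Lemma scal_opp (x : B) : scal (- x) = - scal x.
Proof. by apply: pserP => d; rewrite /= scaleNr. Qed.

Lemma scal0 : scal 0 = 0.
Proof. by apply: pserP => d; rewrite /= scale0r. Qed.

Lemma scal1 : scal 1 = 1.
Proof. by apply: pserP => d /=; case: eqP; rewrite ?scale1r ?scale0r. Qed.

Lemma scal_sum (I : Type) (r : seq I) (F : I -> B) :
  scal (\sum_(i <- r) F i) = \sum_(i <- r) scal (F i).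
Proof. by elim/big_rec2: _ => [|i x y _ <-]; rewrite ?scal0 ?scal_add. Qed.

Lemma scal_scale (c : R) (x : B) : scal (c *: x) = c *: scal x.
Proof. by apply: pserP => d; rewrite /= scalerA. Qed.

Lemma scal_fil i (x : B) : fil B i x -> fil CB i (scal x).
Proof.
move=> /ps_filP h; apply/ps_filP => a; apply/fd_filP => ia.
by rewrite /= (proj1 (fd_filP _ _ _) (h a) ia) scale0r.
Qed.
End ScalarSeries.

(** * Identities comparing a limit with its truncations *)

Section RingIdentities.
Variable M : nzRingType.
Implicit Types H S W X w y r : M.

Lemma commutator_approx S W w : S * w = w * S ->
  S * W - W * S = S * (W - w) - (W - w) * S.
Proof. by move=> e; rewrite mulrBr mulrBl e; zmod. Qed.

Lemma sandwich_approx S W w y : S * w = w * S ->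
  W * (S * W) - 1 =
  (W - w) * (S * W) + w * (S * (W - w)) + (S * (w * w - y) + (S * y - 1)).
Proof. by move=> e; rewrite !(mulrBl, mulrBr, mulrA) e; zmod. Qed.

Lemma product_approx H S W w w' r : S * w = w' + r ->
  H - S * W = (H - w') - S * (W - w) - r.
Proof. by move=> e; rewrite mulrBr e; zmod. Qed.

Lemma mulrB_approx S W w y : S * W - w * y = (S - w) * W + w * (W - y).
Proof. by rewrite mulrBl mulrBr; zmod. Qed.

Lemma alternating_geometric X N :
  (1 + X) * (\sum_(k < N) (- X) ^+ k) - 1 = - (- X) ^+ N.
Proof. by rewrite (_ : 1 + X = - (- X - 1)) ?mulNr -?subrX1; zmod. Qed.

(** Multiplication by [1 + X] adds neighbouring coefficients, and the truncation leaves a single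
    term of top degree. *)
Lemma binomial_shift (R : comNzRingType) (sigma : {rmorphism R -> M}) (c : R) S X
    (g h : nat -> R) N :
  (forall t y, sigma t * y = y * sigma t) -> S = sigma c * (1 + X) ->
  h 0%N = c * g 0%N -> (forall k, h k.+1 = c * (g k.+1 + g k)) ->
  S * (\sum_(k < N.+1) sigma (g k) * X ^+ k) =
  \sum_(k < N.+1) sigma (h k) * X ^+ k + sigma (c * g N) * X ^+ N.+1.
Proof.
move=> cs -> h0 hS; elim: N => [|N IHN].
  rewrite !big_ord1 !expr0 !mulr1 expr1 h0 -mulrA mulrDl mul1r -cs mulrDr.
  by rewrite mulrA -rmorphM.
rewrite big_ord_recr mulrDr IHN /= [in RHS]big_ord_recr /= -!addrA; congr (_ + _).
rewrite hS -mulrA mulrDl mul1r mulrDr [in RHS]mulrDr !rmorphD !mulrDl.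
rewrite ![X * (_ * _)]mulrA -cs -!mulrA -exprS !mulrA -!rmorphM; zmod.
Qed.
End RingIdentities.

(** * Binomial series of matrices over power series *)

Section MatrixSeries.
Variables (R : realType) (m n : nat).
Local Notation B := (pser_convAlg m (reals_convAlg R)).
Local Notation MB := 'M[B]_n.+1.
Implicit Types (X Y : MB).

Definition mfil i X : Prop := forall p q, fil B i (X p q).

Lemma mfil0 i : mfil i 0.
Proof. by move=> p q; rewrite mxE; apply: fil_zero. Qed.

Lemma mfil_add i X Y : mfil i X -> mfil i Y -> mfil i (X + Y).
Proof. by move=> hX hY p q; rewrite mxE; apply: fil_add. Qed.

Lemma mfil_opp i X : mfil i X -> mfil i (- X).
Proof. by move=> hX p q; rewrite mxE; apply: fil_opp. Qed.

Lemma mfil_mul i j X Y : mfil i X -> mfil j Y -> mfil (i + j) (X * Y).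
Proof. by move=> hX hY p q; rewrite mxE; apply: fil_sum => k; apply: fil_mul. Qed.

Lemma mfil_full X : mfil 0 X. Proof. by move=> p q; apply: fil_full. Qed.

Lemma mfil_mull i X Y : mfil i Y -> mfil i (X * Y).
Proof. by move=> hY; apply: (@mfil_mul 0 i _ _ (@mfil_full X)). Qed.

Lemma mfil_mulr i X Y : mfil i X -> mfil i (X * Y).
Proof. by move=> hY; rewrite -[i]addn0; apply: mfil_mul (@mfil_full Y). Qed.

Lemma mfil_exp k X : mfil 1 X -> mfil k (X ^+ k).
Proof.
move=> h; elim: k => [|k IH]; first exact: mfil_full.
by rewrite exprS -add1n; apply: mfil_mul.
Qed.

Lemma mfil_eq X Y : (forall i, mfil i (X - Y)) -> X = Y.
Proof.
move=> h; apply/matrixP => p q; apply: fil_hausdorff_eq => i.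
by have := h i p q; rewrite !mxE.
Qed.

Definition msigma (c : R) : MB := (c%:A : B)%:M.
Fact msigma_zmod : zmod_morphism msigma.
Proof. by move=> x y; rewrite /msigma scalerBl raddfB. Qed.
Fact msigma_monoid : monoid_morphism msigma.
Proof.
split=> [|x y]; first by rewrite /msigma scale1r.
by rewrite /msigma -[X in _ = X](scalar_mxM) -scalerAl mul1r scalerA.
Qed.
HB.instance Definition _ := GRing.isZmodMorphism.Build R MB msigma msigma_zmod.
HB.instance Definition _ := GRing.isMonoidMorphism.Build R MB msigma msigma_monoid.

Lemma msigma_comm (c : R) X : msigma c * X = X * msigma c.
Proof.
rewrite -[LHS]/(_ *m _) -[RHS]/(_ *m _) /msigma mul_scalar_mx; apply/matrixP => p q.
rewrite !mxE (bigD1 q) //= big1 => [|k kq]; last by rewrite !mxE (negbTE kq) mulr0n mulr0.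
by rewrite !mxE eqxx mulr1n addr0 ps_mulC.
Qed.

Variables (c : R) (S : MB).
Hypothesis c0 : 0 < c.
Let X : MB := (c^-1)%:A *: S - 1.
Hypothesis hX : mfil 1 X.
Local Notation half := (2%:R^-1 : R).

Lemma msigmaE (t : R) (Y : MB) : (t%:A : B) *: Y = msigma t * Y.
Proof. by rewrite -[RHS]/(_ *m _) /msigma mul_scalar_mx. Qed.

Lemma msigmaV : msigma c * msigma c^-1 = 1.
Proof. by rewrite -rmorphM mulfV ?rmorph1 // gt_eqF. Qed.

Lemma SE : S = msigma c * (1 + X).
Proof.
rewrite /X addrC subrK msigmaE mulrA msigmaV mul1r //.
Qed.

Lemma commSX : S * X = X * S.
Proof.
rewrite /X msigmaE mulrBr mulrBl mulr1 mul1r; congr (_ - _).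
by rewrite mulrA -msigma_comm.
Qed.

Definition binsum (a : nat -> R) N : MB := \sum_(k < N) msigma (a k) * X ^+ k.

Lemma binsumC (a : nat -> R) N : S * binsum a N = binsum a N * S.
Proof.
rewrite mulr_suml mulr_sumr; apply: eq_bigr => k _.
rewrite mulrA -msigma_comm -!mulrA; congr (_ * _).
by apply: commrX; apply: commSX.
Qed.

Lemma binom_series_spec e N :
  mfil N (binom_series e c S - binsum (fun k => c `^ e * gbinom e k) N).
Proof.
set a := fun k => _; move=> p q; rewrite !mxE.
pose u M : B := (binsum a M) p q.
have -> : (fun M => (\sum_(k < M) ((c `^ e * gbinom e k)%:A : B) *:
     ((c^-1)%:A *: S - 1%:M) ^+ k) p q) = u.
  apply/funext => M; rewrite /u /binsum; congr (fun_of_matrix _ _ _).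
  by apply: eq_bigr => k _; rewrite msigmaE.
have [y hy] : exists y, forall i k, (i <= k)%N -> fil B i (y - u k).
  apply: fil_complete_leq => i; rewrite /u /binsum big_ord_recr /= mxE addrAC subrr add0r.
  exact: (mfil_mull _ (mfil_exp hX)).
rewrite (@limA_eq _ _ u y); first exact: hy.
by apply: fil_cvgA => i; exists i => k; apply: hy.
Qed.

Local Notation W := (binom_series (- half) c S).
Local Notation g := (fun k => c `^ (- half) * gbinom (- half) k).

Lemma inv_sqrt_comm : S * W = W * S.
Proof.
apply: mfil_eq => N; have h := @binom_series_spec (- half) N.
rewrite (commutator_approx _ (binsumC g N)).
exact: (mfil_add (@mfil_mull N S _ h) (mfil_opp (@mfil_mulr N _ S h))).
Qed.

Lemma powR_half_sqr : c `^ (- half) * c `^ (- half) = c^-1.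
Proof.
rewrite -powRD; last by rewrite (gt_eqF c0) implybT.
rewrite (_ : - half + - half = -1); last by field.
by rewrite powRN powRr1 // ltW.
Qed.

(** The convolution identity squares the truncated series into c^-1 times the alternating geometric
    series in [X], which is inverse to S = c (1 + X) up to its first omitted term. *)
Lemma inv_sqrt_sqr : W * (S * W) = 1.
Proof.
apply: mfil_eq => N; have h := @binom_series_spec (- half) N.
set w := binsum _ N in h.
have e1 : mfil N (w * w - binsum (fun k => c^-1 * (-1) ^+ k) N).
  have cX : commr_rmorph (msigma : {rmorphism R -> MB}) X.
    by move=> t; rewrite /GRing.comm msigma_comm.
  have := @truncated_product _ _ (msigma : {rmorphism R -> MB}) X cX (mfil N) N
    (@mfil0 N) (@mfil_add N) (@mfil_mull N) (mfil_exp hX) g g.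
  have -> : binsum (fun k => c^-1 * (-1) ^+ k) N =
      binsum (fun k => \sum_(i < k.+1) g i * g (k - i)%N) N; last by [].
  apply: eq_bigr => k _; rewrite -(gbinom_half_convolution R k) mulr_sumr.
  suff -> : \sum_(i < k.+1) c^-1 * (gbinom (- half) i * gbinom (- half) (k - i)) =
     \sum_(i < k.+1) g i * g (k - i)%N by [].
  by apply: eq_bigr => i _; rewrite -powR_half_sqr mulrACA.
have e2 : mfil N (S * binsum (fun k => c^-1 * (-1) ^+ k) N - 1).
  have -> : S * binsum (fun k => c^-1 * (-1) ^+ k) N = (1 + X) * \sum_(k < N) (- X) ^+ k.
    rewrite SE -mulrA [msigma c * _]msigma_comm -mulrA; congr (_ * _).
    rewrite mulr_suml; apply: eq_bigr => k _; rewrite -msigma_comm mulrA -rmorphM mulrA.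
    rewrite mulfV ?gt_eqF // mul1r [(- X) ^+ k]exprNn; congr (_ * _).
    by rewrite rmorphXn rmorphN rmorph1.
  by rewrite alternating_geometric exprNn; apply/mfil_opp/mfil_mull/mfil_exp.
rewrite (sandwich_approx _ (binsum (fun k => c^-1 * (-1) ^+ k) N) (binsumC g N)).
exact: (mfil_add (mfil_add (@mfil_mulr N _ (S * W) h)
  (@mfil_mull N w _ (@mfil_mull N S _ h))) (mfil_add (@mfil_mull N S _ e1) e2)).
Qed.

(** By Pascal's rule the product of [S] with the series of exponent -1/2 has the coefficients of
    exponent 1/2. So the trace of the square root is available through [W]. *)
Lemma binom_series_half : binom_series half c S = S * W.
Proof.
apply: mfil_eq => N; case: N => [|N]; first exact: mfil_full.
have h := @binom_series_spec (- half) N.+1; have h' := @binom_series_spec half N.+1.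
set w := binsum _ N.+1 in h; set w' := binsum _ N.+1 in h'.
have powR_half : c * c `^ (- half) = c `^ half.
  rewrite -{1}[c]powRr1 ?ltW // -powRD; last by rewrite (gt_eqF c0) implybT.
  by congr (_ `^ _); field.
have e : S * w = w' + msigma (c * g N) * X ^+ N.+1.
  apply: (binomial_shift (sigma := msigma : {rmorphism R -> MB}) (g := g) _ _ SE) => [t y||k].
  - exact: msigma_comm.
  - by rewrite !gbinom0 !mulr1 powR_half.
  - rewrite -mulrDr -gbinom_pascal mulrA powR_half; congr (_ * gbinom _ _).
    by field.
rewrite (product_approx _ _ e).
exact: (mfil_add (mfil_add h' (mfil_opp (@mfil_mull N.+1 S _ h)))
  (mfil_opp (@mfil_mull N.+1 (msigma (c * g N)) _ (@mfil_exp N.+1 _ hX)))).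
Qed.

Lemma inv_sqrt_const : mfil 1 (W - msigma (c `^ (- half))).
Proof.
have := @binom_series_spec (- half) 1.
by rewrite /binsum big_ord1 expr0 mulr1 gbinom0 mulr1.
Qed.

(** The truncations are polynomials in [X], and powers of a symmetric matrix over a commutative ring
    are symmetric. *)
Lemma inv_sqrt_sym : (forall p q, S p q = S q p) -> forall p q, W p q = W q p.
Proof.
move=> hS p q; apply: fil_hausdorff_eq => N; have h := @binom_series_spec (- half) N.
set w := binsum _ N in h.
suff e : w p q = w q p.
  have hE i j : fil B N (W i j - w i j).
    by have := h i j; rewrite mxE [X in _ + X]mxE.
  by apply: (@fil_trans _ _ _ (w p q)) => //; rewrite e; apply: fil_subC.
have Xsym a b : X a b = X b a by rewrite !mxE hS eq_sym.
have Xk k a b : (X ^+ k) a b = (X ^+ k) b a.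
  elim: k a b => [|k IHk] a b; first by rewrite expr0 !mxE eq_sym.
  rewrite {1}exprS exprSr !mxE; apply: eq_bigr => l _.
  by rewrite ps_mulC IHk Xsym.
rewrite /w /binsum !summxE; apply: eq_bigr => k _.
by rewrite -msigmaE !mxE Xk.
Qed.
End MatrixSeries.

(** * Symmetric orthogonalization *)
Section OrthogonalFrame.
Variables (R : realType) (C : algType R) (Cfin : fin_codim [set (0 : C)]) (m n : nat).
Local Notation B := (pser_convAlg m (reals_convAlg R)).
Local Notation CB := (pser_convAlg m (fd_convAlg Cfin)).
Local Notation scal := (scal Cfin).
Local Notation half := (2%:R^-1 : R).
Variables (alpha : 'I_n.+1 -> CB) (c : R) (S W T : 'M[B]_n.+1).
Hypotheses (c0 : 0 < c).
Hypothesis alpha_anti : forall i j,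
  alpha i * alpha j + alpha j * alpha i = (- 2%:R : R) *: scal (S i j).
Hypotheses (W_sym : forall i j, W i j = W j i) (T_sym : forall i j, T i j = T j i).
Hypotheses (WT : W * T = 1) (TE : T = S * W).
Hypotheses (S_const : mfil 1 (S - msigma m n c)).
Hypotheses (W_const : mfil 1 (W - msigma m n (c `^ (- half)))).

Definition frame (U : 'M[B]_n.+1) (i : 'I_n.+1) : CB := \sum_j alpha j * scal (U j i).

Let beta := frame W.

(** The Gram matrix of the new frame is [W S W], hence 1. *)
Lemma beta_anti i l : beta i * beta l + beta l * beta i = (- 2%:R * (i == l)%:R : R) *: (1 : CB).
Proof.
have e k k' : beta k * beta k' = \sum_j \sum_p (alpha j * alpha p) * scal (W j k * W p k').
  rewrite mulr_suml; apply: eq_bigr => j _; rewrite mulr_sumr; apply: eq_bigr => p _.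
  by rewrite scal_mul -!mulrA; congr (_ * _); rewrite !mulrA scal_comm.
rewrite !e [X in _ + X]exchange_big -big_split /=.
have WE : \sum_j \sum_p W j i * (S j p * W p l) = (i == l)%:R.
  transitivity ((W * T) i l); last by rewrite WT mxE.
  rewrite mxE; apply: eq_bigr => j _.
  by rewrite W_sym TE [X in _ = _ * X]mxE mulr_sumr; apply: eq_bigr.
transitivity ((- 2%:R : R) *: scal (\sum_j \sum_p W j i * (S j p * W p l))).
  rewrite scal_sum scaler_sumr; apply: eq_bigr => j _.
  rewrite scal_sum scaler_sumr -big_split; apply: eq_bigr => p _ /=.
  rewrite [W p l * _]ps_mulC -mulrDl alpha_anti -scalerAl -scal_mul; congr (_ *: scal _).
  by rewrite !mulrA [S j p * W j i]ps_mulC.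
by rewrite WE -scalerA; congr (_ *: _); case: (i == l); rewrite ?scal1 ?scal0 ?scale1r ?scale0r.
Qed.

Lemma alpha_beta j : alpha j = \sum_i beta i * scal (T i j).
Proof.
transitivity (\sum_k alpha k * scal ((W * T) k j)).
  rewrite WT (bigD1 j) //= big1 => [|k kj]; last by rewrite mxE (negbTE kj) scal0 mulr0.
  by rewrite mxE eqxx scal1 mulr1 addr0.
rewrite (eq_bigr (fun k => \sum_i alpha k * scal (W k i) * scal (T i j))).
  by rewrite exchange_big; apply: eq_bigr => i _; rewrite mulr_suml.
move=> k _; rewrite mxE scal_sum mulr_sumr; apply: eq_bigr => i _.
by rewrite scal_mul mulrA.
Qed.

Lemma near_frame (U : 'M[B]_n.+1) : mfil 1 (U - 1) -> near alpha (frame U).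
Proof.
move=> hU i; have -> : alpha i - frame U i = \sum_j alpha j * scal ((1 - U) j i).
  rewrite (eq_bigr (fun j => alpha j * scal ((1 : 'M[B]_n.+1) j i) - alpha j * scal (U j i))).
    rewrite sumrB; congr (_ - _); rewrite (bigD1 i) //= big1 => [|k ki].
      by rewrite mxE eqxx scal1 mulr1 addr0.
    by rewrite mxE (negbTE ki) scal0 mulr0.
  by move=> j _; rewrite [(1 - U) j i]mxE [(- U) j i]mxE scal_add scal_opp mulrBr.
apply: fil_sum => j; apply: fil_mull; apply: scal_fil.
by rewrite -opprB mxE; apply/fil_opp/hU.
Qed.

Lemma clifford_beta : clifford beta.
Proof. by move=> i j; apply: beta_anti. Qed.

Lemma sum_beta_alpha : \sum_j beta j * alpha j = \sum_j alpha j * beta j.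
Proof.
transitivity (\sum_j \sum_i beta j * beta i * scal (T i j)).
  apply: eq_bigr => j _; rewrite alpha_beta mulr_sumr.
  by apply: eq_bigr => i _; rewrite mulrA.
rewrite exchange_big; apply: eq_bigr => i _; rewrite alpha_beta mulr_suml.
by apply: eq_bigr => j _; rewrite T_sym -!mulrA scal_comm.
Qed.

(** By [sum_beta_alpha], twice the sum is a sum of anticommutators of the [beta] with coefficients
    from [T], of which only the diagonal remains. *)
Lemma sum_alpha_beta : \sum_j alpha j * beta j = - scal (\tr T).
Proof.
set X := LHS; have n2 : (2%:R : R) != 0 by rewrite pnatr_eq0.
apply: (scalerI n2); rewrite scaler_nat mulr2n {1}/X -{1}sum_beta_alpha /X -big_split /=.
transitivity (\sum_j \sum_i (- 2%:R * (i == j)%:R : R) *: scal (T i j)).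
  transitivity (\sum_j \sum_i (beta j * beta i + beta i * beta j) * scal (T i j)).
    apply: eq_bigr => j _; rewrite alpha_beta mulr_sumr mulr_suml -big_split.
    apply: eq_bigr => i _ /=; rewrite mulrDl !mulrA; congr (_ + _).
    by rewrite -!mulrA scal_comm.
  apply: eq_bigr => j _; apply: eq_bigr => i _.
  by rewrite beta_anti eq_sym -scalerAl mul1r.
rewrite /mxtrace scal_sum scalerN -scaleNr scaler_sumr; apply: eq_bigr => j _.
rewrite (bigD1 j) //= big1 => [|i ij]; last by rewrite (negbTE ij) mulr0 scale0r.
by rewrite eqxx mulr1 addr0.
Qed.

Lemma Sy_connection_data k : connection_data (@Syw R k).
Proof.
split=> [s j sj|s s0]; first by rewrite /Syw sj mul0r; case: ifP.
rewrite /Syw (negbTE s0) -mulr_suml -natr_sum mulfV // pnatr_eq0 sum_nat_eq0.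
apply: contra s0 => /forallP h; apply/eqP/ffunP => i; rewrite ffunE.
by have := h i; rewrite eqb0 => /negbTE.
Qed.

Lemma O_proc_frame : c = 1 -> O_proc (@Syw R n.+1) alpha (frame W).
Proof.
move=> c1; apply/O_procP; first exact: Sy_connection_data.
split; first exact: clifford_beta.
  by apply: near_frame; move: W_const; rewrite c1 powR1 rmorph1.
apply/(commutator_Sy (Sy_connection_data n.+1) _ clifford_beta erefl).
transitivity (\sum_j (beta j * alpha j - alpha j * beta j)).
  by apply: eq_bigr => j _; rewrite mulrBr mulrBl; zmod.
by rewrite sumrB sum_beta_alpha subrr.
Qed.

(** The conformal factor comes from the floating equation: for b_j = st beta_j the sum of alpha_j
    b_j^-1 - 1 is st^-1 times the trace of [T], minus the number of vectors. *)
Let tau : B := ((n.+1%:R^-1 : R)%:A : B) * \tr T.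
Let st : CB := scal tau.

Lemma trT_scal : scal (\tr T) = n.+1%:R *: st.
Proof.
rewrite /st /tau mulr_algl scal_scale scalerA mulfV ?scale1r // pnatr_eq0 //.
Qed.

Lemma fil_const_entry (X : 'M[B]_n.+1) (t : R) : mfil 1 (X - msigma m n t) ->
  forall i j, fil B 1 (X i j - (t * (i == j)%:R)%:A).
Proof.
move=> h i j; have := h i j; rewrite mxE [X in _ + X]mxE [X in - X]mxE.
by case: (i == j); rewrite ?mulr1 ?mulr0 ?mulr1n ?mulr0n ?scale0r.
Qed.

Lemma tau_const : fil B 1 (tau - (c `^ half)%:A).
Proof.
have hT : mfil 1 (T - msigma m n (c `^ half)).
  have -> : c `^ half = c * c `^ (- half).
    rewrite -{2}[c]powRr1 ?ltW // -powRD; last by rewrite (gt_eqF c0) implybT.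
    by congr (_ `^ _); field.
  rewrite rmorphM TE mulrB_approx.
  exact: (mfil_add (@mfil_mulr _ _ _ 1 _ W S_const) (@mfil_mull _ _ _ 1 (msigma m n c) _ W_const)).
rewrite (_ : _ - _ = n.+1%:R^-1 *: \sum_i (T i i - (c `^ half)%:A)).
  apply: fil_scale; apply: fil_sum => i; have := fil_const_entry hT i i.
  by rewrite eqxx mulr1.
rewrite /tau mulr_algl sumrB scalerBr; congr (_ - _).
have sumc (z : B) : \sum_(i < n.+1) z = (n.+1%:R : R) *: z.
  by rewrite sumr_const card_ord scaler_nat.
by rewrite sumc scalerA mulVf ?scale1r ?pnatr_eq0.
Qed.

Lemma st_comm x : st * x = x * st. Proof. exact: scal_comm. Qed.

Lemma st_invertible : invertible st.
Proof.
have s0 : 0 < c `^ half by apply: powR_gt0.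
have -> : st = ((c `^ half)%:A : CB) * ((c `^ half)^-1 *: st).
  by rewrite mulr_algl scalerA mulfV ?scale1r // gt_eqF.
apply: invertible_mul.
  exists ((c `^ half)^-1%:A); rewrite !mulr_algl !scalerA mulVf ?mulfV ?gt_eqF //.
  by rewrite scale1r.
apply: invertible_fil; rewrite (_ : _ - _ = (c `^ half)^-1 *: scal (tau - (c `^ half)%:A)).
  by apply/fil_scale/scal_fil/tau_const.
rewrite scal_add scal_opp scalerBr; congr (_ - _).
by rewrite scal_scale scal1 scalerA mulVf ?scale1r // gt_eqF.
Qed.

Lemma inv_st_comm x : inv st * x = x * inv st.
Proof.
have i := st_invertible.
by rewrite -[x in LHS]mulr1 -(invertible_mulV i) !mulrA -(mulrA _ x) -st_comm mulrA invertible_mulVl // mul1r.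
Qed.

Lemma frame_scale i : frame (tau *: W) i = st * beta i.
Proof.
rewrite /beta /frame mulr_sumr; apply: eq_bigr => j _.
by rewrite mxE scal_mul !mulrA st_comm.
Qed.

Lemma fO_proc_frame : fO_proc (@Syw R n.+1) alpha (frame (tau *: W)).
Proof.
have i := st_invertible; have bb k : beta k * beta k = -1 := clifford_sqr k clifford_beta.
have e1 k l : frame (tau *: W) k * (- inv st * beta l) = - (beta k * beta l).
  rewrite frame_scale mulNr mulrN inv_st_comm mulrA -(mulrA st) st_comm -[_ * st * _]mulrA.
  by rewrite invertible_mulV // mulr1.
have e2 k l : - inv st * beta k * frame (tau *: W) l = - (beta k * beta l).
  rewrite frame_scale !mulNr st_comm mulrA -(mulrA (inv st)) inv_st_comm -[_ * inv st * _]mulrA.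
  by rewrite invertible_mulVl // mulr1.
have [|||hb vb] := @floatingP _ CB _ (frame (tau *: W)) (fun k => - inv st * beta k).
- by move=> k; rewrite e1 bb opprK.
- by move=> k; rewrite e2 bb opprK.
- by move=> k l kl; rewrite !e1 (clifford_anti clifford_beta kl).
apply/fO_procP; first exact: Sy_connection_data.
have hw := Sy_connection_data n.+1.
split=> //.
  apply: near_frame => k l; have hW := fil_const_entry W_const k l.
  rewrite mxE [X in X + _]mxE [X in _ + X]mxE [X in - X]mxE.
  have s1 : c `^ half * c `^ (- half) = 1.
    by rewrite -powRD ?subrr ?powRr0 // (gt_eqF c0) implybT.
  rewrite (_ : _ - _ = (tau - (c `^ half)%:A) * W k l +
     (c `^ half)%:A * (W k l - (c `^ (- half) * (k == l)%:R)%:A)).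
    by apply: fil_add; [apply/fil_mulr/tau_const|apply: fil_mull].
  rewrite mulrBl mulrBr [in X in _ = _ + (_ - X)]mulr_algl scalerA mulrA s1 mul1r.
  by case: (k == l); rewrite ?mulr1n ?mulr0n ?scale1r ?scale0r; zmod.
have trst : inv st * scal (\tr T) = n.+1%:R%:A.
  by rewrite trT_scal -scalerAr invertible_mulVl.
have nE : n.+1%:R%:A = \sum_(j < n.+1) (1 : CB).
  by rewrite sumr_const card_ord scaler_nat.
apply/(fPi_Sy hw _ hb erefl); split.
  transitivity (\sum_j (- (inv st * (alpha j * beta j)) - 1)).
    apply: eq_bigr => j _; rewrite mulrBl floating_mulV // vb mulNr mulrN.
    by rewrite !mulrA inv_st_comm.
  by rewrite sumrB -nE sumrN -mulr_sumr sum_alpha_beta mulrN opprK trst subrr.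
transitivity (\sum_j (- (inv st * (beta j * alpha j)) - 1)).
  by apply: eq_bigr => j _; rewrite mulrBr floating_mulVl // vb !mulNr mulrA.
by rewrite sumrB -nE sumrN -mulr_sumr sum_beta_alpha sum_alpha_beta mulrN opprK trst subrr.
Qed.
End OrthogonalFrame.

Section SymmetricOrthogonalization.
Variables (R : realType) (V : vectType R) (q : V -> V -> R) (C : algType R).
Variables (Cfin : fin_codim [set (0 : C)]) (cl : {linear V -> C}) (m n : nat).
Variables (a : 'I_n.+1 -> pser m V) (c : R).
Hypotheses (hq : is_metric q) (hcl : forall v, cl v * cl v = - (q v v)%:A).
Hypotheses (c0 : 0 < c).
Hypothesis ha : forall i j, q (a i (m0 m)) (a j (m0 m)) = c * (i == j)%:R.
Local Notation B := (pser_convAlg m (reals_convAlg R)).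
Local Notation CB := (pser_convAlg m (fd_convAlg Cfin)).
Local Notation scal := (scal Cfin).
Local Notation half := (2%:R^-1 : R).

Let alpha (i : 'I_n.+1) : CB := cl_ext cl (a i).
Let S : 'M[B]_n.+1 := gram q a.
Let W : 'M[B]_n.+1 := binom_series (- half) c S.

Lemma metricDl u v x : q (u + v) x = q u x + q v x.
Proof. by case: hq => h _ _; rewrite -[u]scale1r h mul1r scale1r. Qed.

Lemma metricC u v : q u v = q v u.
Proof. by case: hq => _ h _; apply: h. Qed.

Lemma cl_polar u v : cl u * cl v + cl v * cl u = (- 2%:R * q u v) *: (1 : C).
Proof.
have := hcl (u + v); rewrite linearD mulrDl !mulrDr !hcl.
rewrite metricDl (metricC u) (metricC v) !metricDl (metricC v u) => h.
have -> : cl u * cl v + cl v * cl u =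
    (- (q u u)%:A + cl u * cl v + (cl v * cl u - (q v v)%:A)) + (q u u)%:A + (q v v)%:A.
  by zmod.
rewrite h -scaleNr -!scalerDl; congr (_ *: _); ring.
Qed.

Lemma gram_sym i j : S i j = S j i.
Proof.
rewrite !mxE; apply: pserP => d; rewrite [LHS]cauchy_swap.
by apply: eq_bigr => e _; apply: metricC.
Qed.

Lemma alpha_anti i j : alpha i * alpha j + alpha j * alpha i = (- 2%:R : R) *: scal (S i j).
Proof.
rewrite gram_sym; apply: pserP => d; rewrite [LHS]/= [X in _ + X]cauchy_swap -big_split /=.
rewrite !mxE /= /cauchy scaler_suml scaler_sumr; apply: eq_bigr => e _.
by rewrite cl_polar scalerA.
Qed.

Lemma fil1_const (x : B) : (x (m0 m) : R) = 0 -> fil B 1 x.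
Proof.
move=> x0; apply/ps_filP => d; apply/fd_filP; case: (posnP (mdeg d)) => [d0 _|]; last first.
  by case: (mdeg d) => // k _; rewrite subSS sub0n.
suff -> : d = m0 m by [].
apply/ffunP => i; rewrite ffunE; apply/eqP; rewrite -leqn0 -d0; exact: coord_mdeg.
Qed.

Lemma gram_const i j : (S i j : B) (m0 m) = c * (i == j)%:R.
Proof.
rewrite !mxE [LHS](@mbelow_only _ _ _ (m0 m)).
- by rewrite (_ : msub _ _ = m0 m) ?ha 1?eq_sym //; apply/ffunP => k; rewrite !ffunE.
- exact/mleP.
- move=> b /mleP hb /eqP[]; apply/ffunP => k; rewrite ffunE.
  by apply/eqP; rewrite -leqn0; have := hb k; rewrite ffunE.
Qed.

Lemma gram_fil : mfil 1 ((c^-1)%:A *: S - 1).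
Proof.
move=> i j; rewrite mxE [X in X + _]mxE [X in _ + X]mxE [X in - X]mxE mulr_algl; apply: fil1_const.
rewrite -[LHS]/(c^-1 * (S i j : B) (m0 m) - ((i == j)%:R : B) (m0 m)) gram_const.
have cn0 : c != 0 by rewrite gt_eqF.
rewrite (mulKf cn0); case: (i == j); rewrite /= ?subrr //.
by rewrite eqxx subrr.
Qed.

Let T : 'M[B]_n.+1 := S * W.

Lemma W_sym i j : W i j = W j i.
Proof. exact: (inv_sqrt_sym gram_fil gram_sym). Qed.

Lemma WT : W * T = 1.
Proof. exact: (inv_sqrt_sqr c0 gram_fil). Qed.

Lemma T_sym i j : T i j = T j i.
Proof.
have ST : T = W * S by apply: (inv_sqrt_comm gram_fil).
rewrite -[LHS]/((S * W) i j) ST [LHS]mxE [RHS]mxE; apply: eq_bigr => k _.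
by rewrite ps_mulC W_sym gram_sym.
Qed.

Lemma cl_ext_row_act (U : 'M[B]_n.+1) i : cl_ext cl (row_act a U i) = frame alpha U i.
Proof.
apply: pserP => d; rewrite ps_sumE [LHS]/= raddf_sum; apply: eq_bigr => j _.
rewrite raddf_sum; apply: eq_bigr => e _ /=.
by rewrite mulr_algr linearZ.
Qed.

Lemma S_const : mfil 1 (S - msigma m n c).
Proof.
have -> : S - msigma m n c = msigma m n c * ((c^-1)%:A *: S - 1).
  by rewrite msigmaE mulrBr mulr1 mulrA msigmaV // mul1r.
exact: (@mfil_mull _ _ _ 1 (msigma m n c) _ gram_fil).
Qed.

Lemma W_const : mfil 1 (W - msigma m n (c `^ (- half))).
Proof. exact: inv_sqrt_const gram_fil. Qed.

Lemma sym_orth_O_proc : c = 1 ->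
  O_proc (@Syw R n.+1) alpha (fun i => cl_ext cl (row_act a W i) : CB).
Proof.
move=> c1; rewrite (_ : (fun i => _) = frame alpha W); last first.
  by apply/funext => i; apply: cl_ext_row_act.
exact: (O_proc_frame alpha_anti W_sym T_sym WT erefl W_const c1).
Qed.

Lemma sym_conf_orth_fO_proc :
  fO_proc (@Syw R n.+1) alpha (fun i => cl_ext cl (sym_conf_orth q c a i) : CB).
Proof.
rewrite (_ : (fun i => _) = frame alpha
    ((((n.+1%:R^-1 : R)%:A : B) * \tr T) *: W)); last first.
  apply/funext => i; rewrite /sym_conf_orth -/S (binom_series_half c0 gram_fil).
  exact: cl_ext_row_act.
exact: (fO_proc_frame c0 alpha_anti W_sym T_sym WT erefl S_const W_const).
Qed.
End SymmetricOrthogonalization.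

Lemma O_PSy (R : realType) n : PSy (O_proc (@Syw R n.+1)).
Proof.
move=> V q C Cfin cl m a hq [hcl _] ha.
apply: (sym_orth_O_proc Cfin hq hcl ltr01 _ erefl) => i j.
by rewrite ha mul1r.
Qed.

Lemma fO_PSy (R : realType) n : fPSy (fO_proc (@Syw R n.+1)).
Proof.
move=> V q C Cfin cl m a c hq [hcl _] c0 ha.
exact: (sym_conf_orth_fO_proc Cfin hq hcl c0 ha).
Qed.

(** * Analytic expansions *)
Section SpeedUp.
Variables (R : realType) (A : convAlg R) (K : nat).
Hypothesis K0 : (0 < K)%N.

(** Keeping only every K-th level gives again a convenient algebra, so a conclusion about level 1 in
    all algebras is also one about level K. *)
Definition speed_fil (i : nat) : set A := fil A (K * i).

Fact speed_full x : speed_fil 0 x.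
Proof. by rewrite /speed_fil muln0; apply: fil_full. Qed.
Fact speed_lin i (c : R) x y : speed_fil i x -> speed_fil i y -> speed_fil i (c *: x + y).
Proof. exact: fil_lin. Qed.
Fact speed_decr i x : speed_fil i.+1 x -> speed_fil i x.
Proof. by apply: fil_leq; rewrite leq_mul2l leqnSn orbT. Qed.
Fact speed_mul i j x y : speed_fil i x -> speed_fil j y -> speed_fil (i + j) (x * y).
Proof. by rewrite /speed_fil mulnDr; apply: fil_mul. Qed.
Fact speed_hausdorff x : (forall i, speed_fil i x) -> x = 0.
Proof.
by move=> h; apply: fil_hausdorff => i; apply: fil_leq (h i); rewrite leq_pmull.
Qed.
Fact speed_complete (u : nat -> A) : (forall i, speed_fil i (u i.+1 - u i)) ->
  exists l, forall i, speed_fil i (l - u i).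
Proof.
move=> hu; have [l hl] : exists l, forall i k, (i <= k)%N -> fil A i (l - u k).
  apply: fil_complete_leq => i; apply: fil_leq (hu i); exact: leq_pmull.
have hd i k : (i <= k)%N -> fil A (K * i) (u k - u i).
  move=> /subnKC <-; elim: (k - i)%N => [|d IHd].
    by rewrite addn0 subrr; apply: fil_zero.
  rewrite addnS; apply: (@fil_trans _ _ _ (u (i + d)%N)) => //.
  by apply: fil_leq (hu _); rewrite leq_mul2l leq_addr orbT.
(* In the original filtration only the term of index K i is known to be close to [l] in level K i;
   the fast increments bring this back to index i. *)
exists l => i; apply: (@fil_trans _ _ _ (u (K * i)%N)); first exact: hl.
by apply: hd; rewrite leq_pmull.
Qed.

Definition speed_convAlg : convAlg R :=
  ConvAlg speed_full (fun i => fil_zero A (K * i)) speed_lin speed_decr speed_mul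
    speed_hausdorff speed_complete (fun i => fil_fin_codim A (K * i)).
End SpeedUp.

(** * Noncommutative polynomials and their homogeneous components *)

Section Monomials.
Variables (R : realType) (p n : nat).
Local Notation letter := ('I_p + 'I_n)%type.
Local Notation ncpoly := (seq (R * seq letter)).

Section Evaluation.
Variables (A : convAlg R) (Q : 'I_p -> A) (X : 'I_n -> A).

Definition letter_eval (g : letter) : A :=
  match g with inl i => Q i | inr j => X j end.
Definition mono_eval (u : seq letter) : A := \prod_(g <- u) letter_eval g.
Definition nc_eval (L : ncpoly) : A := \sum_(x <- L) x.1 *: mono_eval x.2.

Lemma mono_eval_cons g u : mono_eval (g :: u) = letter_eval g * mono_eval u.
Proof. exact: big_cons. Qed.

Lemma mono_eval_cat u v : mono_eval (u ++ v) = mono_eval u * mono_eval v.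
Proof. exact: big_cat. Qed.

Lemma nc_eval_cat L M : nc_eval (L ++ M) = nc_eval L + nc_eval M.
Proof. exact: big_cat. Qed.

Lemma nc_eval_scale (c : R) L : nc_eval [seq (c * x.1, x.2) | x <- L] = c *: nc_eval L.
Proof.
rewrite /nc_eval big_map scaler_sumr; apply: eq_bigr => x _ /=.
by rewrite scalerA.
Qed.

Lemma nc_eval_mul L M :
  nc_eval [seq (x.1 * y.1, x.2 ++ y.2) | x <- L, y <- M] = nc_eval L * nc_eval M.
Proof.
rewrite /nc_eval big_allpairs_dep mulr_suml; apply: eq_bigr => x _.
rewrite mulr_sumr; apply: eq_bigr => y _ /=.
by rewrite mono_eval_cat -scalerAl -scalerAr scalerA.
Qed.

Lemma nc_eval1 g : nc_eval [:: (1, [:: g])] = letter_eval g.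
Proof. by rewrite /nc_eval big_seq1 scale1r /mono_eval big_seq1. Qed.
End Evaluation.

Definition mono_deg (u : seq letter) : nat :=
  count (fun g => if g is inr _ then true else false) u.
Definition nc_part (r : nat) (L : ncpoly) : ncpoly := [seq x <- L | mono_deg x.2 == r].

Lemma mono_eval_fil (A : convAlg R) (Q : 'I_p -> A) X u : (forall i, fil A 1 (X i)) ->
  fil A (mono_deg u) (mono_eval Q X u).
Proof.
move=> hX; elim: u => [|[i|j] u IHu]; first exact: fil_full.
  by rewrite mono_eval_cons; apply: fil_mull.
by rewrite mono_eval_cons; exact: (fil_mul (hX j) IHu).
Qed.

Lemma nc_part_cat r L M : nc_part r (L ++ M) = nc_part r L ++ nc_part r M.
Proof. exact: filter_cat. Qed.

Lemma nc_part_scale r c L :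
  nc_part r [seq (c * x.1, x.2) | x <- L] = [seq (c * x.1, x.2) | x <- nc_part r L].
Proof. by rewrite /nc_part filter_map. Qed.

Lemma nc_eval_truncate (A : convAlg R) (Q : 'I_p -> A) X L N : (forall i, fil A 1 (X i)) ->
  fil A N (nc_eval Q X L - \sum_(r < N) nc_eval Q X (nc_part r L)).
Proof.
move=> hX; elim: L => [|[c u] L IHL].
  by rewrite big1 => [|r _]; rewrite /nc_eval big_nil ?subrr //; apply: fil_zero.
have e r : nc_eval Q X (nc_part r ((c, u) :: L)) =
   (if mono_deg u == r then c *: mono_eval Q X u else 0) + nc_eval Q X (nc_part r L).
  by rewrite /nc_part /=; case: eqP => _; rewrite ?add0r // [LHS]big_cons.
rewrite [X in X - _]big_cons (eq_bigr _ (fun r _ => e (val r))) big_split /= opprD addrACA.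
apply: fil_add => //; have [uN|Nu] := ltnP (mono_deg u) N.
  rewrite (bigD1 (Ordinal uN)) //= eqxx big1 ?addr0 ?subrr; first exact: fil_zero.
  by move=> r /eqP ru; case: eqP => // h; case: ru; apply: val_inj.
rewrite big1 ?subr0 => [|r _]; last by case: eqP => // h; move: Nu; rewrite h leqNgt ltn_ord.
by apply/fil_scale/(fil_leq Nu)/mono_eval_fil.
Qed.

Section Grading.
Variable A : convAlg R.

Definition ps_mono (r : nat) (x : A) : pser 1 A :=
  PSer (fun a : midx 1 => if a == [ffun=> r] then x else 0).

Lemma ps_mono_mul r s x y : ps_mono r x * ps_mono s y = ps_mono (r + s) (x * y).
Proof.
apply: pserP => a; case: (boolP (mle ([ffun=> r] : midx 1) a)) => ra.
  rewrite [LHS](@mbelow_only _ _ _ [ffun=> r]) //=; last first.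
    by move=> b _ /negbTE ->; rewrite mul0r.
  rewrite eqxx; have -> : (msub a [ffun=> r] == [ffun=> s]) = (a == [ffun=> (r + s)%N]).
    apply/eqP/eqP => /ffunP h; apply/ffunP => i; have := h i; rewrite !ffunE => e.
      by move/mleP: ra => /(_ i); rewrite ffunE => ri; rewrite -e subnKC.
    by rewrite e addKn.
  by case: eqP => // _; rewrite mulr0.
rewrite [LHS]big1_seq => [|b /andP[_]]; last first.
  rewrite mem_mbelow /= => ba; case: eqP => [bE|]; last by rewrite mul0r.
  by case/negP: ra; rewrite -bE.
rewrite /=; case: eqP => // aE; case/negP: ra.
by apply/mleP => i; rewrite aE !ffunE leq_addr.
Qed.

Lemma ps_mono_eval (Q : 'I_p -> A) (X : 'I_n -> A) u :
  mono_eval (fun i => ps_mono 0 (Q i) : pser_convAlg 1 A)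
    (fun j => ps_mono 1 (X j) : pser_convAlg 1 A) u =
  ps_mono (mono_deg u) (mono_eval Q X u).
Proof.
elim: u => [|g u IHu].
  rewrite /mono_eval !big_nil; apply: pserP => a /=.
  by rewrite (_ : m0 1 = [ffun=> 0%N]).
by rewrite !mono_eval_cons IHu; case: g => [i|j]; rewrite [LHS]ps_mono_mul.
Qed.
End Grading.

(* Substituting [t X] for [X] in [A[[t]]], where the filtration of [A] is sped
   up by an arbitrary factor, isolates the homogeneous components. *)
Lemma nc_part_eq0 (L : ncpoly) k :
  (forall (A : convAlg R) (Q : 'I_p -> A) X, clifford Q -> (forall i, fil A 1 (X i)) ->
     fil A k (nc_eval Q X L)) ->
  forall (A : convAlg R) (Q : 'I_p -> A) X r, clifford Q -> (r < k)%N ->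
    nc_eval Q X (nc_part r L) = 0.
Proof.
move=> hL A Q X r hQ rk; apply: fil_hausdorff => K0.
pose K := K0.+1; have Kpos : (0 < K)%N by [].
pose AK := speed_convAlg A Kpos; pose P := pser_convAlg 1 AK.
pose Q' i : P := ps_mono 0 (Q i : AK); pose X' j : P := ps_mono 1 (X j : AK).
have hQ' : clifford Q'.
  move=> i j; rewrite /Q'; apply: pserP => a.
  rewrite -[LHS]/((ps_mono 0 (Q i : AK) * ps_mono 0 (Q j : AK) : pser 1 AK) a +
    (ps_mono 0 (Q j : AK) * ps_mono 0 (Q i : AK) : pser 1 AK) a).
  rewrite !ps_mono_mul /= (_ : m0 1 = [ffun=> 0%N]) //.
  by case: eqP => _; [apply: hQ|rewrite addr0 scaler0].
(* The factor t supplies degree 1 whatever [X] is, and remains of degree 1 when the filtration of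
   [A] is sped up. *)
have hX' i : fil P 1 (X' i).
  apply/ps_filP => a /=; case: eqP => [->|_]; last exact: fil_zero.
  by rewrite /mdeg big_ord1 ffunE; exact: (@fil_full _ AK).
(* The coefficient of t^r is the component of degree r. It lies in level k - r of the sped-up
   filtration, that is, in level K (k - r) of [A], which is beyond [K0]. *)
have /ps_filP/(_ [ffun=> r]) := hL P Q' X' hQ' hX'.
have -> : (nc_eval Q' X' L : P) [ffun=> r] = nc_eval Q X (nc_part r L).
  elim: L {hL} => [|[c u] L IHL]; first by rewrite /nc_eval !big_nil.
  rewrite [nc_eval _ _ (_ :: _)]big_cons.
  transitivity (c *: (mono_eval Q' X' u : P) [ffun=> r] + (nc_eval Q' X' L : P) [ffun=> r]).
    by [].
  rewrite IHL (ps_mono_eval (A := AK)) /= /nc_part /=.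
  have -> : ([ffun=> r] == [ffun=> mono_deg u] :> midx 1) = (mono_deg u == r).
    by apply/eqP/eqP => [/ffunP/(_ ord0)|->]; rewrite ?ffunE.
  by case: eqP => _; rewrite ?scaler0 ?add0r // [RHS]big_cons.
rewrite /mdeg big_ord1 ffunE => h; apply: (@fil_leq _ A _ (K * (k - r)) _ _ h).
by rewrite (leq_trans (leqnSn K0)) // leq_pmulr // subn_gt0.
Qed.

(** The sign counts the entries of [s] up to and including [i]. It depends on neither the algebra
    nor the system, hence the order of the quantifiers. *)
Lemma cmon_flip (i : 'I_p) (s : bvec p) : exists e : bool,
  forall (A : convAlg R) (Q : 'I_p -> A), clifford Q ->
  Q i * cmon Q s = (-1 : R) ^+ e *: cmon Q [ffun j => (j == i) (+) s j].
Proof.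
suff [e he] : exists e : bool, forall (A : convAlg R) (Q : 'I_p -> A), clifford Q ->
    Q i * \prod_(j <- enum 'I_p) Q j ^+ s j =
    (-1 : R) ^+ e *: \prod_(j <- enum 'I_p) Q j ^+ ((j == i) (+) s j).
  have enE : enum 'I_p = index_enum 'I_p by rewrite enumT [RHS]unlock.
  exists e => A Q hQ; rewrite /cmon; have := he A Q hQ; rewrite enE => ->.
  by congr (_ *: _); apply: eq_bigr => j _; rewrite ffunE.
have: i \in enum 'I_p by rewrite mem_enum.
elim: (enum 'I_p) (enum_uniq 'I_p) => [|j r IHr] //= /andP[jr ur].
rewrite in_cons => /orP[/eqP ij|ir].
  exists (s i) => A Q hQ; rewrite !big_cons -ij eqxx.
  have -> : \prod_(l <- r) Q l ^+ ((l == i) (+) s l) = \prod_(l <- r) Q l ^+ s l.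
    rewrite big_seq [RHS]big_seq; apply: eq_bigr => l lr.
    by case: eqP => // li; move: jr; rewrite -ij -li lr.
  rewrite mulrA scalerAl; congr (_ * _).
  by case: (s i); rewrite /= ?expr0 ?expr1 ?mulr1 ?scale1r ?scaleN1r // clifford_sqr.
have [e he] := IHr ur ir; exists (s j (+) e) => A Q hQ; rewrite !big_cons.
have ji : j != i by apply: contraNneq jr => ->.
rewrite (negbTE ji) addFb signr_addb -scalerA scalerAr -he //.
rewrite !mulrA scalerAl; congr (_ * _).
case: (s j); rewrite /= ?expr0 ?expr1 ?mulr1 ?mul1r ?scale1r ?scaleN1r //.
by rewrite (clifford_anti hQ) 1?eq_sym.
Qed.

(** Reading from the left, a letter of the system is absorbed into the first block of exponents, and
    a letter of the perturbation opens a new, empty block in front. *)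
Lemma mono_word u : exists (e : bool) (j : {ffun 'I_(mono_deg u) -> 'I_n})
    (s : {ffun 'I_(mono_deg u).+1 -> bvec p}),
  forall (A : convAlg R) (Q : 'I_p -> A) X, clifford Q ->
  mono_eval Q X u = (-1 : R) ^+ e *: word Q X j s.
Proof.
elim: u => [|[i|j0] u [e [j [s h]]]].
- exists false, [ffun l : 'I_0 => False_rect _ (notF (ltn_ord l))], [ffun=> [ffun=> false]] => A Q X hQ.
  rewrite /word big_ord0 mulr1 expr0 scale1r /mono_eval big_nil /cmon big1 // => l _.
  by rewrite !ffunE expr0.
- have [e' he'] := cmon_flip i (s ord0).
  exists (e' (+) e), j, [ffun l => if l == ord0 then [ffun k => (k == i) (+) s ord0 k] else s l].
  move=> A Q X hQ; rewrite mono_eval_cons h //= -scalerAr /word mulrA he' //.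
  rewrite -scalerAl scalerA -signr_addb addbC; congr (_ *: (_ * _)).
    by rewrite ffunE eqxx.
  by apply: eq_bigr => l _; rewrite ffunE.
- exists e, [ffun l => if unlift ord0 l is Some l' then j l' else j0],
    [ffun l => if unlift ord0 l is Some l' then s l' else [ffun=> false]].
  move=> A Q X hQ; rewrite mono_eval_cons h //= -scalerAr /word; congr (_ *: _).
  rewrite big_ord_recl !ffunE !unlift_none liftK /=.
  have -> : cmon Q [ffun=> false] = 1.
    by rewrite /cmon big1 // => l _; rewrite ffunE expr0.
  rewrite mul1r mulrA; congr (_ * _ * _) => //.
  by apply: eq_bigr => l _; rewrite !ffunE !liftK.
Qed.

Lemma nc_part_words r (L : ncpoly) :
  exists psi : {ffun 'I_r -> 'I_n} -> {ffun 'I_r.+1 -> bvec p} -> R,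
  forall (A : convAlg R) (Q : 'I_p -> A) X, clifford Q ->
  nc_eval Q X (nc_part r L) = \sum_j \sum_s psi j s *: word Q X j s.
Proof.
elim: L => [|[c u] L [psi hpsi]].
  exists (fun _ _ => 0) => A Q X _; rewrite [LHS]big_nil big1 // => j _.
  by rewrite big1 // => s _; rewrite scale0r.
rewrite /nc_part /=; case: eqP => [ur|_]; last by exists psi.
case: _ / ur psi hpsi => psi hpsi; have [e [j [s h]]] := mono_word u.
exists (fun j' s' => (if (j' == j) && (s' == s) then c * (-1) ^+ e else 0) + psi j' s').
move=> A Q X hQ; rewrite [LHS]big_cons /= h // scalerA.
rewrite -/(nc_eval Q X _) -/(nc_part (mono_deg u) L) hpsi //.
under [RHS]eq_bigr => j' _.
  under eq_bigr => s' _ do rewrite scalerDl.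
  rewrite big_split /=; over.
rewrite big_split /=; congr (_ + _); rewrite (bigD1 j) //= (bigD1 s) //= !eqxx /=.
rewrite big1 => [|s' /negbTE ->]; last by rewrite scale0r.
rewrite big1 ?addr0 // => j' /negbTE jj'; rewrite big1 // => s' _.
by rewrite jj' /= scale0r.
Qed.
End Monomials.

(** * Approximation by polynomials common to all algebras *)

Section Approximation.
Variables (R : realType) (p n : nat).
Local Notation letter := ('I_p + 'I_n)%type.
Local Notation ncpoly := (seq (R * seq letter)).

Definition family := forall A : convAlg R, ('I_p -> A) -> ('I_n -> A) -> A.

Definition admissible (A : convAlg R) (Q : 'I_p -> A) (X : 'I_n -> A) : Prop :=
  clifford Q /\ forall i, fil A 1 (X i).

(* The polynomials do not depend on the algebra. *)
Definition approximable (F : family) : Prop :=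
  forall N, exists L : ncpoly, forall A Q X, admissible Q X ->
    fil A N (F A Q X - nc_eval Q X L).

Implicit Types F G : family.

Lemma appr_ext F G : (forall A Q X, admissible Q X -> F A Q X = G A Q X) ->
  approximable F -> approximable G.
Proof.
move=> e hF N; have [L hL] := hF N; exists L => A Q X hQX.
by rewrite -e //; apply: hL.
Qed.

Lemma appr_limit F (G : nat -> family) : (forall N, approximable (G N)) ->
  (forall N A Q X, admissible Q X -> fil A N (F A Q X - G N A Q X)) -> approximable F.
Proof.
move=> hG h N; have [L hL] := hG N N; exists L => A Q X hQX.
exact: fil_trans (h N A Q X hQX) (hL A Q X hQX).
Qed.

Lemma appr_base i : approximable (fun A Q X => Q i).
Proof.
move=> N; exists [:: (1, [:: inl i])] => A Q X _.
by rewrite nc_eval1 subrr; apply: fil_zero.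
Qed.

Lemma appr_perturbation i : approximable (fun A Q X => X i).
Proof.
move=> N; exists [:: (1, [:: inr i])] => A Q X _.
by rewrite nc_eval1 subrr; apply: fil_zero.
Qed.

Lemma appr1 : approximable (fun A Q X => 1).
Proof.
move=> N; exists [:: (1, [::])] => A Q X _.
by rewrite /nc_eval big_seq1 scale1r /mono_eval big_nil subrr; apply: fil_zero.
Qed.

Lemma appr0 : approximable (fun A Q X => 0).
Proof.
by move=> N; exists [::] => A Q X _; rewrite /nc_eval big_nil subrr; apply: fil_zero.
Qed.

Lemma appr_scale (c : R) F : approximable F -> approximable (fun A Q X => c *: F A Q X).
Proof.
move=> hF N; have [L hL] := hF N; exists [seq (c * x.1, x.2) | x <- L] => A Q X hQX.
by rewrite nc_eval_scale -scalerBr; apply/fil_scale/hL.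
Qed.

Lemma appr_add F G : approximable F -> approximable G ->
  approximable (fun A Q X => F A Q X + G A Q X).
Proof.
move=> hF hG N; have [L hL] := hF N; have [M hM] := hG N; exists (L ++ M) => A Q X hQX.
by rewrite nc_eval_cat opprD addrACA; apply: fil_add; [apply: hL|apply: hM].
Qed.

Lemma appr_opp F : approximable F -> approximable (fun A Q X => - F A Q X).
Proof.
move=> hF; apply: appr_ext (appr_scale (-1) hF) => A Q X _.
by rewrite scaleN1r.
Qed.

Lemma appr_sub F G : approximable F -> approximable G ->
  approximable (fun A Q X => F A Q X - G A Q X).
Proof. by move=> hF hG; apply: (appr_add hF (appr_opp hG)). Qed.

Lemma appr_mul F G : approximable F -> approximable G ->
  approximable (fun A Q X => F A Q X * G A Q X).
Proof.
move=> hF hG N; have [L hL] := hF N; have [M hM] := hG N.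
exists [seq (x.1 * y.1, x.2 ++ y.2) | x <- L, y <- M] => A Q X hQX.
rewrite nc_eval_mul (_ : _ - _ = (F A Q X - nc_eval Q X L) * G A Q X +
  nc_eval Q X L * (G A Q X - nc_eval Q X M)).
  by apply: fil_add; [apply/fil_mulr/hL|apply/fil_mull/hM].
by rewrite mulrBl mulrBr subrKA.
Qed.

Lemma appr_sum (I : Type) (r : seq I) (F : I -> family) : (forall i, approximable (F i)) ->
  approximable (fun A Q X => \sum_(i <- r) F i A Q X).
Proof.
move=> hF; elim: r => [|i r IHr].
  by apply: appr_ext appr0 => A Q X _; rewrite big_nil.
by apply: appr_ext (appr_add (hF i) IHr) => A Q X _; rewrite big_cons.
Qed.

Lemma appr_exp F k : approximable F -> approximable (fun A Q X => F A Q X ^+ k).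
Proof.
move=> hF; elim: k => [|k IHk]; first by apply: appr_ext appr1 => A Q X _; rewrite expr0.
by apply: appr_ext (appr_mul hF IHk) => A Q X _; rewrite exprS.
Qed.

Lemma appr_expA F : approximable F ->
  (forall A Q X, admissible Q X -> fil A 1 (F A Q X)) ->
  approximable (fun A Q X => expA (F A Q X)).
Proof.
move=> hF h1; apply: (@appr_limit _
  (fun N A Q X => \sum_(k < N) (k`!%:R : R)^-1 *: F A Q X ^+ k)) => [N|N A Q X hQX].
  by apply: (@appr_sum _ _ (fun k A Q X => _)) => k; apply/appr_scale/appr_exp.
exact: expA_fil (h1 A Q X hQX) N.
Qed.

Lemma appr_inv F : approximable F ->
  (forall A Q X, admissible Q X -> fil A 1 (F A Q X - 1)) ->
  approximable (fun A Q X => inv (F A Q X)).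
Proof.
move=> hF h1; apply: (@appr_limit _
  (fun N A Q X => \sum_(k < N) (1 - F A Q X) ^+ k)) => [N|N A Q X hQX].
  by apply: (@appr_sum _ _ (fun k A Q X => _)) => k; apply/appr_exp/appr_sub => //; apply: appr1.
exact: inv_geom (h1 A Q X hQX) N.
Qed.

Lemma appr_part (T : family) (b : bool) F : approximable T ->
  approximable (fun A Q X => inv (T A Q X)) -> approximable F ->
  approximable (fun A Q X => part (T A Q X) b (F A Q X)).
Proof.
move=> hT hT' hF; apply/appr_scale/appr_add => //.
apply: appr_mul; last by apply: appr_mul => //; apply: appr_mul.
by apply: appr_exp; apply: appr_opp; apply: appr1.
Qed.

Lemma appr_parts m (T : 'I_m -> family) (s : 'I_m -> bool) F r :
  (forall i, approximable (T i)) ->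
  (forall i, approximable (fun A Q X => inv (T i A Q X))) -> approximable F ->
  approximable (fun A Q X => parts r (fun i => T i A Q X) s (F A Q X)).
Proof.
move=> hT hT'; elim: r F => [|i r IHr] F hF //=.
by apply: (IHr (fun A Q X => part (T i A Q X) (s i) (F A Q X))); apply: appr_part.
Qed.

(** Approximating polynomials are not unique as lists; this makes the values of their components
    unique in the degrees below the precision. *)
Lemma nc_part_eq L M r N : (r < N)%N ->
  (forall (A : convAlg R) Q X, admissible Q X -> fil A N (nc_eval Q X L - nc_eval Q X M)) ->
  forall (A : convAlg R) (Q : 'I_p -> A) X, clifford Q ->
    nc_eval Q X (nc_part r L) = nc_eval Q X (nc_part r M).
Proof.
move=> rN h A Q X hQ; apply/eqP; rewrite -subr_eq0 -scaleN1r -nc_eval_scale -nc_eval_cat.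
rewrite -nc_part_scale -nc_part_cat; apply/eqP/(@nc_part_eq0 _ _ _ _ N) => // A' Q' X' hQ' hX'.
by rewrite nc_eval_cat nc_eval_scale scaleN1r; apply: h.
Qed.

Lemma appr_expansion m (F : 'I_m -> family) : (forall k, approximable (F k)) ->
  exists psi : forall r : nat, 'I_m -> {ffun 'I_r -> 'I_n} -> {ffun 'I_r.+1 -> bvec p} -> R,
  forall A Q X, admissible Q X -> forall k N,
    fil A N (F k A Q X - \sum_(r < N) \sum_(j : {ffun 'I_r -> 'I_n})
      \sum_(s : {ffun 'I_r.+1 -> bvec p}) psi r k j s *: word Q X j s).
Proof.
move=> hF; have /choice[L hL] : forall kN : 'I_m * nat, exists L : ncpoly,
    forall A Q X, admissible Q X -> fil A kN.2 (F kN.1 A Q X - nc_eval Q X L).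
  by move=> [k N]; apply: hF.
(* Coefficients of degree r are read off at precision r+1, the least that determines this component;
   [nc_part_eq] shows that higher precisions give the same values. *)
exists (fun r k => sval (cid (nc_part_words r (L (k, r.+1))))) => A Q X hQX k N.
have [hQ hX] := hQX.
rewrite (eq_bigr (fun r : 'I_N => nc_eval Q X (nc_part r (L (k, N))))) => [|r _].
  exact: fil_trans (hL (k, N) A Q X hQX) (nc_eval_truncate Q (L (k, N)) N hX).
case: cid => psi /= <- //; apply: (@nc_part_eq _ _ _ r.+1) => // A' Q' X' hQX'.
apply: (fil_trans (fil_subC _) (fil_leq (ltn_ord r) (hL (k, N) A' Q' X' hQX'))).
exact: hL (k, r.+1) A' Q' X' hQX'.
Qed.
End Approximation.

Section Analyticity.
Variables (R : realType) (n : nat) (w : weights R n).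
Hypothesis hw : connection_data w.

Let a (A : convAlg R) (Q X : 'I_n -> A) := fun i => Q i + X i.

Let Z m (k : 'I_n) : family R n n := fun A Q X => iter m (Step w (a Q X)) Q k.

Let near_base (A : convAlg R) (Q X : 'I_n -> A) : (forall i, fil A 1 (X i)) -> near (a Q X) Q.
Proof. by move=> hX i; rewrite /a addrAC subrr add0r. Qed.

Let iterate_spec m (A : convAlg R) (Q X : 'I_n -> A) : admissible Q X ->
  clifford (iter m (Step w (a Q X)) Q) /\ near (a Q X) (iter m (Step w (a Q X)) Q).
Proof.
move=> [hQ hX]; elim: m => [|m [h1 h2]]; first by split=> //; apply: near_base.
by have [] := Step_spec hw (ltn0Sn 0) h1 h2 (Pi_fil h1 w h2).
Qed.

Let appr_iterate m k : approximable (Z m k).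
Proof.
elim: m k => [|m IHm] k; first exact: appr_base.
have inv_appr i : approximable (fun A Q X => inv (Z m i Q X)).
  apply: appr_ext (appr_opp (IHm i)) => A Q X hQX.
  by have [h1 _] := iterate_spec m hQX; rewrite /Z clifford_inv.
pose P : family R n n := fun A Q X => Pi w (iter m (Step w (a Q X)) Q)
  (fun i => a Q X i - iter m (Step w (a Q X)) Q i).
have hP : approximable P.
  apply: appr_scale; apply: (@appr_sum _ _ _ _ _ (fun j A Q X => _)) => j.
  apply: (@appr_sum _ _ _ _ _ (fun s A Q X => _)) => s; apply: appr_scale.
  apply: (@appr_parts _ _ _ _ (Z m) s (fun A Q X => (a Q X j - Z m j Q X) * inv (Z m j Q X))) => //.
  apply: appr_mul => //; apply: appr_sub => //.
  by apply: appr_add; [apply: appr_base|apply: appr_perturbation].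
have P1 A Q X : admissible Q X -> fil A 1 (P A Q X).
  by move=> hQX; have [h1 h2] := iterate_spec m hQX; apply: Pi_fil.
apply: (@appr_mul _ _ _ (fun A Q X => expA (P A Q X) * Z m k Q X)
  (fun A Q X => inv (expA (P A Q X)))).
  by apply: appr_mul => //; apply: appr_expA.
apply: appr_inv; first exact: appr_expA.
by move=> A Q X hQX; apply: expA_fil1 => //; apply: P1.
Qed.

Lemma O_Ana : Ana (O_proc w).
Proof.
have hlim (A : convAlg R) (Q X : 'I_n -> A) : admissible Q X ->
    exists2 b, fixed_system w (a Q X) b &
      forall i k N, (N <= k.+1)%N -> fil A N (b i - Z k i Q X).
  by move=> [hQ hX]; apply: Step_limit => //; apply: near_base.
(* A family must be defined for all arguments, so the limit is chosen, with default value 0 when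
   there is none. *)
pose F k : family R n n := fun A Q X => xget (fun=> 0) [set b | fixed_system w (a Q X) b /\
      forall i k N, (N <= k.+1)%N -> fil A N (b i - Z k i Q X)] k.
have FP (A : convAlg R) (Q X : 'I_n -> A) : admissible Q X ->
    fixed_system w (a Q X) (fun k => F k A Q X) /\
    forall i k N, (N <= k.+1)%N -> fil A N (F i A Q X - Z k i Q X).
  move=> hQX; have [b h1 h2] := hlim A Q X hQX.
  exact: (@xgetPex _ (fun=> 0) [set b | fixed_system w (a Q X) b /\
      forall i k N, (N <= k.+1)%N -> fil A N (b i - Z k i Q X)] (ex_intro _ b (conj h1 h2))).
have [k|psi hpsi] := @appr_expansion R n n n F.
  apply: (@appr_limit _ _ _ _ (fun N => Z N k)) => [N|N A Q X hQX]; first exact: appr_iterate.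
  by have [_ h] := FP A Q X hQX; apply: h.
exists psi => A Q X hQ hX; have hQX : admissible Q X by [].
exists (fun k => F k A Q X); first by apply/O_procP => //; case: (FP A Q X hQX).
move=> k; apply: fil_cvgA => i; exists i => N iN.
exact: fil_leq iN (hpsi A Q X hQX k N).
Qed.
End Analyticity.

Section FloatingAnalyticity.
Variables (R : realType) (n : nat) (w : weights R n.+1).
Hypothesis hw : connection_data w.
Local Notation sys A := ('I_n.+1 -> A).

Let a (A : convAlg R) (Q : 'I_n -> A) (X : sys A) : sys A := fun i => fcons 1 Q i + X i.

Let Y m (A : convAlg R) (Q : 'I_n -> A) (X : sys A) : sys A :=
  iter m (fStep ord0 w (a Q X)) (fcons 1 Q).
Let Z m (k : 'I_n.+1) : family R n n.+1 := fun A Q X => Y m Q X k.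

Let near_base (A : convAlg R) (Q : 'I_n -> A) (X : sys A) : (forall i, fil A 1 (X i)) ->
  near (a Q X) (fcons 1 Q).
Proof. by move=> hX i; rewrite /a addrAC subrr add0r. Qed.

Let iterate_spec m (A : convAlg R) (Q : 'I_n -> A) (X : sys A) : admissible Q X ->
  floating (Y m Q X) /\ near (a Q X) (Y m Q X).
Proof.
move=> [hQ hX]; elim: m => [|m [h1 h2]].
  by split; [apply/fl_cliffordP/fl_clifford_fcons|apply: near_base].
by have [] := fStep_spec hw (ltn0Sn 0) h1 h2 (fPi_fil h1 hw ord0 h2).
Qed.

Let appr_fcons i : approximable (fun (A : convAlg R) (Q : 'I_n -> A) (X : sys A) => fcons 1 Q i).
Proof.
case: (unliftP ord0 i) => [j|] ->.
  by apply: appr_ext (appr_base _ _ j) => A Q X _; rewrite fconsS.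
by apply: appr_ext (appr1 _ _ _) => A Q X _; rewrite fcons0.
Qed.

Let appr_fcons_inv i : approximable (fun (A : convAlg R) (Q : 'I_n -> A) (X : sys A) => inv (fcons 1 Q i)).
Proof.
case: (unliftP ord0 i) => [j|] ->.
  apply: appr_ext (appr_opp (appr_base _ _ j)) => A Q X [hQ _].
  by rewrite fconsS clifford_inv.
by apply: appr_ext (appr1 _ _ _) => A Q X _; rewrite fcons0 inv1.
Qed.

(** The inverses of the entries are carried through the induction: unlike in the plain case they are
    not the negatives of the entries, and the next step needs them. *)
Let appr_iterate m k : approximable (Z m k) /\ approximable (fun A Q X => inv (Z m k Q X)).
Proof.
elim: m k => [|m IHm] k; first by split; [apply: appr_fcons|apply: appr_fcons_inv].
have hZ i : approximable (Z m i) by case: (IHm i).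
have hV i : approximable (fun A Q X => inv (Z m i Q X)) by case: (IHm i).
pose D i : family R n n.+1 := fun A Q X => a Q X i - Z m i Q X.
have hD i : approximable (D i).
  apply: appr_sub => //.
  by apply: appr_add; [apply: appr_fcons|apply: appr_perturbation].
pose P (A : convAlg R) (Q : 'I_n -> A) (X : sys A) := @fPi R A n.+1 ord0 w (Y m Q X) (fun i => D i A Q X).
have Pfil A Q X : admissible Q X -> fil A 1 (P A Q X).1 /\ fil A 1 (P A Q X).2.
  by move=> hQX; have [h1 h2] := iterate_spec m hQX; apply: (fPi_fil h1 hw ord0 h2).
have inv_quo i j : approximable (fun A Q X => inv (Z m i Q X * inv (Z m j Q X))).
  apply: appr_ext (appr_mul (hZ j) (hV i)) => A Q X hQX.
  have [[h1 _] _] := iterate_spec m hQX.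
  by rewrite /Z (inv_mul (h1 i) (invertible_inv (h1 j))) (inv_inv (h1 j)).
have inv_quol i j : approximable (fun A Q X => inv (inv (Z m i Q X) * Z m j Q X)).
  apply: appr_ext (appr_mul (hV j) (hZ i)) => A Q X hQX.
  have [[h1 _] _] := iterate_spec m hQX.
  by rewrite /Z (inv_mul (invertible_inv (h1 i)) (h1 j)) (inv_inv (h1 i)).
have hP1 : approximable (fun A Q X => (P A Q X).1).
  apply: appr_scale; apply: (@appr_sum _ _ _ _ _ (fun j A Q X => _)) => j.
  apply: (@appr_sum _ _ _ _ _ (fun s A Q X => _)) => s; apply: appr_scale.
  apply: (@appr_parts _ _ _ _ (fun i A Q X => Z m i Q X * inv (Z m ord0 Q X)) _
    (fun A Q X => D j A Q X * inv (Z m j Q X))) => //; last exact: appr_mul.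
  by move=> i; apply: appr_mul.
have hP2 : approximable (fun A Q X => (P A Q X).2).
  apply: appr_scale; apply: (@appr_sum _ _ _ _ _ (fun j A Q X => _)) => j.
  apply: (@appr_sum _ _ _ _ _ (fun s A Q X => _)) => s; apply: appr_scale.
  apply: (@appr_parts _ _ _ _ (fun i A Q X => inv (Z m ord0 Q X) * Z m i Q X) _
    (fun A Q X => inv (Z m j Q X) * D j A Q X)) => //; last exact: appr_mul.
  by move=> i; apply: appr_mul.
have e1 : approximable (fun A Q X => expA (P A Q X).1).
  by apply: (@appr_expA _ _ _ (fun A Q X => (P A Q X).1)) => // A Q X /Pfil[].
have e2 : approximable (fun A Q X => expA (P A Q X).2).
  by apply: (@appr_expA _ _ _ (fun A Q X => (P A Q X).2)) => // A Q X /Pfil[].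
split.
  apply: (@appr_mul _ _ _ (fun A Q X => expA (P A Q X).1 * Z m k Q X)
    (fun A Q X => expA (P A Q X).2)) => //.
  exact: appr_mul.
have ev1 : approximable (fun A Q X => inv (expA (P A Q X).1)).
  by apply: appr_inv => // A Q X /Pfil[h _]; apply: expA_fil1.
have ev2 : approximable (fun A Q X => inv (expA (P A Q X).2)).
  by apply: appr_inv => // A Q X /Pfil[_ h]; apply: expA_fil1.
apply: appr_ext (appr_mul (appr_mul ev2 (hV k)) ev1) => A Q X hQX.
have [h1 h2] := Pfil A Q X hQX; have [hY _] := iterate_spec m hQX.
by have [_ ->] := floating_fAd (invertible_expA h1) (invertible_expA h2) hY.
Qed.

Lemma fO_expansion_base : exists psi : coefficients R n.+1 n,
  forall (A : convAlg R) (Q : 'I_n -> A) (X : sys A), admissible Q X ->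
  exists2 b, fO_proc w (fun i => fcons 1 Q i + X i) b &
    forall k N, fil A N (b k - expansion psi Q X k N).
Proof.
have hlim (A : convAlg R) (Q : 'I_n -> A) (X : sys A) : admissible Q X ->
    exists2 b, ffixed_system w ord0 (a Q X) b &
      forall i k N, (N <= k.+1)%N -> fil A N (b i - Z k i Q X).
  move=> [hQ hX]; apply: fStep_limit => //; last exact: near_base.
  exact/fl_cliffordP/fl_clifford_fcons.
pose F k : family R n n.+1 := fun A Q X => xget (fun=> 0) [set b | ffixed_system w ord0 (a Q X) b /\
      forall i k N, (N <= k.+1)%N -> fil A N (b i - Z k i Q X)] k.
have FP (A : convAlg R) (Q : 'I_n -> A) (X : sys A) : admissible Q X ->
    ffixed_system w ord0 (a Q X) (fun k => F k A Q X) /\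
    forall i k N, (N <= k.+1)%N -> fil A N (F i A Q X - Z k i Q X).
  move=> hQX; have [b h1 h2] := hlim A Q X hQX.
  exact: (@xgetPex _ (fun=> 0) [set b | ffixed_system w ord0 (a Q X) b /\
      forall i k N, (N <= k.+1)%N -> fil A N (b i - Z k i Q X)] (ex_intro _ b (conj h1 h2))).
have [k|psi hpsi] := @appr_expansion R n n.+1 n.+1 F.
  apply: (@appr_limit _ _ _ _ (fun N => Z N k)) => [N|N A Q X hQX]; first by case: (appr_iterate N k).
  by have [_ h] := FP A Q X hQX; apply: h.
exists psi => A Q X hQX; exists (fun k => F k A Q X); last exact: hpsi.
by apply/fO_procP => //; case: (FP A Q X hQX).
Qed.

(* Biv reduces to the systems starting with 1. *)
Lemma fO_Ana : fAna (fO_proc w).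
Proof.
have [psi hpsi] := fO_expansion_base; exists psi => A Q X [i0 hT] hX.
have [|b hb hexp] := hpsi A (fl_tail Q) (fun i => X i * inv (Q ord0)).
  by split=> // i; apply: fil_mulr.
exists (fun k => b k * Q ord0); last first.
  move=> k; apply: fil_cvgA => i; exists i => N iN; rewrite -mulrBl.
  by apply/fil_mulr/(fil_leq iN)/hexp.
have := fO_Biv hw (invertible1 A) i0 hb.
congr (fO_proc w _ _); apply/funext => i; rewrite mul1r //.
rewrite mulrDl -mulrA invertible_mulVl // mulr1; congr (_ + _).
case: (unliftP ord0 i) => [j|] ->; last by rewrite fcons0 mul1r.
by rewrite fconsS /fl_tail -mulrA invertible_mulVl // mulr1.
Qed.
End FloatingAnalyticity.

Theorem theorem5p6 (R : realType) (n : nat) (w : weights R n.+1)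
    (hw : connection_data w) :
  [/\ FQ_orthogonalization (O_proc w),
      vL (O_proc w) /\ vC (O_proc w) /\ H0 (O_proc w),
      FSt (O_proc w),
      w = @GSw R n.+1 ->
        restriction (fun A => @dom R A n.+1) (@O_GS R n.+1) (O_proc w) &
      w = @Syw R n.+1 ->
        PSy (O_proc w) /\ Sigma (O_proc w) /\ Orth (O_proc w)] /\
  [/\ FQ_conform_orthogonalization (fO_proc w),
      vL (fO_proc w) /\ fvC (fO_proc w),
      FSt (fO_proc w),
      w = @GSw R n.+1 ->
        restriction (fun A => @fdom R A n) (@O_fGS R n) (fO_proc w) &
      w = @Syw R n.+1 ->
        fPSy (fO_proc w) /\ Sigma (fO_proc w) /\ Orth (fO_proc w)].
Proof.
split; split.
- by split; [exact: O_vR|exact: O_Frm|exact: O_Ana|exact: O_Nat|exact: O_CP].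
- by split; [exact: O_vL|split; [exact: O_vC|exact: O_H0]].
- exact: O_FSt.
- by move=> -> A a b; exact: O_GS_restriction_aux.
- move=> hS; split; first by rewrite hS; exact: O_PSy.
  by split; [exact: O_Sigma|exact: O_Orth].
- split; last by split; [exact: fO_Nat|exact: fO_CP].
  by split; [exact: fO_vR|exact: fO_Biv|exact: fO_Frm|exact: fO_Ana].
- by split; [exact: fO_vL|exact: fO_vC].
- exact: fO_FSt.
- by move=> -> A a b; exact: fO_GS_restriction_aux.
- move=> hS; split; first by rewrite hS; exact: fO_PSy.
  by split; [exact: fO_Sigma|exact: fO_Orth].
Qed.
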